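(* For all $r\ge 0$ and all $G\in\mathcal{A}_r$, $\mathrm{CL}_G(n)\simeq n$.
   Context: Let $\Lambda=\{\lambda_1,\lambda_2,\ldots\}$ be a countable alphabet. $\mathcal{A}_0$ is the set of finitely generated free groups with free basis contained in $\Lambda$. Inductively, $\mathcal{A}_r$ is the union of $\mathcal{A}_{r-1}$ with the set of amalgamated free products $G_1\ast_C G_2$, where $G_1,G_2\in\mathcal{A}_{r-1}$ and $C$ is an infinite cyclic group embedding into $G_1$ and $G_2$ (all cyclic groups are by convention infinite). For a group $G=\langle X\mid R\rangle$ with finite presentation, $|g|$ denotes the word length of $g\in G$ with respect to $X^{\pm1}$. For conjugate $u,v\in G$ put $c(u,v)=\min\{|\gamma| : \gamma u\gamma^{-1}=v\}$. The conjugator length function is $\mathrm{CL}_G(n)=\max c(u,v)$, the maximum being over all conjugate pairs $u,v\in G$ with $|u|+|v|\le n$. For non-decreasing $f,g:\mathbb{N}\to\mathbb{N}$ write $f(n)\preceq g(n)$ if there is $C>0$ with $f(n)\le C g(Cn+C)+Cn+C$ for all $n\in\mathbb{N}$, and $f(n)\simeq g(n)$ if $f\preceq g$ and $g\preceq f$; up to $\simeq$, $\mathrm{CL}_G$ does not depend on the finite presentation. *)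

(* Defs.v *)
From HB Require Import structures.
From mathcomp Require Import all_boot.
From mathcomp Require Import finmap.
From mathcomp Require Import boolp classical_sets cardinality.

Set Implicit Arguments.
Unset Strict Implicit.
Unset Printing Implicit Defensive.

Local Open Scope group_scope.

(* A word over X^{+1,-1}; the letter (a, true) stands for a, (a, false) for
   a^-1. *)
Definition word (X : Type) := seq (X * bool).

Definition weval (X : Type) (G : groupType) (x : X -> G) (w : word X) : G :=
  \prod_(l <- w) (if l.2 then x l.1 else (x l.1)^-1).

(* Group homomorphisms are the {multiplicative G -> H}: between groups,
   preservation of products implies preservation of 1 and of inverses.
   Free bases, presentations and amalgams are all given by their universal
   properties, hence are determined up to isomorphism. *)

Definition free_basis (X : Type) (G : groupType) (b : X -> G) : Prop :=
  forall (H : groupType) (f : X -> H),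
    (exists phi : {multiplicative G -> H}, forall a, phi (b a) = f a) /\
    (forall phi psi : {multiplicative G -> H},
       (forall a, phi (b a) = f a) -> (forall a, psi (b a) = f a) ->
       phi =1 psi).

(* G = < X | R >, the letter a of X naming the element x a of G. *)
Definition presentation (X : finType) (R : seq (word X)) (G : groupType)
    (x : X -> G) : Prop :=
  (forall w, w \in R -> weval x w = 1) /\
  forall (H : groupType) (f : X -> H),
    (forall w, w \in R -> weval f w = 1) ->
    (exists phi : {multiplicative G -> H}, forall a, phi (x a) = f a) /\
    (forall phi psi : {multiplicative G -> H},
       (forall a, phi (x a) = f a) -> (forall a, psi (x a) = f a) ->
       phi =1 psi).

Definition finitely_presented (G : groupType) : Prop :=
  exists (X : finType) (R : seq (word X)) (x : X -> G), presentation R x.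

Definition infinite_cyclic (C : groupType) : Prop :=
  (exists c : C, forall y : C, exists n : nat, y = c ^+ n \/ y = c ^- n) /\
  infinite_set [set: C].

(* G, with i1 : G1 -> G and i2 : G2 -> G, is the pushout of the embeddings e1
   and e2 of C. *)
Definition amalgam (C G1 G2 G : groupType)
    (e1 : {multiplicative C -> G1}) (e2 : {multiplicative C -> G2})
    (i1 : {multiplicative G1 -> G}) (i2 : {multiplicative G2 -> G}) : Prop :=
  [/\ injective e1, injective e2,
      forall c, i1 (e1 c) = i2 (e2 c) &
      forall (H : groupType)
        (f1 : {multiplicative G1 -> H}) (f2 : {multiplicative G2 -> H}),
        (forall c, f1 (e1 c) = f2 (e2 c)) ->
        (exists phi : {multiplicative G -> H},
           (forall y, phi (i1 y) = f1 y) /\ (forall y, phi (i2 y) = f2 y)) /\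
        (forall phi psi : {multiplicative G -> H},
           (forall y, phi (i1 y) = f1 y) -> (forall y, phi (i2 y) = f2 y) ->
           (forall y, psi (i1 y) = f1 y) -> (forall y, psi (i2 y) = f2 y) ->
           phi =1 psi)].

Fixpoint calA (Lambda : countType) (r : nat) (G : groupType) : Prop :=
  match r with
  | 0 => exists (S : {fset Lambda}) (b : S -> G), free_basis b
  | r'.+1 =>
      calA Lambda r' G \/
      exists (G1 G2 C : groupType)
        (e1 : {multiplicative C -> G1}) (e2 : {multiplicative C -> G2})
        (i1 : {multiplicative G1 -> G}) (i2 : {multiplicative G2 -> G}),
        [/\ calA Lambda r' G1, calA Lambda r' G2, infinite_cyclic C &
            amalgam e1 e2 i1 i2]
  end.

(* The default value 0 is used only when there is no minimum (A empty), resp.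
   no maximum (A empty or unbounded). *)
Definition nat_min (A : set nat) : nat :=
  xget 0 [set m | A m /\ forall k, A k -> m <= k].
Definition nat_max (A : set nat) : nat :=
  xget 0 [set m | A m /\ forall k, A k -> k <= m].

Section ConjugatorLength.
Variables (X : finType) (G : groupType) (x : X -> G).

Definition wlen (g : G) : nat :=
  nat_min [set m | exists w : word X, weval x w = g /\ size w = m].

Definition conjugate (u v : G) : Prop := exists t : G, t * u * t^-1 = v.

Definition conj_dist (u v : G) : nat :=
  nat_min [set m | exists t : G, t * u * t^-1 = v /\ wlen t = m].

Definition CL (n : nat) : nat :=
  nat_max [set m | exists u v : G,
    [/\ conjugate u v, wlen u + wlen v <= n & conj_dist u v = m]].

End ConjugatorLength.

Definition preceq (f g : nat -> nat) : Prop :=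
  exists2 C : nat, 0 < C & forall n, f n <= C * g (C * n + C) + C * n + C.

Definition simeq (f g : nat -> nat) : Prop := preceq f g /\ preceq g f.

(* Main.v *)
(** Three properties of a group are carried through the amalgams. (1) For
    finitely many elements there is a single length function growing like
    [k m + O(1)], [k > 0], along the powers [h ^ m] of each nontrivial one of
    them. (2) For nontrivial [h], [h'], an equality [h ^ a u h' ^ b = v] bounds
    [|a|] linearly by the lengths of [u] and [v], unless [u] conjugates a bounded
    power of [h'] to a bounded power of [h]. (3) Conjugators can be chosen of
    linear length. Free groups are covered as amalgams of infinite cyclic groups
    over the trivial group.

    In an amalgam over [<c>], (1) makes it possible to modify length functions of
    the factors so that both give [k |z|] on [c ^ z]; reduction of words then does
    not increase their total length, so reduced words of elements are linearly
    short. Giving the finitely many syllables occurring in chosen cyclically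
    reduced words the least length among all syllables makes such words exactly
    geodesic along with all their powers, which is (1) again.

    For (2) and (3), two reduced words for one element differ by a sequence of
    edge elements [c ^ f]. By (2) in the factors, a syllable across which a large
    [f] is carried commensurates [<c>]. If [h], [h'] are cyclically reduced of
    syllable length at least 2, either [f] stays bounded along the periods and
    takes the same value twice, or all syllables commensurate [<c>] and [f] repeats
    modulo a fixed [p]; a repetition up to a nontrivial multiple of [p] makes [f]
    drift linearly, which bounds [a]. *)

Require Import Defs.
From HB Require Import structures.
From mathcomp Require Import all_boot ssralg ssrint intdiv zmodp.
From mathcomp Require Import finmap zify.
From mathcomp Require Import boolp classical_sets.

Set Implicit Arguments.
Unset Strict Implicit.
Unset Printing Implicit Defensive.

Local Open Scope group_scope.

(** Lengths are arbitrary subadditive symmetric functions vanishing at 1, not word metrics. Each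
    estimate asks only for some [l], and on a finitely generated group every [l] is at most a
    multiple of the word length. So lengths of the factors may be added, rescaled and maximized
    freely, and their generators never enter the induction. Only the upper bound on [CL] has
    content, as [preceq] tolerates linear terms.

    Short conjugators in the factors alone do not suffice: an equality of reduced words leaves an
    unknown power of [c] between consecutive syllables, which may be long although all syllables are
    short. Property (2) confines this to syllables conjugating a power of [c] to a power of [c].
    Property (1) forces such a syllable to keep the exponent up to sign, which excludes relations as
    in the Baumslag-Solitar group BS(1,2), where powers are distorted. Hence one exponent [p] serves
    all of these syllables at once, and only a sign and a residue modulo [p] remain to be
    controlled. *)

Lemma nat_minP (A : set nat) k : A k ->
  A (nat_min A) /\ forall m, A m -> nat_min A <= m.
Proof.
move=> Ak; pose p := fun m => `[< A m >].
have exp : exists m, p m by exists k; apply/asboolP.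
case: (ex_minnP exp) => m /asboolP Am minm.
have : [set m | A m /\ forall k, A k -> m <= k]%classic m.
  by split=> // j Aj; apply: minm; apply/asboolP.
by move=> /(xgetI 0).
Qed.

(* The magma structure of a group is reached along several inheritance paths;
   [lia] needs the resulting convertible terms to be syntactically equal. *)
Ltac norm_group G := repeat match goal with
  | |- context [@mul ?M ?x ?y] =>
      progress change (@mul M x y) with (@mul (monoid_Group__to__monoid_Magma G) x y)
  | |- context [@natexp ?M ?x ?n] =>
      progress change (@natexp M x n)
        with (@natexp (monoid_Group__to__monoid_BaseUMagma G) x n)
  | |- context [@inv ?M ?x] =>
      progress change (@inv M x) with (@inv (monoid_Group__to__monoid_BaseGroup G) x)
  end.

Ltac glia :=
  repeat match goal with H : is_true (leq _ _) |- _ => revert H end;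
  match goal with G : groupType |- _ => norm_group G end; lia.

Lemma gmulA (G : groupType) (x y z : G) : x * (y * z) = x * y * z.
Proof. exact: mulgA. Qed.

Lemma ginvM (G : groupType) (x y : G) : (x * y)^-1 = y^-1 * x^-1.
Proof. exact: invgM. Qed.

(** * Integer powers and intertwining relations *)

Section Zpow.
Variable G : groupType.
Implicit Types (x y t : G) (a b z : int) (n m : nat).

Definition zpow x z : G :=
  match z with Posz n => x ^+ n | Negz n => x ^- n.+1 end.

Lemma zpow_nat x n : zpow x n%:Z = x ^+ n. Proof. by []. Qed.
Lemma zpow0 x : zpow x 0 = 1. Proof. by []. Qed.
Lemma zpowN x z : zpow x (- z)%R = (zpow x z)^-1.
Proof.
case: z => [[|n]|n] /=; first by rewrite expg0 invg1.
- by [].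
- by rewrite invgK.
Qed.

Lemma zpowS x z : zpow x (z + 1)%R = zpow x z * x.
Proof.
case: z => n.
  by rewrite -PoszD addn1 /= expgSr.
have -> : (Negz n + 1 = - n%:Z)%R by lia.
by rewrite zpowN /= expgS invgM mulgVK.
Qed.

Lemma zpowB1 x z : zpow x (z - 1)%R = zpow x z * x^-1.
Proof.
have {2}-> : (z = (z - 1) + 1)%R by lia.
by rewrite zpowS mulgK.
Qed.

Lemma zpowD x a b : zpow x (a + b)%R = zpow x a * zpow x b.
Proof.
case: b => n.
  elim: n => [|n IH]; first by rewrite GRing.addr0 zpow0 mulg1.
  have -> : (a + n.+1%:Z = (a + n%:Z) + 1)%R by lia.
  by rewrite zpowS IH -mulgA -zpowS -PoszD addn1.
elim: n => [|n IH].
  have -> : (a + Negz 0 = a - 1)%R by lia.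
  by rewrite zpowB1.
have -> : (a + Negz n.+1 = (a + Negz n) - 1)%R by lia.
rewrite zpowB1 IH -mulgA -zpowB1; congr (_ * zpow x _); lia.
Qed.

Lemma zpowB x a b : zpow x (a - b)%R = zpow x a * (zpow x b)^-1.
Proof. by rewrite zpowD zpowN. Qed.

Lemma zpow1g z : zpow 1 z = 1.
Proof. by case: z => n /=; rewrite expg1n ?invg1. Qed.

Lemma zpowC x a b : zpow x a * zpow x b = zpow x b * zpow x a.
Proof. by rewrite -!zpowD GRing.addrC. Qed.

Lemma zpowM x a b : zpow x (a * b)%R = zpow (zpow x a) b.
Proof.
case: b => n.
  elim: n => [|n IH]; first by rewrite GRing.mulr0.
  have -> : (a * n.+1%:Z = a * n%:Z + a)%R by lia.
  by rewrite zpowD IH /= -expgSr.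
have -> : (a * Negz n = - (a * n.+1%:Z))%R by lia.
rewrite zpowN; congr _^-1.
elim: n => [|n IH]; first by rewrite GRing.mulr1.
have -> : (a * n.+2%:Z = a * n.+1%:Z + a)%R by lia.
by rewrite zpowD IH -expgSr.
Qed.

Lemma expg_zpow x n z : zpow (x ^+ n) z = zpow x (n%:Z * z)%R.
Proof. by rewrite zpowM. Qed.

Lemma zpowV x z : zpow x^-1 z = zpow x (- z)%R.
Proof.
have -> : x^-1 = zpow x (-1)%R by rewrite zpowN.
by rewrite -zpowM; congr zpow; lia.
Qed.

Lemma zpow_intertwine t x y z : t * x = y * t -> t * zpow x z = zpow y z * t.
Proof.
move=> E.
have Xn n : t * x ^+ n = y ^+ n * t.
  elim: n => [|n IH]; first by rewrite !expg0 mulg1 mul1g.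
  by rewrite expgS mulgA E -mulgA IH mulgA -expgS.
case: z => n /=; first exact: Xn.
apply: (mulgI (y ^+ n.+1)); apply: (mulIg (x ^+ n.+1)).
by rewrite mulVKg mulgA mulgVK Xn.
Qed.

Lemma expg_intertwine t x y n : t * x = y * t -> t * x ^+ n = y ^+ n * t.
Proof. exact: (@zpow_intertwine t x y n). Qed.

Lemma conj_intertwine t x y : t * x * t^-1 = y -> t * x = y * t.
Proof. by move=> <-; rewrite mulgVK. Qed.

Lemma intertwine_conj t x y : t * x = y * t -> t * x * t^-1 = y.
Proof. by move=> ->; rewrite mulgK. Qed.

Lemma intertwineM t1 t2 x y (z : G) : t1 * y = z * t1 -> t2 * x = y * t2 ->
  (t1 * t2) * x = z * (t1 * t2).
Proof. by move=> E1 E2; rewrite -gmulA E2 !gmulA E1. Qed.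

Lemma intertwineV t x y : t * x = y * t -> t^-1 * y = x * t^-1.
Proof.
by move=> E; apply: (mulgI t); apply: (mulIg t); rewrite !gmulA mulgV mul1g mulgVK.
Qed.

Lemma expgC x n m : x ^+ n * x ^+ m = x ^+ m * x ^+ n.
Proof. by rewrite -!expgnDr addnC. Qed.

Lemma zpow_conj t x z : zpow (t * x * t^-1) z = t * zpow x z * t^-1.
Proof.
by apply/esym/intertwine_conj/zpow_intertwine; rewrite mulgVK.
Qed.

Lemma expg_conj t x n : (t * x * t^-1) ^+ n = t * x ^+ n * t^-1.
Proof. exact: (zpow_conj t x n). Qed.

End Zpow.

Lemma gmulfz (G H : groupType) (f : {multiplicative G -> H}) x z :
  f 1 = 1 -> f (zpow x z) = zpow (f x) z.
Proof.
move=> f1.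
have fX n : f (x ^+ n) = f x ^+ n.
  by elim: n => [|n IH] //; rewrite !expgS gmulfM IH.
case: z => n /=; first exact: fX.
by apply: (mulIg (f x ^+ n.+1)); rewrite -fX -gmulfM !mulVg f1.
Qed.

Lemma hom1 (G H : groupType) (f : {multiplicative G -> H}) : f 1 = 1.
Proof. by apply: (mulgI (f 1)); rewrite -gmulfM !mulg1. Qed.

Lemma homV (G H : groupType) (f : {multiplicative G -> H}) x :
  f x^-1 = (f x)^-1.
Proof. by apply: (mulIg (f x)); rewrite -gmulfM !mulVg hom1. Qed.

(** * Length functions on groups *)

Section LengthFunctions.
Variable G : groupType.
Implicit Types (x y t h u v : G) (l : G -> nat) (P : G -> Prop).

Definition subgrp P : Prop :=
  [/\ P 1, forall x y, P x -> P y -> P (x * y) & forall x, P x -> P x^-1].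

Definition lenfun P l : Prop :=
  [/\ l 1 = 0, forall x y, P x -> P y -> l (x * y) <= l x + l y &
      forall x, P x -> l x^-1 = l x].

Definition wprod (s : seq G) : G := foldr (fun x y => x * y) 1 s.

Lemma wprod_cat s1 s2 : wprod (s1 ++ s2) = wprod s1 * wprod s2.
Proof. by elim: s1 => [|a s IH] /=; rewrite ?mul1g // IH mulgA. Qed.

Lemma wprod1 x : wprod [:: x] = x. Proof. by rewrite /= mulg1. Qed.

Lemma wprod_rcons s x : wprod (rcons s x) = wprod s * x.
Proof. by rewrite -cats1 wprod_cat wprod1. Qed.

Definition winv (s : seq G) : seq G := rev [seq x^-1 | x <- s].

Lemma wprod_winv s : wprod (winv s) = (wprod s)^-1.
Proof.
elim: s => [|a s IH]; first by rewrite /= invg1.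
by rewrite /winv /= rev_cons wprod_rcons -/(winv s) IH invgM.
Qed.

Section Subgroup.
Variable P : G -> Prop.
Hypothesis sP : subgrp P.

Lemma subgrp1 : P 1. Proof. by case: sP. Qed.
Lemma subgrpM x y : P x -> P y -> P (x * y). Proof. by case: sP => _ h _; apply: h. Qed.
Lemma subgrpV x : P x -> P x^-1. Proof. by case: sP => _ _; apply. Qed.

Lemma subgrpMl x y : P x -> P (x * y) -> P y.
Proof. by move=> Px Pxy; rewrite -(mulKg x y); apply: subgrpM => //; apply: subgrpV. Qed.

Lemma subgrpMr x y : P y -> P (x * y) -> P x.
Proof. by move=> Py Pxy; rewrite -(mulgK y x); apply: subgrpM => //; apply: subgrpV. Qed.

Lemma subgrpX x n : P x -> P (x ^+ n).
Proof.
by move=> Px; elim: n => [|n IH]; [apply: subgrp1 | rewrite expgS; apply: subgrpM].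
Qed.

Lemma subgrpZ x z : P x -> P (zpow x z).
Proof. by case: z => n Px /=; [|apply: subgrpV]; apply: subgrpX. Qed.

Lemma subgrpJ t x : P t -> P x -> P (t * x * t^-1).
Proof. by move=> Pt Px; apply: subgrpM; [apply: subgrpM|apply: subgrpV]. Qed.

Variable l : G -> nat.
Hypothesis ll : lenfun P l.

Lemma len1 : l 1 = 0. Proof. by case: ll. Qed.
Lemma lenM x y : P x -> P y -> l (x * y) <= l x + l y.
Proof. by case: ll => _ h _; apply: h. Qed.
Lemma lenV x : P x -> l x^-1 = l x. Proof. by case: ll => _ _; apply. Qed.

Lemma lenX x n : P x -> l (x ^+ n) <= n * l x.
Proof.
move=> Px; elim: n => [|n IH]; first by rewrite expg0 len1.
by rewrite expgS mulSn; apply: leq_trans (lenM _ _) _ => //;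
   [apply: subgrpX | rewrite leq_add2l].
Qed.

Lemma lenZ x z : P x -> l (zpow x z) <= absz z * l x.
Proof.
case: z => n Px /=; first exact: lenX.
by rewrite lenV ?NegzE ?abszN; [apply: lenX | apply: subgrpX].
Qed.

Lemma lenMr x y : P x -> P y -> l x <= l (x * y) + l y.
Proof.
move=> Px Py; have := lenM (subgrpM Px Py) (subgrpV Py).
by rewrite mulgK lenV.
Qed.

Lemma lenMl x y : P x -> P y -> l y <= l x + l (x * y).
Proof.
move=> Px Py; have := lenM (subgrpV Px) (subgrpM Px Py).
by rewrite mulKg lenV.
Qed.

Lemma len3 x y t : P x -> P y -> P t -> l (x * y * t) <= l x + l y + l t.
Proof.
move=> Px Py Pt; apply: leq_trans (lenM _ _) _ => //; first exact: subgrpM.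
by rewrite leq_add2r; apply: lenM.
Qed.

Lemma lenfun_scale k : lenfun P (fun x => k * l x)%N.
Proof.
split=> [|x y Px Py|x Px]; first by rewrite len1 muln0.
- by rewrite -mulnDr leq_mul2l lenM ?orbT.
- by rewrite lenV.
Qed.

End Subgroup.

Lemma lenfun0 P : lenfun P (fun=> 0). Proof. by []. Qed.

Lemma lenfunD P l1 l2 : lenfun P l1 -> lenfun P l2 ->
  lenfun P (fun x => l1 x + l2 x).
Proof.
move=> [a1 a2 a3] [b1 b2 b3]; split=> [|x y Px Py|x Px].
- by rewrite a1 b1.
- by rewrite addnACA leq_add ?a2 ?b2.
- by rewrite a3 ?b3.
Qed.

(** [k] is the translation length of [h], the limit of [l (h ^+ m) / m]. Its positivity says that
    [h] is undistorted, in particular of infinite order. *)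
Definition tame l h : Prop :=
  exists k K : nat, (h <> 1 -> 0 < k) /\
    forall m, (k * m <= l (h ^+ m) + K /\ l (h ^+ m) <= k * m + K)%N.

(** Subadditivity removes the additive error: a deficit at [m] would be multiplied by [K.+1] at the
    exponent [m * K.+1] and exceed [K] there. *)
Lemma tame_lower P l h k K : subgrp P -> lenfun P l -> P h ->
  (forall m, k * m <= l (h ^+ m) + K)%N -> forall m, (k * m <= l (h ^+ m))%N.
Proof.
move=> sP ll Ph H m; rewrite leqNgt; apply/negP => lt.
have h1 := H (m * K.+1)%N.
have h2 : l (h ^+ (m * K.+1)) <= K.+1 * l (h ^+ m).
  by rewrite expgnA; apply: (lenX sP ll); apply: subgrpX.
nia.
Qed.

Lemma tame_zpow P l h k K : subgrp P -> lenfun P l -> P h ->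
  (forall m, k * m <= l (h ^+ m) + K)%N ->
  forall z, (k * absz z <= l (zpow h z))%N.
Proof.
move=> sP ll Ph /(tame_lower sP ll Ph) H; case=> n; first exact: H.
by rewrite NegzE abszN /= (lenV ll); [apply: H | apply: subgrpX].
Qed.

Definition bcomm B h h' u : Prop :=
  exists (p : nat) (q : int),
    [/\ 0 < p <= B, 0 < absz q <= B & u * h' ^+ p = zpow h q * u].

Definition undistorted P : Prop :=
  forall F : seq G, (forall h, h \in F -> P h) ->
  exists2 l, lenfun P l & forall h, h \in F -> tame l h.

Definition commens_bound P h h' : Prop :=
  exists2 l, lenfun P l & exists B, forall (a b : int) u, P u ->
    absz a <= l u + l (zpow h a * u * zpow h' b) + B \/ bcomm B h h' u.

Definition linear_commens P : Prop :=
  forall h h', P h -> P h' -> h <> 1 -> h' <> 1 -> commens_bound P h h'.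

(** The quantification over [l'] is what the induction needs: an amalgam measures conjugators taken
    from its factors by the restriction of its own length, which is unknown when the factor is
    treated. *)
Definition linear_conj P : Prop :=
  forall l', lenfun P l' -> exists2 l, lenfun P l &
  exists K, forall u v t, P u -> P v -> P t -> t * u * t^-1 = v ->
    exists t', [/\ P t', t' * u * t'^-1 = v & l' t' <= l u + l v + K].

Definition good P : Prop :=
  [/\ subgrp P, undistorted P, linear_commens P & linear_conj P].

Lemma undistorted_zpow P h : subgrp P -> undistorted P -> P h -> h <> 1 ->
  exists2 l, lenfun P l & forall z, absz z <= l (zpow h z).
Proof.
move=> sP uP Ph h1; case: (uP [:: h]) => [x|l ll tl].
  by rewrite inE => /eqP ->.
case: (tl h (mem_head _ _)) => k [K [/(_ h1) k0 H]]; exists l => // z.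
apply: leq_trans (tame_zpow sP ll Ph (fun m => proj1 (H m)) z).
by rewrite leq_pmull.
Qed.

Lemma undistorted_zpow_inj P h : subgrp P -> undistorted P -> P h -> h <> 1 ->
  injective (zpow h).
Proof.
move=> sP uP Ph h1 a b E; have [l ll H] := undistorted_zpow sP uP Ph h1.
have := H (a - b)%R; rewrite zpowB E mulgV (len1 ll); lia.
Qed.

End LengthFunctions.

(** * Reduced words in an amalgam *)

Section ReducedWords.
Variables (G : groupType) (I : finType) (i0 : I) (P : I -> G -> Prop) (c : G).
Implicit Types (x y z u v : G) (s t : seq G) (i j : I).

Definition edge x : Prop := exists a : int, x = zpow c a.

(** Meaningful on syllables only: edge elements lie in every vertex group, and elements outside all
    of them get the default [i0]. *)
Definition idx x : I := odflt i0 [pick i | `[< P i x >]].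

Definition syllable x : bool := `[< (exists i, P i x) /\ ~ edge x >].

Definition reduced s : bool :=
  all syllable s && sorted (fun x y => idx x != idx y) s.

(* [G] is the amalgam of its subgroups [P i] over [<c>], expressed by the normal
   form property instead of a universal property. The case [c = 1] of a free
   product is included. *)
Record splitting : Prop := Splitting {
  spl_sub : forall i, subgrp (P i);
  spl_edge : forall i, P i c;
  spl_cap : forall i j x, P i x -> P j x -> i <> j -> edge x;
  spl_gen : forall g, exists s, (forall x, x \in s -> exists i, P i x) /\
                                wprod s = g;
  spl_red : forall i s, reduced s -> 1 < size s -> ~ P i (wprod s) }.

Hypothesis spl : splitting.
Let sP i := spl_sub spl i.

Lemma edge_subgrp : subgrp edge.
Proof.
split=> [|x y [a ->] [b ->]|x [a ->]]; first by exists 0%R.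
- by exists (a + b)%R; rewrite zpowD.
- by exists (- a)%R; rewrite zpowN.
Qed.
Let sE := edge_subgrp.

Lemma edgeZ a : edge (zpow c a). Proof. by exists a. Qed.

Lemma edgeP i x : edge x -> P i x.
Proof. by case=> a ->; apply: subgrpZ => //; apply: spl_edge. Qed.

Lemma idxE i x : P i x -> ~ edge x -> idx x = i.
Proof.
move=> Pi nE; rewrite /idx; case: pickP => [j /asboolP Pj /=|/(_ i)].
  apply: contrapT => ne; apply: nE; exact: (spl_cap spl Pj Pi ne).
by move/negP; case; apply/asboolP.
Qed.

Lemma syllableI i x : P i x -> ~ edge x -> syllable x /\ idx x = i.
Proof.
by move=> Pi nE; split; [apply/asboolP; split=> //; exists i | apply: idxE].
Qed.

Lemma syllable_idx x : syllable x -> P (idx x) x.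
Proof. by move/asboolP=> [[i Pi] nE]; rewrite (idxE Pi nE). Qed.

Lemma syllable_edge x : syllable x -> ~ edge x.
Proof. by move/asboolP=> []. Qed.

Lemma syllableMl x z : edge z -> syllable x -> syllable (z * x) /\ idx (z * x) = idx x.
Proof.
move=> Ez sx; apply: syllableI.
  by apply: (subgrpM (sP _)); [apply: edgeP | apply: syllable_idx].
by move/(subgrpMl sE Ez); apply: syllable_edge.
Qed.

Lemma syllableV x : syllable x -> syllable x^-1 /\ idx x^-1 = idx x.
Proof.
move=> sx; apply: syllableI; first exact/(subgrpV (sP _))/syllable_idx.
by move/(subgrpV sE); rewrite invgK; apply: syllable_edge.
Qed.

Definition junction s t : bool :=
  if s is a :: s' then if t is b :: _ then idx (last a s') != idx b else true
  else true.

Lemma reduced_cons a s :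
  reduced (a :: s) = [&& syllable a, reduced s & junction [:: a] s].
Proof.
rewrite /reduced /=; case: s => [|b s] /=; first by rewrite !andbT.
by case: (syllable a); case: (syllable b); case: (idx a == idx b);
   rewrite /= ?andbF ?andbT.
Qed.

Lemma reduced_cat s t : reduced (s ++ t) = [&& reduced s, reduced t & junction s t].
Proof.
elim: s => [|a s IH]; first by rewrite /= andbT.
rewrite cat_cons !reduced_cons IH.
case: s IH => [|b s] _ /=.
  by case: (syllable a); case: (reduced t); rewrite /= ?andbT ?andbF.
by case: (syllable a); case: (reduced (b :: s)); case: (reduced t);
   case: (idx a == idx b); rewrite ?andbT ?andbF.
Qed.

Lemma reduced_rcons s a :
  reduced (rcons s a) = [&& reduced s, syllable a & junction s [:: a]].
Proof. by rewrite -cats1 reduced_cat reduced_cons /= !andbT. Qed.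

Lemma junction_winv s t :
  all syllable s -> all syllable t -> junction (winv t) (winv s) = junction s t.
Proof.
elim/last_ind: s => [|s a _] //.
  by rewrite /winv /=; case: (rev _).
case: t => [|b t]; first by move=> _ _; rewrite /winv /=; case: (rcons _ _).
rewrite /winv map_rcons rev_rcons /= rev_cons all_rcons.
move=> /andP[sa _] /andP[sb _].
case: (rev [seq x^-1 | x <- t]) => [|d r]; case: s => [|e s] /=;
by rewrite ?last_rcons (proj2 (syllableV sa)) (proj2 (syllableV sb)) eq_sym.
Qed.

Lemma reduced_syll s : reduced s -> all syllable s.
Proof. by case/andP. Qed.

Lemma winv_cons a s : winv (a :: s) = rcons (winv s) a^-1.
Proof. by rewrite /winv /= rev_cons. Qed.

Lemma size_winv s : size (winv s) = size s.
Proof. by rewrite /winv size_rev size_map. Qed.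

Lemma reduced_winv s : reduced s -> reduced (winv s).
Proof.
elim: s => [|a s IH] // R; move: (R); rewrite reduced_cons => /and3P[sa rs j].
rewrite winv_cons reduced_rcons IH // (proj1 (syllableV sa)) /=.
rewrite -(junction_winv (s := [:: a]) (t := s)) /= ?sa ?reduced_syll // in j.
Qed.

Lemma reduced_edge s : reduced s -> s != [::] -> ~ edge (wprod s).
Proof.
case: s => [|a [|b s]] // R _; last by move/(edgeP i0); apply: spl_red R _.
by rewrite wprod1; apply: syllable_edge; move: R; rewrite reduced_cons => /and3P[].
Qed.

(* [x s = t y] letter by letter, the [z] being the edge elements by which the
   prefixes of both sides differ. *)
Fixpoint aligned x s t y : Prop :=
  match s, t with
  | [::], [::] => x = y
  | a :: s', b :: t' =>
      exists z, [/\ edge z, idx a = idx b, x * a = b * z & aligned z s' t' y]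
  | _, _ => False
  end.

(** The only candidate for the first edge element is [z = b^-1 * (x * a)]. If it is not one, or if
    [a] and [b] have different indices, then moving [t] to the other side produces a nonempty
    reduced word with product [y], contrary to [reduced_edge]. *)
Lemma alignedP x s t y : reduced s -> reduced t -> edge x -> edge y ->
  x * wprod s = wprod t * y -> aligned x s t y.
Proof.
elim: s t x => [|a s IH] [|b t] x Rs Rt Ex Ey /=.
- by rewrite mulg1 mul1g.
- rewrite mulg1 => E; case: (reduced_edge Rt) => //=.
  by apply: (subgrpMr sE Ey); rewrite -E.
- rewrite mul1g => E; case: (reduced_edge Rs) => //=.
  by apply: (subgrpMl sE Ex); rewrite E.
move: (Rs) (Rt); rewrite !reduced_cons => /and3P[sa rs js] /and3P[sb rt jt] E.
have {}E : b^-1 * (x * a) * wprod s = wprod t * y.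
  by rewrite -!mulgA E -mulgA mulKg.
have [e|ne] := eqVneq (idx a) (idx b).
  set z := b^-1 * (x * a) in E *.
  have Ez : edge z.
    apply: contrapT => nE.
    have [sz iz] : syllable z /\ idx z = idx b.
      apply: syllableI => //; apply: (subgrpM (sP _)).
        by apply/(subgrpV (sP _))/syllable_idx.
      by apply: (subgrpM (sP _)); [apply: edgeP | rewrite -e; apply: syllable_idx].
    have W : wprod (winv t ++ z :: s) = y.
      by rewrite wprod_cat wprod_winv /= E mulKg.
    have R : reduced (winv t ++ z :: s).
      rewrite reduced_cat reduced_winv // reduced_cons sz rs /=.
      apply/andP; split; first by move: js; case: (s) => //= d s'; rewrite iz e.
      move: jt rt; case: (t) => [|d t'] //= jt rt.
      rewrite winv_cons; move: rt; rewrite reduced_cons => /and3P[sd _ _].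
      case: (winv t') => [|f r] /=; rewrite ?last_rcons iz (proj2 (syllableV sd));
      by rewrite eq_sym.
    by case: (reduced_edge R); rewrite ?W //; case: (winv t).
  by exists z; split=> //; [rewrite /z mulVKg | apply: IH].
have [sx ix] := syllableMl Ex sa; have [sb' ib'] := syllableV sb.
have W : wprod (winv t ++ b^-1 :: x * a :: s) = y.
  by rewrite wprod_cat wprod_winv /= [b^-1 * _]mulgA E mulKg.
have R : reduced (winv t ++ b^-1 :: x * a :: s).
  have -> : winv t ++ b^-1 :: x * a :: s = winv (b :: t) ++ (x * a :: s).
    by rewrite winv_cons cat_rcons.
  rewrite reduced_cat reduced_winv // reduced_cons sx rs /=.
  apply/andP; split; first by move: js; case: (s) => //= d s'; rewrite ix.
  rewrite winv_cons; case: (winv t) => [|f r] /=; rewrite ?last_rcons ix ib' eq_sym //.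
by case: (reduced_edge R); rewrite ?W //; case: (winv t).
Qed.

Lemma aligned_edge x s t y : edge x -> aligned x s t y -> edge y.
Proof.
elim: s t x => [|a s IH] [|b t] x //=; first by move=> Ex <-.
by move=> _ [z [Ez _ _]]; apply: IH.
Qed.

Lemma aligned_prod x s t y : aligned x s t y -> x * wprod s = wprod t * y.
Proof.
elim: s t x => [|a s IH] [|b t] x //=; first by move=> ->; rewrite mulg1 mul1g.
by case=> z [_ _ E /IH W]; rewrite mulgA E -!mulgA W.
Qed.

Lemma aligned_size x s t y : aligned x s t y -> size s = size t.
Proof.
elim: s t x => [|a s IH] [|b t] x //=.
by case=> z [_ _ _ /IH ->].
Qed.

Lemma aligned_cat x s1 s2 t1 t2 y : size s1 = size t1 ->
  aligned x (s1 ++ s2) (t1 ++ t2) y ->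
  exists2 z, aligned x s1 t1 z & aligned z s2 t2 y.
Proof.
elim: s1 t1 x => [|a s1 IH] [|b t1] x //=; first by move=> _ A; exists x.
move=> [sz] [z [Ez i E /IH]] /(_ sz) [w A1 A2]; exists w => //.
by exists z.
Qed.

(* Only the values of [w] on the vertex groups matter; its restrictions to them
   agree on the edge group because [w] is a single function on [G]. *)
Variable w : G -> nat.
Hypothesis lw : forall i, lenfun (P i) w.

Definition cost s : nat := \sum_(x <- s) w x.

Lemma cost_cons a s : cost (a :: s) = w a + cost s.
Proof. exact: big_cons. Qed.
Lemma cost_cat s t : cost (s ++ t) = cost s + cost t.
Proof. exact: big_cat. Qed.
Lemma cost1 a : cost [:: a] = w a.
Proof. exact: big_seq1. Qed.
Lemma cost_rcons s a : cost (rcons s a) = cost s + w a.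
Proof. by rewrite -cats1 cost_cat cost1. Qed.

Definition vertex_word s : Prop := forall x, x \in s -> exists i, P i x.

Lemma vertex_word_cons a s : vertex_word (a :: s) <-> (exists i, P i a) /\ vertex_word s.
Proof.
split=> [V|[Va V] x]; first by split=> [|x xs]; apply: V; rewrite inE ?eqxx ?xs ?orbT.
by rewrite inE => /orP[/eqP ->|/V].
Qed.

Lemma vertex_word_cat s t : vertex_word s -> vertex_word t -> vertex_word (s ++ t).
Proof. by move=> Vs Vt x; rewrite mem_cat => /orP[/Vs|/Vt]. Qed.

Lemma reduced_vertex s : reduced s -> vertex_word s.
Proof.
move/reduced_syll/allP => R x /R sx; exists (idx x); exact: syllable_idx.
Qed.

Lemma cost_winv s : vertex_word s -> cost (winv s) = cost s.
Proof.
elim: s => [|a s IH] // /vertex_word_cons[[i Pa] /IH E].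
by rewrite winv_cons cost_rcons E cost_cons addnC (lenV (lw i)).
Qed.

Lemma vertex_word_winv s : vertex_word s -> vertex_word (winv s).
Proof.
move=> V x; rewrite mem_rev => /mapP[y /V[i Py] ->]; exists i; exact: (subgrpV (sP i)).
Qed.

Definition normal_word s : Prop := (exists2 x, edge x & s = [:: x]) \/
  (reduced s /\ s != [::]).

Lemma normal_vertex s : normal_word s -> vertex_word s.
Proof.
case=> [[x Ex ->]|[/reduced_vertex //]] y; rewrite inE => /eqP ->.
by exists i0; apply: edgeP.
Qed.

Lemma normal1 i x : P i x -> normal_word [:: x].
Proof.
move=> Px; case: (EM (edge x)) => E; first by left; exists x.
by right; split=> //; rewrite reduced_cons (proj1 (syllableI Px E)).
Qed.

Lemma cost_mul i x y s : P i x -> P i y -> cost ((x * y) :: s) <= cost [:: x, y & s].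
Proof.
by move=> Px Py; rewrite !cost_cons addnA leq_add2r; apply: lenM (lw i) _ _ _ _.
Qed.

(** Letters are prepended one at a time. Every contraction multiplies two letters within one vertex
    group, an edge letter being counted in the group of its neighbour, and [w] is subadditive
    there. *)
Lemma normalize s : vertex_word s -> exists t,
  [/\ normal_word t, wprod t = wprod s & cost t <= cost s].
Proof.
elim: s => [|x s IH].
  exists [:: 1]; rewrite wprod1 cost1 (len1 (lw i0)); split=> //.
  by left; exists 1 => //; apply: subgrp1 sE.
move=> /vertex_word_cons [[i Px] /IH[t [Nt Wt Ct]]].
have {}Ct : cost (x :: t) <= cost (x :: s) by rewrite !cost_cons leq_add2l.
case: Nt => [[y Ey te]|[Rt te]].
  move: Wt Ct; rewrite te wprod1 => Wt Ct.
  exists [:: x * y]; rewrite wprod1 /= -Wt; split=> //.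
    by apply: (@normal1 i); apply: (subgrpM (sP i)) => //; apply: edgeP.
  by apply: leq_trans Ct; apply: (@cost_mul i) => //; apply: edgeP.
case: t Rt te Wt Ct => [|a t] // Rt _ Wt Ct.
move: (Rt); rewrite reduced_cons => /and3P[sa rt ja].
case: (EM (edge x)) => [Ex|nEx].
  exists ((x * a) :: t) => /=; rewrite -mulgA -Wt; split=> //.
    have [sxa ixa] := syllableMl Ex sa.
    right; split=> //; rewrite reduced_cons sxa rt /=.
    by move: ja; case: (t) => //= b t'; rewrite ixa.
  apply: leq_trans Ct; apply: (@cost_mul (idx a)); last exact: syllable_idx.
  exact: edgeP.
have [sx ix] := syllableI Px nEx.
have [e|ne] := eqVneq (idx a) i; last first.
  exists [:: x, a & t]; rewrite /= -Wt; split=> //.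
  by right; split=> //; rewrite reduced_cons sx Rt /= ix eq_sym.
have Pa : P i a by rewrite -e; apply: syllable_idx.
have Pxa := subgrpM (sP i) Px Pa.
have Cxa := leq_trans (cost_mul t Px Pa) Ct.
case: (EM (edge (x * a))) => [Exa|nExa]; last first.
  exists ((x * a) :: t) => /=; rewrite -mulgA -Wt; split=> //.
  have [sxa ixa] := syllableI Pxa nExa.
  right; split=> //; rewrite reduced_cons sxa rt /=.
  by move: ja; case: (t) => //= b t'; rewrite ixa e.
(* The merged letter has become an edge element. The next letter [b] absorbs it without changing its
   index, so the contraction stops here. *)
case: t rt {Rt} ja Wt Cxa {Ct} => [|b t] rt ja Wt Cxa.
  exists [:: x * a]; rewrite /= -mulgA -Wt; split=> //.
  by apply: (@normal1 i).
move: (rt); rewrite reduced_cons => /and3P[sb rt' jb].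
have [sxb ixb] := syllableMl Exa sb.
exists ((x * a * b) :: t); rewrite /= -!mulgA -Wt; split=> //.
  right; split=> //; rewrite reduced_cons !mulgA sxb rt' /=.
  by move: jb; case: (t) => //= d t'; rewrite ixb.
apply: leq_trans Cxa; rewrite mulgA; apply: (@cost_mul (idx b)); last exact: syllable_idx.
exact: edgeP.
Qed.

(** The largest length function on the amalgam that is at most [w] on each vertex group. By
    [glen_vertex] it extends [w]. *)
Definition glen g : nat := nat_min
  [set n | exists s, [/\ vertex_word s, wprod s = g & cost s = n]]%classic.

Lemma glen_le s : vertex_word s -> glen (wprod s) <= cost s.
Proof.
move=> V; pose A n := exists t, [/\ vertex_word t, wprod t = wprod s & cost t = n].
by have [_] := @nat_minP A (cost s) (ex_intro _ s (And3 V erefl erefl)); apply;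
   exists s.
Qed.

Lemma glen_normal g : exists t, [/\ normal_word t, wprod t = g & cost t = glen g].
Proof.
pose A n := exists t, [/\ vertex_word t, wprod t = g & cost t = n].
have [s [Vs Ws]] := spl_gen spl g.
have [[t [Vt Wt Ct]] _] := @nat_minP A (cost s) (ex_intro _ s (And3 Vs Ws erefl)).
have [r [Nr Wr Cr]] := normalize Vt; exists r; split=> //; first by rewrite Wr.
apply/eqP; rewrite eqn_leq -{2}Wt -Wr glen_le ?andbT; last exact: normal_vertex.
by move: Cr; rewrite Ct.
Qed.

Lemma glen_lenfun : lenfun (fun=> True) glen.
Proof.
split=> [|x y _ _|x _].
- by apply/eqP; rewrite -leqn0; have := @glen_le [::]; rewrite /cost big_nil; apply.
- have [s [Ns Ws Cs]] := glen_normal x; have [t [Nt Wt Ct]] := glen_normal y.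
  rewrite -Cs -Ct -cost_cat -{1}Ws -{1}Wt -wprod_cat; apply: glen_le.
  by apply: vertex_word_cat; apply: normal_vertex.
have le y : glen y^-1 <= glen y.
  have [s [Ns Ws Cs]] := glen_normal y; have Vs := normal_vertex Ns.
  rewrite -{1}Ws -Cs -wprod_winv -cost_winv //; apply: glen_le; exact: vertex_word_winv.
by apply/eqP; rewrite eqn_leq le -{1}[x]invgK le.
Qed.

Lemma normal_of_vertex i x s : normal_word s -> P i x -> wprod s = x -> s = [:: x].
Proof.
case=> [[y Ey ->]|[Rs sn]] Px; first by rewrite wprod1 => ->.
case: s Rs sn => [|a [|b s]] // Rs _; first by rewrite wprod1 => ->.
by move=> W; case: (spl_red spl (i := i) Rs); rewrite ?W.
Qed.

Lemma glen_vertex i x : P i x -> glen x = w x.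
Proof.
move=> Px; have [s [Ns Ws <-]] := glen_normal x.
by rewrite (normal_of_vertex Ns Px Ws) cost1.
Qed.

(** The source of lower bounds for [glen]: a cheapest word can be taken reduced, and then it shares
    with the given [t] the number of syllables and their indices. *)
Lemma glen_reduced g t : reduced t -> t != [::] -> wprod t = g ->
  exists s, [/\ reduced s, aligned 1 s t 1, wprod s = g & cost s = glen g].
Proof.
move=> Rt te Wt; have [s [Ns Ws Cs]] := glen_normal g.
have {Ns} Rs : reduced s.
  case: Ns => [[x Ex se]|[]//]; case: (reduced_edge Rt te).
  by rewrite Wt -Ws se wprod1.
exists s; split=> //; apply: alignedP => //; try exact: subgrp1 sE.
by rewrite mul1g mulg1 Ws.
Qed.

End ReducedWords.

(** * Length functions on an amalgam *)

Section EdgeNorm.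
Variables (G : groupType) (P : G -> Prop) (c : G) (l : G -> nat) (k K : nat).
Hypotheses (sP : subgrp P) (Pc : P c) (ll : lenfun P l).
Hypothesis lc : forall z, k * absz z <= l (zpow c z) <= k * absz z + K.
Implicit Types (x y : G) (a b z : int).

(* The least function above [l] that is [k]-Lipschitz under multiplication by
   [c] on either side; subadditivity survives because the two corrections meet
   at the outer ends of a product only. *)
Definition lipnorm x : nat := nat_min
  [set n | forall a b, l (zpow c a * x * zpow c b) <= n + k * absz a + k * absz b]%classic.

Let Pz z : P (zpow c z) := subgrpZ sP z Pc.
Let PJ a b x : P x -> P (zpow c a * x * zpow c b).
Proof. by move=> Px; apply: (subgrpM sP) => //; apply: (subgrpM sP). Qed.

Let A x n := forall a b, l (zpow c a * x * zpow c b) <= n + k * absz a + k * absz b.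

Lemma lipnorm_bound x : P x -> A x (l x + K + K).
Proof.
move=> Px a b; apply: leq_trans (len3 sP ll _ _ _) _ => //.
have := lc a; have := lc b; lia.
Qed.

Lemma lipnormP x : P x -> A x (lipnorm x).
Proof. by move=> Px; have [] := @nat_minP (A x) _ (lipnorm_bound Px). Qed.

Lemma lipnorm_le x n : P x -> A x n -> lipnorm x <= n.
Proof. by move=> Px An; have [_] := @nat_minP (A x) _ (lipnorm_bound Px); apply. Qed.

Lemma lipnorm_ub x : P x -> lipnorm x <= l x + K + K.
Proof. by move=> Px; apply: lipnorm_le => //; apply: lipnorm_bound. Qed.

Lemma lipnorm_ge x : P x -> l x <= lipnorm x.
Proof. by move=> /lipnormP /(_ 0%R 0%R); rewrite !zpow0 mul1g mulg1 !muln0 !addn0. Qed.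

Lemma lipnormM x y : P x -> P y -> lipnorm (x * y) <= lipnorm x + lipnorm y.
Proof.
move=> Px Py; apply: lipnorm_le => [|a b]; first exact: (subgrpM sP).
have := lipnormP Px a 0%R; have := lipnormP Py 0%R b.
rewrite !zpow0 mul1g mulg1 !muln0 !addn0 => hy hx.
have : l (zpow c a * x * (y * zpow c b)) <= l (zpow c a * x) + l (y * zpow c b).
  by apply: (lenM ll); apply: (subgrpM sP).
rewrite !gmulA; lia.
Qed.

Lemma lipnormV x : P x -> lipnorm x^-1 = lipnorm x.
Proof.
have le y : P y -> lipnorm y^-1 <= lipnorm y.
  move=> Py; apply: lipnorm_le => [|a b]; first exact: (subgrpV sP).
  have := lipnormP Py (- b)%R (- a)%R.
  rewrite -(lenV ll (PJ _ _ Py)) !ginvM !zpowN !invgK gmulA !abszN; lia.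
move=> Px; apply/eqP; rewrite eqn_leq le //= -{1}[x]invgK le //.
exact: (subgrpV sP).
Qed.

Lemma lipnormZl z x : P x -> lipnorm (zpow c z * x) <= k * absz z + lipnorm x.
Proof.
move=> Px; apply: lipnorm_le => [|a b]; first exact: (subgrpM sP).
have := lipnormP Px (a + z)%R b; rewrite zpowD !gmulA.
have : absz (a + z)%R <= absz a + absz z by lia.
move: (absz (a + z)%R) => w; nia.
Qed.

Lemma lipnormZr z x : P x -> lipnorm (x * zpow c z) <= lipnorm x + k * absz z.
Proof.
move=> Px; rewrite -lipnormV ?ginvM; last exact: (subgrpM sP).
rewrite -zpowN addnC -(lipnormV Px) -(abszN z).
by apply: lipnormZl; apply: (subgrpV sP).
Qed.

(** Makes [k * absz z] a well-defined function of [zpow c z]: for positive [k] the powers of [c] are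
    distinct, and for [k = 0] the value is constant. *)
Lemma edge_val_inj z1 z2 : zpow c z1 = zpow c z2 -> (k * absz z1 = k * absz z2)%N.
Proof.
move=> E; have := lc (z1 - z2)%R; rewrite zpowB E mulgV (len1 ll).
case: (posnP k) => [->|k0] //; have [->|ne] := eqVneq z1 z2; nia.
Qed.

End EdgeNorm.

Lemma nat_seq_bound (T : eqType) (f : T -> nat) (s : seq T) :
  exists B, forall x, x \in s -> f x <= B.
Proof.
exists (\sum_(x <- s) f x) => x xs.
by rewrite (big_rem x xs) /= leq_addr.
Qed.

Lemma common_scale (I : finType) (k : I -> nat) (b : nat) :
  (forall i, 0 < k i) ->
  exists d : I -> nat, exists2 e, b < e & forall i, 0 < d i /\ e = (d i * k i)%N.
Proof.
move=> k0; exists (fun i => (b.+1 * \prod_(j | j != i) k j)%N).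
exists (b.+1 * \prod_j k j)%N.
  by rewrite -[b.+1 in X in X <= _]muln1 leq_pmul2l // prodn_gt0.
move=> i; rewrite muln_gt0 /= prodn_gt0; last by move=> j; apply: k0.
by split=> //; rewrite (bigD1 i) //= -mulnA [(k i * _)%N]mulnC.
Qed.

Section NormExists.
Variables (G : groupType) (I : finType) (i0 : I) (P : I -> G -> Prop) (c : G).
Hypothesis spl : splitting i0 P c.
Hypothesis undP : forall i, undistorted (P i).
Let sP i := spl_sub spl i.
Let Pc i := spl_edge spl i.
Let edge := edge c.
Let idx := idx i0 P.
Let syllable := syllable P c.
Implicit Types (x y : G) (z : int).

(** Integer multiples of the lengths of the factors share a growth rate along [c], as agreement on
    the edge group requires. A further common factor lifts this rate to at least [L i c], so that
    [L] can later be included without changing the values on edges. *)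
Lemma edge_scaled (F : I -> seq G) (L : I -> G -> nat) :
  (forall i h, h \in F i -> P i h) ->
  exists (l : I -> G -> nat) (k K : nat),
    [/\ c <> 1 -> 0 < k, forall i, lenfun (P i) (l i), forall i, L i 1 = 0 -> L i c <= k,
     forall i z, k * absz z <= l i (zpow c z) <= k * absz z + K &
     forall i h, h \in F i -> tame (l i) h].
Proof.
move=> FP.
have /choice[l] : forall i, exists l, lenfun (P i) l /\
    forall h, h \in c :: F i -> tame l h.
  move=> i; case: (@undP i (c :: F i)) => [h|l ll tl]; last by exists l.
  by rewrite inE => /orP[/eqP ->|/FP].
move=> Hl; have ll i : lenfun (P i) (l i) by case: (Hl i).
case: (EM (c = 1)) => [c1|nc1].
  exists l, 0, 0; split=> // [i|i z|i h hF]; first by rewrite c1 => ->.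
    by rewrite c1 zpow1g (len1 (ll i)).
  by case: (Hl i) => _; apply; rewrite inE hF orbT.
have /choice[kK] : forall i, exists kK : nat * nat, 0 < kK.1 /\ forall z,
    kK.1 * absz z <= l i (zpow c z) <= kK.1 * absz z + kK.2.
  move=> i; case: (proj2 (Hl i) c (mem_head _ _)) => k [K [/(_ nc1) k0 H]].
  exists (k, K); split=> //= z; apply/andP; split.
    exact: (tame_zpow (sP i) (ll i) (Pc i) (fun m => proj1 (H m))).
  case: z => n; first exact: (proj2 (H n)).
  by rewrite NegzE zpowN (lenV (ll i)) ?abszN; [exact: (proj2 (H _)) | exact: (subgrpX (sP i))].
move=> HkK.
have [d [e eb He]] := @common_scale _ (fun i => (kK i).1) (\sum_i L i c)
   (fun i => proj1 (HkK i)).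
exists (fun i x => d i * l i x)%N, e, (\sum_i d i * (kK i).2)%N.
split=> [_|i|i _|i z|i h hF].
- exact: leq_ltn_trans (leq0n _) eb.
- exact: lenfun_scale.
- by apply: leq_trans (ltnW eb); rewrite (bigD1 i) //= leq_addr.
- have [d0 ->] := He i; have := proj2 (HkK i) z.
  have : d i * (kK i).2 <= \sum_i d i * (kK i).2 by rewrite [leqRHS](bigD1 i) //= leq_addr.
  move: (\sum_i _) => s; nia.
case: (proj2 (Hl i) h); first by rewrite inE hF orbT.
move=> k [K [k0 H]]; have [d0 _] := He i.
exists (d i * k)%N, (d i * K)%N; split=> [/k0|m]; first by rewrite muln_gt0 d0.
have := H m; nia.
Qed.

(** Off the edge group [w] is the maximum of [M], [lipnorm] and [L]. The floor [M] respects
    subadditivity, since a product of two non-edge elements has [2 * M] at its disposal, while the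
    Lipschitz property handles edge factors. As [M] also bounds the other two terms on the finite
    list [S], it is attained there. Tameness is kept for vanishing [L] only, because an arbitrary
    [L] could spoil the growth along powers. *)
Lemma norm_exists (F : I -> seq G) (L : I -> G -> nat) (S : seq G) (M0 : nat) :
  (forall i h, h \in F i -> P i h) -> (forall i, lenfun (P i) (L i)) ->
  (forall x, x \in S -> syllable x) ->
  exists (w : G -> nat) (k M : nat),
    [/\ forall i, lenfun (P i) w, c <> 1 -> 0 < k,
        forall z, w (zpow c z) = (k * absz z)%N & M0 < M] /\
    [/\ forall x, x \in S -> w x = M, forall x, syllable x -> M <= w x,
        forall i x, P i x -> L i x <= w x &
        (forall i x, L i x = 0) -> forall i h, h \in F i -> tame w h].
Proof.
move=> FP LP Sy; have [l [k [K [k0 ll Lk lc tl]]]] := edge_scaled L FP.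
have {}Lk i : L i c <= k by apply: Lk; apply: len1 (LP i).
pose lip i := lipnorm c (l i) k.
pose n i x := maxn (lip i x) (L i x).
have [M1 HM1] := nat_seq_bound (fun x => n (idx x) x) S.
pose M := maxn M0.+1 M1.
pose w x := if `[< edge x >] then (k * absz (xget 0%R [set z | x = zpow c z]%classic))%N
            else maxn M (n (idx x) x).
have wE z : w (zpow c z) = (k * absz z)%N.
  rewrite /w ifT; last by apply/asboolP; exists z.
  apply: (edge_val_inj (ll i0) (lc i0)).
  by have /(xgetI 0%R) <- : [set u | zpow c z = zpow c u]%classic z by [].
have wN i x : P i x -> ~ edge x -> w x = maxn M (n i x).
  move=> Px nE; rewrite /w ifF; last by apply/asboolP.
  by rewrite /idx (idxE spl Px nE).
have sE := edge_subgrp c.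
have LZ i z : L i (zpow c z) <= k * absz z.
  by apply: leq_trans (lenZ (sP i) (LP i) z (Pc i)) _; rewrite mulnC leq_mul2r Lk orbT.
have wge i x : P i x -> L i x <= w x.
  move=> Px; case: (EM (edge x)) => [[z ->]|nE]; first by rewrite wE LZ.
  by rewrite (wN i) // /n; lia.
have lE i z : k * absz z <= l i (zpow c z) by case/andP: (lc i z).
have lipE i z x y : P i x -> P i y -> x * y = zpow c z ->
    k * absz z <= lip i x + lip i y.
  move=> Px Py E; apply: leq_trans (lE i z) _; rewrite -E.
  apply: leq_trans (lenM (ll i) Px Py) _.
  by rewrite leq_add // /lip (lipnorm_ge (sP i) (Pc i) (ll i) (lc i)).
have lw i : lenfun (P i) w.
  split=> [|x y Px Py|x Px].
  - by rewrite -(zpow0 c) wE muln0.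
  - have Pxy := subgrpM (sP i) Px Py.
    case: (EM (edge x)) => [[a xa]|nx].
      case: (EM (edge y)) => [[b yb]|ny].
        by rewrite xa yb -zpowD !wE; nia.
      have nxy : ~ edge (x * y) by apply: contra_not ny; apply: subgrpMl; [|exists a].
      rewrite (wN i y) // (wN i (x * y)) // {1 2}xa wE /n.
      have := lipnormZl (sP i) (Pc i) (ll i) (lc i) a Py.
      have : L i (zpow c a * y) <= k * absz a + L i y.
        by apply: leq_trans (lenM (LP i) _ Py) _; rewrite -?xa // leq_add2r xa.
      by rewrite /lip -xa; lia.
    case: (EM (edge y)) => [[b yb]|ny].
      have nxy : ~ edge (x * y) by apply: contra_not nx; apply: subgrpMr; [|exists b].
      rewrite (wN i x) // (wN i (x * y)) // {2}yb wE /n.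
      have := lipnormZr (sP i) (Pc i) (ll i) (lc i) b Px.
      have : L i (x * zpow c b) <= L i x + k * absz b.
        by apply: leq_trans (lenM (LP i) Px _) _; rewrite -?yb // leq_add2l yb.
      by rewrite /lip -yb; lia.
    rewrite (wN i x) // (wN i y) //.
    case: (EM (edge (x * y))) => [[z xyz]|nxy].
      by rewrite xyz wE /n; have := lipE i z x y Px Py xyz; lia.
    rewrite (wN i (x * y)) // /n.
    have := lipnormM (sP i) (Pc i) (ll i) (lc i) Px Py.
    by have := lenM (LP i) Px Py; rewrite /lip; lia.
  - have PV := subgrpV (sP i) Px.
    case: (EM (edge x)) => [[a ->]|nx]; first by rewrite -zpowN !wE abszN.
    have nV : ~ edge x^-1 by apply: contra_not nx => /(subgrpV sE); rewrite invgK.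
    rewrite (wN i x) // (wN i) // /n /lip.
    by rewrite (lipnormV (sP i) (Pc i) (ll i) (lc i) Px) (lenV (LP i) Px).
exists w, k, M; split; first by split=> //; rewrite /M; lia.
split=> [x xS|x /asboolP[[i Px] nE]|//|L0 i h hF].
- have sx := Sy x xS; have := HM1 x xS.
  have nE : ~ edge x := syllable_edge sx.
  have Px := syllable_idx spl sx.
  by rewrite (wN _ _ Px nE) /M /idx; lia.
- by rewrite (wN i) //; lia.
have Ph := FP i h hF; case: (tl i h hF) => q [Q [q0 H]].
exists q, (Q + K + K + M)%N; split=> // m.
have Phm := subgrpX (sP i) m Ph; have := H m.
case: (EM (edge (h ^+ m))) => [[z E]|nE].
  by rewrite E wE; have := lc i z; lia.
rewrite (wN i) // /n L0 /lip.
have := lipnorm_ge (sP i) (Pc i) (ll i) (lc i) Phm.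
have := lipnorm_ub (sP i) (Pc i) (ll i) (lc i) Phm; lia.
Qed.

End NormExists.

Lemma tame_conj (G : groupType) (P : G -> Prop) (l : G -> nat) (t h : G) :
  subgrp P -> lenfun P l -> P t -> P h -> tame l h -> tame l (t * h * t^-1).
Proof.
move=> sP ll Pt Ph [k [K [k0 H]]]; exists k, (K + l t + l t)%N; split=> [ne|m].
  by apply: k0 => h1; apply: ne; rewrite h1 mulg1 mulgV.
rewrite expg_conj; have := H m.
have Phm := subgrpX sP m Ph.
have := len3 sP ll Pt Phm (subgrpV sP Pt).
have := len3 sP ll (subgrpV sP Pt) (subgrpJ sP Pt Phm) Pt.
rewrite (lenV ll Pt).
have -> : t^-1 * (t * h ^+ m * t^-1) * t = h ^+ m by rewrite !gmulA mulVg mul1g mulgVK.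
lia.
Qed.

(** * Cyclically reduced words and translation lengths *)

Section Cyclic.
Variables (G : groupType) (I : finType) (i0 : I) (P : I -> G -> Prop) (c : G).
Hypothesis spl : splitting i0 P c.
Let sP i := spl_sub spl i.
Local Notation edge := (edge c).
Local Notation idx := (idx i0 P).
Local Notation syllable := (syllable P c).
Local Notation reduced := (reduced i0 P c).
Local Notation junction := (junction i0 P).
Implicit Types (x y g t u v : G) (s r : seq G) (i j : I) (z : int).

(** A single syllable fails the last condition, so there are at least two. The products of such
    words are hyperbolic on the Bass-Serre tree. *)
Definition cyclic s : bool := [&& s != [::], reduced s & junction s s].

Lemma cyclic_reduced s : cyclic s -> reduced s.
Proof. by case/and3P. Qed.

Lemma cyclic_size s : cyclic s -> 1 < size s.
Proof. by case: s => [|a [|b s]] // /and3P[_ _] /=; rewrite eqxx. Qed.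

Definition spow s n : seq G := flatten (nseq n s).

Lemma spowS s n : spow s n.+1 = s ++ spow s n. Proof. by []. Qed.

Lemma spowD s m n : spow s (m + n) = spow s m ++ spow s n.
Proof. by rewrite /spow nseqD flatten_cat. Qed.

Lemma wprod_spow s n : wprod (spow s n) = wprod s ^+ n.
Proof. by elim: n => [|n IH] //; rewrite spowS wprod_cat IH expgS. Qed.

Lemma size_spow s n : size (spow s n) = (n * size s)%N.
Proof. by elim: n => [|n IH] //; rewrite spowS size_cat IH mulSn. Qed.

Lemma spow_reduced s n : cyclic s -> reduced (spow s n).
Proof.
move=> /and3P[ne rs js]; elim: n => [|n IH] //.
rewrite spowS reduced_cat rs IH /=; case: n {IH} => [|n].
  by rewrite /spow /=; case: (s).
by move: ne js; rewrite spowS; case: (s).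
Qed.

(** [rot n s ++ rot n s] is a factor of the reduced word [s ++ s ++ s]. *)
Lemma cyclic_rot n s : cyclic s -> cyclic (rot n s).
Proof.
move=> cs; have := spow_reduced 3 cs; rewrite /spow /= cats0.
rewrite -{1 2 3}(cat_take_drop n s) -!catA => R.
have {R} : reduced (rot n s ++ rot n s).
  move: R; rewrite reduced_cat => /and3P[_ + _].
  rewrite [X in reduced X](_ : _ = (rot n s ++ rot n s) ++ drop n s).
    by rewrite reduced_cat => /and3P[].
  by rewrite /rot -!catA.
rewrite reduced_cat => /and3P[R _ J]; rewrite /cyclic R J.
by rewrite -size_eq0 size_rot size_eq0; case/and3P: cs => ->.
Qed.

Lemma cyclic_winv s : cyclic s -> cyclic (winv s).
Proof.
move=> /and3P[ne rs js]; rewrite /cyclic (reduced_winv spl) //.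
by rewrite (junction_winv spl) ?(reduced_syll rs) // js -size_eq0 size_winv size_eq0 ne.
Qed.

Definition elliptic u : Prop := exists i, P i u.

Section CyclicReduction.
Variable w : G -> nat.
Hypothesis lw : forall i, lenfun (P i) w.
Local Notation cost := (cost w).
Local Notation glen := (glen P w).
Local Notation vertex_word := (vertex_word P).

(** The first letter is kept apart because conjugation by the last letter [y] turns it into [y * x],
    or into [y * x * a] if [y * x] is an edge element. The letters of the conjugator are thus paid
    for by the shrinking tail, and the total cost does not grow. *)
Lemma cyclic_reduction_cons n x s : size s <= n ->
  reduced (x :: s) \/ s = [::] /\ elliptic x ->
  exists r u, [/\ vertex_word r, x * wprod s = wprod r * u * (wprod r)^-1,
    cost r <= cost s &
    elliptic u /\ w u <= w x + cost s \/
    exists q, [/\ cyclic q, wprod q = u & cost q <= w x + cost s]].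
Proof.
have done_ell y s' : elliptic y -> s' = [::] -> exists r u,
   [/\ vertex_word r, y * wprod s' = wprod r * u * (wprod r)^-1,
    cost r <= cost s' &
    elliptic u /\ w u <= w y + cost s' \/
    exists q, [/\ cyclic q, wprod q = u & cost q <= w y + cost s']].
  move=> ey ->; exists [::], y; rewrite /= invg1 mul1g; split=> //.
  by left; rewrite leq_addr.
elim: n x s => [|n IH] x s sz; case=> [R|[-> ex]]; try exact: done_ell.
  have sx : syllable x by move: R; rewrite reduced_cons => /and3P[].
  apply: done_ell; last by apply: size0nil; lia.
  by exists (idx x); apply: (syllable_idx spl).
have sx : syllable x by move: R; rewrite reduced_cons => /and3P[].
have Px := syllable_idx spl sx.
case/lastP: s sz R => [|s y] sz R; first by apply: done_ell => //; exists (idx x).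
have [e|ne] := eqVneq (idx y) (idx x); last first.
  exists [::], (x * wprod (rcons s y)); rewrite /= invg1 mul1g mulg1; split=> //.
    by rewrite /cost big_nil.
  right; exists (x :: rcons s y); split=> //; last by rewrite cost_cons.
  by rewrite /cyclic R /= last_rcons.
have sy : syllable y.
  by move: R; rewrite -rcons_cons reduced_rcons => /and3P[].
have Py : P (idx x) y by rewrite -e; apply: (syllable_idx spl).
have Pyx := subgrpM (sP _) Py Px.
have lyx := lenM (lw _) Py Px.
move: sz; rewrite size_rcons ltnS => sz.
have Rs : reduced (x :: s) by move: R; rewrite -rcons_cons reduced_rcons => /and3P[].
have wrap x' s' : size s' <= n -> x' * wprod s' = y * x * wprod s ->
   w x' + cost s' <= w y + w x + cost s -> cost s' <= cost s ->
   reduced (x' :: s') \/ s' = [::] /\ elliptic x' ->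
   exists r u, [/\ vertex_word r,
     x * wprod (rcons s y) = wprod r * u * (wprod r)^-1,
     cost r <= cost (rcons s y) &
     elliptic u /\ w u <= w x + cost (rcons s y) \/
     exists q, [/\ cyclic q, wprod q = u & cost q <= w x + cost (rcons s y)]].
  move=> sz' E C1 C2 /(IH _ _ sz')[r [u [Vr Wr Cr H]]].
  exists (y^-1 :: r), u; rewrite cost_cons cost_rcons (lenV (lw _) Py).
  split; [|by rewrite wprod_rcons /=; move: Wr; rewrite E => Wr;
     rewrite ginvM invgK !gmulA -(gmulA y^-1) -(gmulA y^-1) -Wr !gmulA mulVg mul1g| |].
  - apply/vertex_word_cons; split=> //; exists (idx x); exact: (subgrpV (sP _)).
  - by lia.
  case: H => [[eu wu]|[q [cq Wq Cq]]]; [left; split=> // | right; exists q; split=> //]; lia.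
case: (EM (edge (y * x))) => [Ez|nEz]; last first.
  have [syx iyx] := syllableI spl Pyx nEz.
  apply: (wrap (y * x) s) => //; first lia.
  by left; move: Rs; rewrite !reduced_cons syx => /and3P[_ ->] /=; case: (s) => //= b s'; rewrite iyx.
case: s sz R Rs wrap => [|a s] sz R Rs wrap.
  apply: (wrap (y * x) [::]) => //; first lia.
  by right; split=> //; exists (idx x).
have rs : reduced (a :: s) by move: Rs; rewrite reduced_cons => /and3P[].
have sa : syllable a by move: rs; rewrite reduced_cons => /and3P[].
have [sza ia] := syllableMl spl Ez sa.
have Pa := syllable_idx spl sa.
have la := lenM (lw _) (edgeP spl (idx a) Ez) Pa.
apply: (wrap (y * x * a) s) => //.
- by move: sz => /=; lia.
- by rewrite /= !gmulA.
- by rewrite cost_cons; lia.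
- by rewrite cost_cons; lia.
by left; move: rs; rewrite !reduced_cons sza => /and3P[_ ->] /=; case: (s) => //= b s'; rewrite ia.
Qed.

Lemma cyclic_reduction g : exists r u,
  [/\ vertex_word r, g = wprod r * u * (wprod r)^-1, cost r <= glen g &
    elliptic u /\ w u <= glen g \/
    exists q, [/\ cyclic q, wprod q = u & cost q <= glen g]].
Proof.
have [s [Ns <- <-]] := glen_normal spl lw g.
case: s Ns => [|x s] Ns; first by case: Ns => [[]|[]].
have H : reduced (x :: s) \/ s = [::] /\ elliptic x.
  case: Ns => [[y Ey [-> ->]]|[]]; last by left.
  by right; split=> //; exists i0; apply: (edgeP spl).
have [r [u [Vr Wr Cr Hu]]] := cyclic_reduction_cons (leqnn _) H.
by exists r, u; rewrite cost_cons; split=> //; lia.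
Qed.

End CyclicReduction.

Lemma splitting_undistorted : (forall i, undistorted (P i)) ->
  undistorted (fun _ : G => True).
Proof.
move=> undP F _.
have /choice[d Hd] : forall f, exists d : G * G * seq G,
   f = d.1.1 * d.1.2 * d.1.1^-1 /\
   (elliptic d.1.2 /\ d.2 = [::] \/ cyclic d.2 /\ wprod d.2 = d.1.2).
  (* Only the shape of the reduced conjugate matters at this point, so the zero length is used. The
     actual [w] is chosen afterwards, depending on the letters found. *)
  move=> f; have [r [u [_ E _ H]]] := cyclic_reduction (fun i => lenfun0 (P i)) f.
  case: H => [[eu _]|[q [cq Wq _]]].
    by exists (wprod r, u, [::]); split=> //; left.
  by exists (wprod r, u, q); split=> //; right.
pose Fi i := [seq x <- [seq (d f).1.2 | f <- F] | `[< P i x >]].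
pose S := flatten [seq (d f).2 | f <- F].
have FiP i h : h \in Fi i -> P i h by rewrite mem_filter => /andP[/asboolP].
have SP x : x \in S -> syllable x.
  move=> /flatten_mapP[f fF xd]; case: (Hd f) => _ [[_ d0]|[/cyclic_reduced cd _]].
    by rewrite d0 in xd.
  by move/reduced_syll/allP: cd; apply.
have [w [k [M [[lw _ _ M0] [wS wM _ tw]]]]] :=
  norm_exists spl undP 0 FiP (fun i => lenfun0 (P i)) SP.
have lg := glen_lenfun spl lw.
have sT : subgrp (fun _ : G => True) by [].
exists (glen P w) => // f fF; have [E H] := Hd f; rewrite E.
apply: (tame_conj sT lg) => //; case: H => [[[i Pi] _]|[cd Wd]].
  have : tame w (d f).1.2.
    apply: (tw _ i) => //; rewrite mem_filter (map_f (fun f => (d f).1.2)) // andbT; exact/asboolP.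
  case=> q [Q [q0 H]]; exists q, Q; split=> // m.
  rewrite (glen_vertex spl lw (subgrpX (sP i) m Pi)); exact: H.
rewrite -Wd; set s := (d f).2 in cd Wd *.
have cS : cost w s = (M * size s)%N.
  have : forall x, x \in s -> w x = M.
    by move=> x xs; apply: wS; apply/flatten_mapP; exists f.
  elim: (s) => [|a s' IH] H; first by rewrite /cost big_nil muln0.
  rewrite cost_cons IH ?H ?mem_head //= ?mulnS //.
  by move=> x xs'; apply: H; rewrite inE xs' orbT.
exists (M * size s)%N, 0; split=> [_|m].
  by rewrite muln_gt0 M0; have := cyclic_size cd; lia.
rewrite addn0; split; last first.
  apply: leq_trans (lenX sT lg m _) _ => //; rewrite addn0 mulnC leq_mul2r.
  have := glen_le w (reduced_vertex spl (cyclic_reduced cd)).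
  by rewrite cS => ->; rewrite orbT.
case: m => [|m]; first by rewrite muln0.
have R := spow_reduced m.+1 cd.
have ne : spow s m.+1 != [::].
  by rewrite -size_eq0 size_spow; have := cyclic_size cd; case: (size s).
have [s' [Rs' A Ws' <-]] := glen_reduced spl lw R ne (wprod_spow s m.+1).
(* The cheapest word [s'] has as many syllables as the power of [s], each costing at least [M],
   whereas the letters of [s] cost exactly [M]. Hence there is no error term. *)
have : M * size s' <= cost w s'.
  move/reduced_syll: Rs' => {A Ws'}; elim: s' => [|a s' IH]; first by rewrite muln0.
  move=> /= /andP[sa /IH h]; rewrite cost_cons mulnS leq_add // wM //.
rewrite (aligned_size A) size_spow; lia.
Qed.

End Cyclic.

(** * Commensuration in an amalgam *)

Section CommensBound.
Variables (G : groupType) (P : G -> Prop).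
Hypothesis sP : subgrp P.
Implicit Types (h u t : G) (B : nat).

Lemma bcomm_mono B1 B2 h h' u : B1 <= B2 -> bcomm B1 h h' u -> bcomm B2 h h' u.
Proof. by move=> le [p [q [H1 H2 E]]]; exists p, q; split=> //; lia. Qed.

Lemma bcomm_conj B h h' t t' u : bcomm B h h' (t^-1 * u * t') ->
  bcomm B (t * h * t^-1) (t' * h' * t'^-1) u.
Proof.
move=> [p [q [H1 H2 E]]]; exists p, q; split=> //.
rewrite expg_conj zpow_conj; apply: (mulgI t^-1); apply: (mulIg t').
by rewrite !gmulA mulgVK mulVg mul1g E !gmulA.
Qed.

Lemma commens_bound_conj h h' t t' : P t -> P t' -> P h -> P h' ->
  commens_bound P h h' -> commens_bound P (t * h * t^-1) (t' * h' * t'^-1).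
Proof.
move=> Pt Pt' Ph Ph' [l ll [B H]]; exists l => //.
exists (B + (l t + l t') + (l t + l t'))%N => a b u Pu.
have PtV := subgrpV sP Pt; have PtV' := subgrpV sP Pt'.
have Pu' : P (t^-1 * u * t') by do 2?apply: (subgrpM sP).
case: (H a b _ Pu') => [le|bc]; last first.
  by right; apply: bcomm_conj; apply: bcomm_mono bc; lia.
left; rewrite !zpow_conj; set v := _ * u * _.
have Ev : zpow h a * (t^-1 * u * t') * zpow h' b = t^-1 * v * t'.
  by rewrite /v !gmulA mulVg mul1g mulgVK.
have Pv : P v.
  by apply: (subgrpM sP); [apply: (subgrpM sP) |] => //; apply: (subgrpJ sP) => //;
     apply: (subgrpZ sP).
rewrite Ev in le.
have := len3 sP ll PtV Pu Pt'; have := len3 sP ll PtV Pv Pt'.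
rewrite (lenV ll Pt); glia.
Qed.

(** Both exponents are divided with remainder and the remainders are absorbed into [u]. They commute
    with the powers in a commensuration, which therefore passes back to [u]. *)
Lemma commens_bound_pow h h' m n : 0 < m -> 0 < n -> P h -> P h' ->
  commens_bound P (h ^+ m) (h' ^+ n) -> commens_bound P h h'.
Proof.
move=> m0 n0 Ph Ph' [l ll [B H]].
exists (fun x => m * l x)%N; first exact: lenfun_scale.
exists ((m + n) * B + m + m * (m * l h + n * l h'))%N => a b u Pu.
pose a' := (a %/ m)%Z; pose r := (a %% m)%Z.
pose b' := (b %/ n)%Z; pose r' := (b %% n)%Z.
have Ea : a = (m%:Z * a' + r)%R by rewrite {1}(divz_eq a m) GRing.mulrC.
have Eb : b = (r' + n%:Z * b')%R by rewrite {1}(divz_eq b n) GRing.mulrC GRing.addrC.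
have Hr : absz r <= m by rewrite /r; have := modz_ge0 a (d := m); have := ltz_pmod a (d := m); lia.
have Hr' : absz r' <= n by rewrite /r'; have := modz_ge0 b (d := n); have := ltz_pmod b (d := n); lia.
have PZ z : P (zpow h z) := subgrpZ sP z Ph.
have PZ' z : P (zpow h' z) := subgrpZ sP z Ph'.
have Pu' : P (zpow h r * u * zpow h' r') by do 2?apply: (subgrpM sP).
have := H a' b' _ Pu'.
have -> : zpow (h ^+ m) a' * (zpow h r * u * zpow h' r') * zpow (h' ^+ n) b' =
   zpow h a * u * zpow h' b.
  have hC : zpow h (m%:Z * a')%R * zpow h r = zpow h a by rewrite -zpowD -Ea.
  have hC' : zpow h' r' * zpow h' (n%:Z * b')%R = zpow h' b by rewrite -zpowD -Eb.
  by rewrite !expg_zpow !gmulA hC -!gmulA hC'.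
case=> [le|[p [q [H1 H2 E]]]].
  left; have := len3 sP ll (PZ r) Pu (PZ' r').
  have := lenZ sP ll r Ph; have := lenZ sP ll r' Ph'.
  have : absz a <= m * absz a' + m by rewrite Ea; lia.
  have : absz r * l h <= m * l h by rewrite leq_mul2r Hr orbT.
  have : absz r' * l h' <= n * l h' by rewrite leq_mul2r Hr' orbT.
  move: le; move: (l (_ * u * _)) (l (_ * u * _)) (l (zpow _ _)) (l (zpow _ _)) (l u) => X1 X2 X3 X4 X5.
  move: (absz r * _)%N (absz r' * _)%N (m * l h)%N (n * l h')%N (absz a) (absz a') => *.
  nia.
right; exists (n * p)%N, (m%:Z * q)%R; split.
- rewrite muln_gt0 n0; case/andP: H1 => -> pB.
  have := leq_mul (leqnn n) pB; clear; lia.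
- rewrite abszM absz_nat muln_gt0 m0; case/andP: H2 => -> qB.
  have := leq_mul (leqnn m) qB; clear; lia.
rewrite zpowM expgnA zpow_nat; apply: (mulgI (zpow h r)); apply: (mulIg (zpow h' r')).
move: E; rewrite !gmulA => E.
have -> : zpow h r * zpow (h ^+ m) q = zpow (h ^+ m) q * zpow h r.
  by rewrite expg_zpow zpowC.
rewrite -E -!gmulA; do 2 congr (_ * _).
by rewrite -expgnA -zpow_nat zpowC.
Qed.

End CommensBound.

(** Excludes Baumslag-Solitar relations. The lengths of the [p * m]-th and [q * m]-th powers of [h]
    differ by at most [2 * l u], while [l] grows at the same positive rate along both; taking [m]
    beyond all error terms forces equality. *)
Lemma bcomm_abs (G : groupType) (P : G -> Prop) (h u : G) (p : nat) (q : int) :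
  subgrp P -> undistorted P -> P h -> P u -> h <> 1 ->
  u * h ^+ p = zpow h q * u -> absz q = p.
Proof.
move=> sP uP Ph Pu h1 E; case: (uP [:: h]) => [x|l ll]; first by rewrite inE => /eqP ->.
move=> /(_ h (mem_head _ _)) [k [K [/(_ h1) k0 H]]].
have Lb z : k * absz z <= l (zpow h z).
  exact: (tame_zpow sP ll Ph (fun m => proj1 (H m))).
have Ub z : l (zpow h z) <= k * absz z + K.
  case: z => n; first exact: (proj2 (H n)).
  rewrite NegzE zpowN (lenV ll) ?abszN; last exact: (subgrpX sP).
  exact: (proj2 (H _)).
have Em m : u * zpow h (p%:Z * m%:Z)%R = zpow h (q * m%:Z)%R * u.
  by rewrite !zpowM; apply: zpow_intertwine.
have PZ z := subgrpZ sP z Ph.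
have L1 m : l (zpow h (p%:Z * m%:Z)%R) <= l (zpow h (q * m%:Z)%R) + l u + l u.
  have := lenMl sP ll Pu (PZ (p%:Z * m%:Z)%R); rewrite Em.
  have := lenM ll (PZ (q * m%:Z)%R) Pu; glia.
have L2 m : l (zpow h (q * m%:Z)%R) <= l (zpow h (p%:Z * m%:Z)%R) + l u + l u.
  have := lenMr sP ll (PZ (q * m%:Z)%R) Pu; rewrite -Em.
  have := lenM ll Pu (PZ (p%:Z * m%:Z)%R); glia.
have [m m_def] : exists m, m = (K + l u + l u).+1 by eexists.
have := L1 m; have := L2 m.
have := Lb (p%:Z * m%:Z)%R; have := Lb (q * m%:Z)%R.
have := Ub (p%:Z * m%:Z)%R; have := Ub (q * m%:Z)%R.
rewrite !abszM !absz_nat => u1 u2 b1 b2 c1 c2.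
have d1 : k * (absz q * m) <= k * (p * m) + (K + l u + l u) by lia.
have d2 : k * (p * m) <= k * (absz q * m) + (K + l u + l u) by lia.
clear -k0 d1 d2 m_def; move: d1 d2; rewrite m_def.
move: (K + l u + l u)%N (absz q) => C n {m_def}.
have key a b : k * (b * C.+1) <= k * (a * C.+1) + C -> b <= a.
  move=> le; rewrite leqNgt; apply/negP => lt.
  have : k * (a.+1 * C.+1) <= k * (b * C.+1) by rewrite leq_mul2l leq_mul2r lt !orbT.
  have : C.+1 <= k * C.+1 by rewrite leq_pmull.
  by rewrite mulSn mulnDr; lia.
by move=> /key le1 /key le2; apply/eqP; rewrite eqn_leq le1 le2.
Qed.

(** * Carrying powers of the edge generator through reduced words *)

Section Elliptic.
Variables (G : groupType) (I : finType) (i0 : I) (P : I -> G -> Prop) (c : G).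
Hypothesis spl : splitting i0 P c.
Hypothesis gP : forall i, good (P i).
Let sP i := spl_sub spl i.
Let Pc i := spl_edge spl i.
Let sE := edge_subgrp c.
Local Notation edge := (edge c).
Local Notation idx := (idx i0 P).
Local Notation syllable := (syllable P c).
Local Notation reduced := (reduced i0 P c).
Local Notation aligned := (aligned i0 P c).
Implicit Types (x y g h t u v : G) (s r : seq G) (i j : I) (z : int).

Let uP i : undistorted (P i). Proof. by case: (gP i). Qed.
Let cP i : linear_commens (P i). Proof. by case: (gP i). Qed.

(** By [bcomm_abs] an element conjugating powers of a nontrivial [c] within a vertex group can only
    keep or invert the exponent, whence the sign [e]. *)
Definition commens (p : nat) x : Prop :=
  exists2 e : int, absz e = 1%N & x * zpow c p = zpow c (e * p%:Z)%R * x.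

Lemma commensZ (p : nat) x z (e : int) : x * zpow c p = zpow c (e * p%:Z)%R * x ->
  x * zpow c (p%:Z * z)%R = zpow c (e * (p%:Z * z))%R * x.
Proof. by move=> E; rewrite GRing.mulrA !(zpowM _ _ z); apply: zpow_intertwine. Qed.

Lemma commensM (p : nat) x y : commens p x -> commens p y -> commens p (x * y).
Proof.
move=> [e e1 E] [e' e1' E']; exists (e * e')%R; first by rewrite abszM e1 e1'.
rewrite -gmulA E' [(e' * _)%R]GRing.mulrC gmulA (commensZ e' E) -gmulA.
by congr (zpow c _ * _); rewrite [(p%:Z * _)%R]GRing.mulrC GRing.mulrA.
Qed.

Lemma commens_wprod p s : (forall x, x \in s -> commens p x) -> commens p (wprod s).
Proof.
elim: s => [|a s IH] H; first by exists 1%R => //; rewrite GRing.mul1r /= mul1g mulg1.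
apply: commensM; first by apply: H; rewrite mem_head.
by apply: IH => x xs; apply: H; rewrite inE xs orbT.
Qed.

Lemma commens_fact p B x : 0 < p <= B -> commens p x -> commens B`! x.
Proof.
move=> pB [e e1 E]; exists e => //.
have /dvdnP[m ->] : p %| B`! by apply: dvdn_fact.
by rewrite mulnC PoszM; apply: commensZ.
Qed.

Lemma edge_commens : exists (l : I -> G -> nat) (p B : nat),
  [/\ 0 < p, forall i, lenfun (P i) (l i) &
   forall i a b x, P i x ->
     absz a <= l i x + l i (zpow c a * x * zpow c b) + B \/ commens p x].
Proof.
case: (EM (c = 1)) => [c1|nc1].
  exists (fun _ _ => 0), 1%N, 0; split=> // i a b x _; right.
  by exists 1%R => //; rewrite c1 !zpow1g mul1g mulg1.
have /choice[l Hl] : forall i, exists l, lenfun (P i) l /\ exists B, forall a b x, P i x -> absz a <= l x + l (zpow c a * x * zpow c b) + B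
     \/ bcomm B c c x.
  move=> i; case: (cP (Pc i) (Pc i) nc1 nc1) => l ll [B H]; exists l; split=> //.
  by exists B.
have /choice[B HB] := fun i => proj2 (Hl i).
(* This factorial is a multiple of every exponent that can occur, so one [p] serves all vertex
   groups. *)
exists l, (\sum_i B i)`!, (\sum_i B i); split=> [|i|i a b x Px].
- exact: fact_gt0.
- by case: (Hl i).
have le : B i <= \sum_i B i by rewrite [leqRHS](bigD1 i) //= leq_addr.
case: (HB i a b x Px) => [h|[p [q [H1 H2 E]]]]; first by left; lia.
right; apply: (@commens_fact p); first lia.
have qp := bcomm_abs (sP i) (@uP i) (Pc i) Px nc1 E.
have [Eq | Eq] : q = Posz p \/ q = (- Posz p)%R by lia.
  by exists 1%R => //; rewrite GRing.mul1r zpow_nat E Eq.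
by exists (-1)%R => //; rewrite GRing.mulN1r zpow_nat E Eq.
Qed.

Section Chain.
Variables (w : G -> nat) (k p : nat).
Hypotheses (lw : forall i, lenfun (P i) w) (k0 : 0 < k).
Hypothesis wE : forall z, w (zpow c z) = (k * absz z)%N.
Hypothesis wC : forall a b x, syllable x ->
  absz a <= 2 * (w x + w (zpow c a * x * zpow c b)) \/ commens p x.

Lemma edge_drift i (a b : int) x : P i x ->
  absz a <= absz b + w x + w (zpow c a * x * zpow c (- b)%R).
Proof.
move=> Px; set y := _ * x * _.
have Py : P i y by rewrite /y; do 2?apply: (subgrpM (sP i)) => //; apply: (subgrpZ (sP i)).
have : zpow c a = y * zpow c b * x^-1.
  by rewrite /y zpowN -!gmulA mulKg mulgV mulg1.
have := len3 (sP i) (lw i) Py (subgrpZ (sP i) b (Pc i)) (subgrpV (sP i) Px).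
move=> + E; rewrite -E !wE (lenV (lw i) Px); nia.
Qed.

(** By [edge_drift], crossing the letters [a] and [b] changes [absz f] by at most [w a + w b].
    Starting above twice the total cost, it remains above twice the remaining cost, so the first
    alternative of [wC] fails at every letter. *)
Lemma chain (f : int) s (t : seq G) y : reduced s -> reduced t ->
  aligned (zpow c f) s t y -> 2 * (cost w s + cost w t) < absz f ->
  (forall x, x \in s -> commens p x) /\ exists2 f', y = zpow c f' & absz f <= absz f' + cost w s + cost w t.
Proof.
elim: s t f => [|a s IH] [|b t] f //=.
  by move=> _ _ <- _; split=> //; exists f => //; lia.
rewrite !reduced_cons => /and3P[sa rs _] /and3P[sb rt _].
rewrite !cost_cons => -[_ [[f1 ->] e E A]] lt.
have Eb : zpow c f * a * zpow c (- f1)%R = b by rewrite E zpowN mulgK.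
have Pa := syllable_idx spl sa.
have D := edge_drift f f1 Pa; rewrite Eb in D.
have [h|ca] := wC f (- f1)%R sa; first by rewrite Eb in h; lia.
have [H [f' -> le]] := IH t f1 rs rt A ltac:(lia).
split; last by exists f' => //; lia.
by move=> x; rewrite inE => /orP[/eqP ->|/H].
Qed.

End Chain.

(** Together with [ends_off] this describes the middle words in representatives of the double cosets
    of [P i] and [P j]: the outer factors cannot merge with them. *)
Definition starts_off i s : bool := if s is a :: _ then idx a != i else true.
Definition ends_off j s : bool := if s is a :: s' then idx (last a s') != j else true.

Section Triples.
Variable w : G -> nat.
Hypothesis lw : forall i, lenfun (P i) w.

Lemma triple i j g : exists x s y,
  [/\ g = x * wprod s * y, P i x /\ P j y,
      [/\ reduced s, starts_off i s & ends_off j s] &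
      w x + cost w s + w y <= glen P w g].
Proof.
have [r [Nr <- <-]] := glen_normal spl lw g.
have w1 : w 1 = 0 := len1 (lw i).
case: Nr => [[x Ex ->]|[R _]].
  exists x, [::], 1; split=> //; first by rewrite /= !mulg1.
    by split; [apply: (edgeP spl) | apply: (subgrp1 (sP j))].
  by rewrite w1 cost1 /cost big_nil !addn0.
have [x [s [E Px R' [H C]]]] : exists x s, [/\ wprod r = x * wprod s, P i x,
    reduced s & starts_off i s /\ w x + cost w s <= cost w r].
  case: r R => [|a r] R.
    by exists 1, [::]; rewrite mul1g w1; split=> //; apply: (subgrp1 (sP i)).
  have [ia|ia] := eqVneq (idx a) i; last first.
    by exists 1, (a :: r); rewrite mul1g w1 /= ia; split=> //; apply: (subgrp1 (sP i)).
  exists a, r; rewrite cost_cons; move: R; rewrite reduced_cons => /and3P[sa rr ja].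
  split=> //; first by rewrite -ia; apply: (syllable_idx spl).
  by split=> //; move: ja; case: (r) => //= b r'; rewrite ia eq_sym.
rewrite E; case/lastP: s R' H C {E R} => [|s y] R H C.
  exists x, [::], 1; rewrite /= !mulg1 w1 addn0; split=> //.
  by split=> //; apply: (subgrp1 (sP j)).
have [iy|iy] := eqVneq (idx y) j; last first.
  exists x, (rcons s y), 1; rewrite mulg1 w1 addn0; split=> //.
    by split=> //; apply: (subgrp1 (sP j)).
  split=> //; rewrite /ends_off; case: (s) => //= a s'; by rewrite last_rcons.
exists x, s, y; rewrite wprod_rcons gmulA; move: C; rewrite cost_rcons => C.
move: R; rewrite reduced_rcons => /and3P[R sy jy]; split=> //; last by lia.
  by split=> //; rewrite -iy; apply: (syllable_idx spl).
split=> //; first by move: H; case: (s).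
by move: jy; case: (s) => //= a s'; rewrite iy.
Qed.

End Triples.

(** If [x'^-1 * x] or [y * y'^-1] is not an edge element, it is an additional outer syllable of a
    reduced word aligned with [s'], whose end has the wrong index for this. The exception is [i = j]
    with empty [s], where the two outer factors meet and merge. *)
Lemma triple_rigid i j x s y x' s' y' :
  P i x -> P j y -> P i x' -> P j y' ->
  [/\ reduced s, starts_off i s & ends_off j s] ->
  [/\ reduced s', starts_off i s' & ends_off j s'] ->
  x * wprod s * y = x' * wprod s' * y' ->
  [/\ i = j, s = [::] & s' = [::]] \/
  exists f0 f1 : int, [/\ x = x' * zpow c f0,
     aligned (zpow c f0) s s' (zpow c f1) & zpow c f1 * y = y'].
Proof.
move=> Px Py Px' Py' [R S0 T0] [R' S0' T0'] E.
set al := x'^-1 * x; set be := y * y'^-1.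
have Pal : P i al by apply: (subgrpM (sP i)) => //; apply: (subgrpV (sP i)).
have Pbe : P j be by apply: (subgrpM (sP j)) => //; apply: (subgrpV (sP j)).
have {}E : al * wprod s * be = wprod s'.
  rewrite /al /be !gmulA; apply: (mulIg y'); apply: (mulgI x').
  by rewrite mulgVK !gmulA mulgV mul1g E.
have E1 := subgrp1 sE.
have noL (t : seq G) : reduced (al :: t) -> idx al = i -> wprod (al :: t) = wprod s' * 1 -> False.
  move=> Rt ial W; have := alignedP spl Rt R' E1 E1; rewrite mul1g => /(_ W).
  by case: (s') S0' => //= b s'' ne [z [_ e _ _]]; move: ne; rewrite -e ial eqxx.
have noR : edge al ->
    reduced (rcons s be) -> idx be = j -> False.
  move=> Eal Rt ibe; have := alignedP spl Rt R' Eal E1.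
  rewrite wprod_rcons gmulA mulg1 E => /(_ erefl).
  case/lastP: (s') T0' => [|s'' d] T A; first by have := aligned_size A; rewrite size_rcons.
  have sz : size s = size s''.
    by have := aligned_size A; rewrite !size_rcons => -[].
  move: A; rewrite -!cats1 => /(aligned_cat sz)[z _ /= [_ [_ e _ _]]].
  move: T; rewrite /ends_off.
  by case: (s'') => [|q r] /=; rewrite ?last_rcons -e ibe eqxx.
case: (EM (edge al)) => [Eal|nEal]; case: (EM (edge be)) => [Ebe|nEbe].
- right; have := alignedP spl R R' Eal (subgrpV sE Ebe).
  rewrite -E mulgK => /(_ erefl); case: Eal => f0 Ef0.
  case: Ebe => f1 Ef1 A; exists f0, (- f1)%R; rewrite zpowN -Ef1 -Ef0; split=> //.
    by rewrite /al mulVKg.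
  by rewrite /be ginvM invgK mulgVK.
- have [sbe ibe] := syllableI spl Pbe nEbe.
  exfalso; apply: noR => //; rewrite reduced_rcons R sbe /=.
  by move: T0; case: (s) => //= a s1; rewrite ibe.
- have [sal ial] := syllableI spl Pal nEal.
  have Ral : reduced (al :: s).
    by rewrite reduced_cons sal R /=; move: S0; case: (s) => //= a s1; rewrite ial eq_sym.
  exfalso; have := alignedP spl Ral R' E1 (subgrpV sE Ebe).
  rewrite mul1g /= -E mulgK => /(_ erefl).
  by case: (s') S0' => //= b s'' ne [z [_ e _ _]]; move: ne; rewrite -e ial eqxx.
have [sal ial] := syllableI spl Pal nEal.
have [sbe ibe] := syllableI spl Pbe nEbe.
case: (EM (i = j /\ s = [::])) => [[ij s0]|nij]; last first.
  exfalso; apply: (noL (rcons s be)) => //; last by rewrite /= wprod_rcons mulg1 gmulA.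
  rewrite -rcons_cons reduced_rcons reduced_cons sal R sbe /=.
  apply/andP; split; first by move: S0; case: (s) => //= a s1; rewrite ial eq_sym.
  move: T0 nij; case: (s) => [|a s1] /=; last by rewrite ibe.
  by move=> _ nij; rewrite ial ibe; apply/eqP => ij; apply: nij.
left; split=> //; case: (s') S0' R' E => [|b [|d s'']] //= S0' R' E.
  case/negP: S0'; apply/eqP.
  have Pb : P i b.
    by move: E; rewrite s0 /= !mulg1 => <-; apply: (subgrpM (sP i)); rewrite ?ij //; rewrite -ij.
  by move: R'; rewrite reduced_cons => /and3P[sb _ _]; exact: proj2 (syllableI spl Pb (syllable_edge sb)).
case: (spl_red spl (i := i) R') => //=.
rewrite -E s0 /= mulg1; apply: (subgrpM (sP i)) => //; by rewrite ij.
Qed.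

End Elliptic.

(** * Commensuration involving elliptic elements *)

Section EllipticCommens.
Variables (G : groupType) (I : finType) (i0 : I) (P : I -> G -> Prop) (c : G).
Hypothesis spl : splitting i0 P c.
Hypothesis gP : forall i, good (P i).
Let sP i := spl_sub spl i.
Let Pc i := spl_edge spl i.
Let sE := edge_subgrp c.
Local Notation edge := (edge c).
Local Notation idx := (idx i0 P).
Local Notation syllable := (syllable P c).
Local Notation reduced := (reduced i0 P c).
Local Notation full := (fun _ : G => True).
Implicit Types (x y g h t u v : G) (s r : seq G) (i j : I) (z : int).

Let uP i : undistorted (P i). Proof. by case: (gP i). Qed.
Let cP i : linear_commens (P i). Proof. by case: (gP i). Qed.
Let sT : subgrp full. Proof. by []. Qed.

(** The factor 2 replaces the additive constant of [edge_commens]: in [edge_norm_exists] every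
    syllable costs more than that constant. *)
Definition edge_norm (w : G -> nat) (k p : nat) : Prop :=
  [/\ forall i, lenfun (P i) w, c <> 1 -> 0 < k, 0 < p,
      forall z, w (zpow c z) = (k * absz z)%N &
      forall (a b : int) x, syllable x ->
        absz a <= 2 * (w x + w (zpow c a * x * zpow c b)) \/ commens c p x].

Lemma edge_norm_exists (L : I -> G -> nat) : (forall i, lenfun (P i) (L i)) ->
  exists w k p, edge_norm w k p /\ forall i x, P i x -> L i x <= w x.
Proof.
move=> LP; have [l [p [B [p0 ll Hl]]]] := edge_commens spl gP.
have LP' i : lenfun (P i) (fun x => L i x + l i x) by apply: lenfunD.
have [w [k [M [[lw k0 wE MB] [_ wM wL _]]]]] :=
  norm_exists (F := fun=> [::]) (S := [::]) spl uP B (fun _ _ _ => ltac:(by [])) LP'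
    (fun _ _ => ltac:(by [])).
exists w, k, p; split; last by move=> i x /(wL i); lia.
split=> // a b x sx; have Px := syllable_idx spl sx.
case: (Hl _ a b x Px) => [le|]; [left|by right].
have Py : P (idx x) (zpow c a * x * zpow c b).
  by do 2?apply: (subgrpM (sP _)) => //; apply: (subgrpZ (sP _)).
have := wL _ _ Px; have := wL _ _ Py; have := wM x sx; lia.
Qed.

Lemma elliptic_commens i j h h' : P i h -> P j h' -> h <> 1 -> h' <> 1 ->
  commens_bound full h h'.
Proof.
move=> Ph Ph' h1 h1'.
have [lH llH HH] := undistorted_zpow (sP i) (@uP i) Ph h1.
have [lD [BD [llD HD]]] : exists lD BD, lenfun (P i) lD /\ (i = j ->
    forall (a b : int) u, P i u ->
    absz a <= lD u + lD (zpow h a * u * zpow h' b) + BD \/ bcomm BD h h' u).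
  have [ij|ne] := eqVneq i j.
    have Ph'i : P i h' by rewrite ij.
    have [lD llD [BD HD]] := cP Ph Ph'i h1 h1'.
    by exists lD, BD; split.
  by exists (fun=> 0), 0; split=> // ij; rewrite ij eqxx in ne.
have [lA [lB [B [llA llB HAB]]]] : exists lA lB B, [/\ lenfun (P i) lA, lenfun (P j) lB &
    c <> 1 -> (forall (a b : int) u, P i u ->
      absz a <= lA u + lA (zpow h a * u * zpow c b) + B \/ bcomm B h c u) /\
     (forall (a b : int) u, P j u ->
      absz a <= lB u + lB (zpow c a * u * zpow h' b) + B \/ bcomm B c h' u)].
  case: (EM (c = 1)) => [c1|nc1]; first by exists (fun=> 0), (fun=> 0), 0; split.
  have [lA llA [BA HA]] := cP Ph (Pc i) h1 nc1.
  have [lB llB [BB HB]] := cP (Pc j) Ph' nc1 h1'.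
  exists lA, lB, (BA + BB)%N; split=> // _; split=> a b u Pu.
    case: (HA a b u Pu) => [le|bc]; [left; lia | right].
    by apply: bcomm_mono bc; lia.
  case: (HB a b u Pu) => [le|bc]; [left; lia | right].
  by apply: bcomm_mono bc; lia.
pose L m x := (if m == i then lH x + lD x + lA x else 0) + (if m == j then lB x else 0).
have LP m : lenfun (P m) (L m).
  apply: lenfunD.
    by case: eqVneq => [->|_]; [do 2?apply: lenfunD | apply: lenfun0].
  by case: eqVneq => [->|_]; [ | apply: lenfun0].
have [w [k [p [[lw k0 p0 wE wC] wL]]]] := edge_norm_exists LP.
have wi x : P i x -> lH x <= w x /\ lD x <= w x /\ lA x <= w x.
  by move=> /wL; rewrite /L eqxx; lia.
have wj x : P j x -> lB x <= w x.
  by move=> /wL; rewrite /L eqxx; lia.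
have lg := glen_lenfun spl lw.
have gE x m : P m x -> glen P w x = w x := glen_vertex spl lw (i := m) (x := x).
exists (fun x => (1 + 2 * k) * glen P w x)%N; first exact: lenfun_scale.
exists (BD + k * B + B + B * p * B)%N => a b u _; set v := _ * u * _.
have [x [s [y [Eu [Px Py] Ts Cu]]]] := triple spl lw i j u.
have [x' [s' [y' [Ev [Px' Py'] Ts' Cv]]]] := triple spl lw i j v.
have PZ := subgrpZ (sP i) a Ph; have PZ' := subgrpZ (sP j) b Ph'.
have E : (zpow h a * x) * wprod s * (y * zpow h' b) = x' * wprod s' * y'.
  by rewrite -Ev /v Eu !gmulA.
have := triple_rigid spl (subgrpM (sP i) PZ Px) (subgrpM (sP j) Py PZ')
  Px' Py' Ts Ts' E.
case=> [[ij s0 s0']|[f0 [f1 [E0 A E1]]]].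
  have Pu : P i u.
    rewrite Eu s0 /= mulg1; apply: (subgrpM (sP i)) => //; by rewrite ij.
  have Pv : P i v.
    rewrite Ev s0' /= mulg1; apply: (subgrpM (sP i)) => //; by rewrite ij.
  case: (HD ij a b u Pu) => [le|bc]; last by right; apply: bcomm_mono bc; lia.
  left; rewrite (gE _ _ Pu) (gE _ _ Pv).
  have [_ [d1 _]] := wi u Pu; have [_ [d2 _]] := wi v Pv.
  move: le; rewrite -/v; nia.
have Ha : absz a <= w x + w x' + k * absz f0.
  have Eh : zpow h a = x' * zpow c f0 * x^-1 by rewrite -E0 mulgK.
  apply: leq_trans (HH a) _; apply: leq_trans (proj1 (wi _ PZ)) _.
  have := len3 (sP i) (lw i) Px' (subgrpZ (sP i) f0 (Pc i)) (subgrpV (sP i) Px).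
  by rewrite Eh wE (lenV (lw i) Px); glia.
pose N := glen P w u + glen P w v.
(* A small [f0] bounds [a] through [Ha]. For a large one [chain] makes the middle word commensurate
   [c], and it remains to ask the same of [x] and [y] in their vertex groups. *)
have [le|lt] := leqP (absz f0) (2 * N).
  left; have : k * absz f0 <= k * (2 * N) by rewrite leq_mul2l le orbT.
  move: Cu Cv; rewrite /N; nia.
case: (EM (c = 1)) => [c1|nc1].
  have := wE 1%R; rewrite c1 !zpow1g (len1 (lw i)) => k1.
  have k00 : k = 0 by lia.
  by left; rewrite k00; move: Ha Cu Cv; rewrite k00; lia.
have {}k0 := k0 nc1; have [HA HB] := HAB nc1.
have [R _ _] := Ts; have [R' _ _] := Ts'.
have lt' : 2 * (cost w s + cost w s') < absz f0 by move: Cu Cv lt; rewrite /N; lia.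
have [Hs [f' Ef' lef]] := chain spl lw k0 wE wC R R' A lt'.
have hu : glen P w u <= (1 + 2 * k) * glen P w u by rewrite leq_pmull.
have hv : glen P w v <= (1 + 2 * k) * glen P w v by rewrite leq_pmull.
have {Ef'} ff : f1 = f' by apply: (undistorted_zpow_inj (sP i) (@uP i) (Pc i) nc1).
subst f'.
have Ex' : zpow h a * x * zpow c (- f0)%R = x' by rewrite E0 zpowN mulgK.
case: (HA a (- f0)%R x Px) => [le|[p1 [q1 [p1B q1B C1]]]].
  rewrite Ex' in le; left.
  have [_ [_ a1]] := wi x Px; have [_ [_ a2]] := wi x' Px'.
  by move: Cu Cv le a1 a2 hu hv; clear; lia.
have E1' : zpow c f1 * y * zpow h' b = y' by rewrite -gmulA.
case: (HB f1 b y Py) => [le|[p2 [q2 [p2B q2B C2]]]].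
  rewrite E1' in le; left.
  have b1 := wj y Py; have b2 := wj y' Py'.
  have le0 : absz f0 <= 2 * N + B by move: Cu Cv lef le; rewrite /N; lia.
  have : k * absz f0 <= k * (2 * N + B) by rewrite leq_mul2l le0 orbT.
  by move: Cu Cv Ha; rewrite /N; clear; lia.
right; have [e e1 Es] := commens_wprod Hs.
(* [p2] moves the power of [h'] across [y]; divisibility of the result by [p] and by [p1] then
   allows it to cross the middle word and [x]. *)
pose m := (p2 * (p * p1))%N.
exists m, (q1 * e * p%:Z * q2)%R; split.
- rewrite /m; apply/andP; split; first by rewrite !muln_gt0; lia.
  have : p2 * (p * p1) <= B * (p * B) by apply: leq_mul; [lia|apply: leq_mul; lia].
  by lia.
- rewrite !abszM e1 absz_nat muln1; apply/andP; split; first by rewrite !muln_gt0; lia.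
  have : absz q1 * p * absz q2 <= B * p * B by do 2?apply: leq_mul; lia.
  by lia.
have Y : y * h' ^+ m = zpow c (p%:Z * (p1%:Z * q2))%R * y.
  rewrite /m expgnA (expg_intertwine _ C2) -zpow_nat -zpowM.
  by congr (zpow c _ * _); lia.
have S : wprod s * zpow c (p%:Z * (p1%:Z * q2))%R =
         zpow c (e * (p%:Z * (p1%:Z * q2)))%R * wprod s.
  by apply: commensZ.
have X : x * zpow c (e * (p%:Z * (p1%:Z * q2)))%R = zpow h (q1 * e * p%:Z * q2)%R * x.
  have -> : (e * (p%:Z * (p1%:Z * q2)) = p1%:Z * (e * p%:Z * q2))%R by lia.
  rewrite zpowM (zpow_intertwine _ C1) -zpowM; congr (zpow h _ * _); lia.
by rewrite Eu -gmulA Y !gmulA -(gmulA x) S !gmulA X.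
Qed.

(** Syllable length, obtained as a [glen] so that all facts about [glen] apply to it. *)
Definition tree_len : G -> nat := glen P (fun x => ~~ `[< edge x >] : nat).

Lemma edge_count i : lenfun (P i) (fun x => ~~ `[< edge x >] : nat).
Proof.
split=> [|x y Px Py|x Px].
- by have -> : `[< edge 1 >] by apply/asboolP/(subgrp1 sE).
- case: asboolP => [_|n] //=; case: asboolP => //= ex; case: asboolP => //= ey.
  by case: n; apply: (subgrpM sE).
- congr (~~ _ : nat); apply/asboolP/asboolP; last exact: (subgrpV sE).
  by move/(subgrpV sE); rewrite invgK.
Qed.

Lemma tree_lenfun : lenfun full tree_len.
Proof. exact: (glen_lenfun spl edge_count). Qed.

Lemma tree_len_vertex i x : P i x -> tree_len x <= 1.
Proof. by move=> Px; rewrite /tree_len (glen_vertex spl edge_count Px) leq_b1. Qed.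

Lemma tree_len_reduced s : reduced s -> tree_len (wprod s) = size s.
Proof.
move=> R; have [->|ne] := eqVneq s [::]; first exact: (len1 tree_lenfun).
have [s' [R' A W]] := glen_reduced spl edge_count R ne erefl.
rewrite -/tree_len => <-; rewrite -(aligned_size A).
move/reduced_syll: R'; elim: (s') => [|a r IH] /=; first by rewrite /cost big_nil.
move=> /andP[sa /IH Er]; rewrite cost_cons Er.
by have /asboolPn -> := syllable_edge sa.
Qed.

Lemma tree_len_cyclic s n : cyclic i0 P c s ->
  tree_len (wprod s ^+ n) = (n * size s)%N.
Proof.
by move=> cs; rewrite -wprod_spow tree_len_reduced ?size_spow //; apply: spow_reduced.
Qed.

Lemma tree_len_cyclicZ s z : cyclic i0 P c s -> absz z <= tree_len (zpow (wprod s) z).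
Proof.
move=> cs; have := cyclic_size cs.
case: z => n /=; last rewrite (lenV tree_lenfun) //; rewrite tree_len_cyclic //; nia.
Qed.

(** Syllable length grows along the powers of [wprod s] but is at most 1 on those of [h'], so the
    bound always holds and no commensuration occurs. *)
Lemma hyp_ell_commens s j h' : cyclic i0 P c s -> P j h' ->
  commens_bound full (wprod s) h'.
Proof.
move=> cs Ph'; exists tree_len; first exact: tree_lenfun.
exists 1%N => a b u _; left; set v := _ * u * _.
apply: leq_trans (tree_len_cyclicZ a cs) _.
have -> : zpow (wprod s) a = v * (zpow h' b)^-1 * u^-1 by rewrite /v !mulgK.
have := len3 sT tree_lenfun (x := v) (y := (zpow h' b)^-1) (t := u^-1) Logic.I Logic.I Logic.I.
have := tree_len_vertex (subgrpV (sP j) (subgrpZ (sP j) b Ph')).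
by rewrite (lenV tree_lenfun (x := u)) //; glia.
Qed.

(** Here syllable length bounds only [b]. The power of [h] is then a product of short elements, and
    [h] is undistorted in the amalgam. *)
Lemma ell_hyp_commens s i h : cyclic i0 P c s -> P i h -> h <> 1 ->
  commens_bound full h (wprod s).
Proof.
move=> cs Ph h1; have uG := splitting_undistorted spl uP.
have [l ll Hl] := undistorted_zpow sT uG (h := h) Logic.I h1.
exists (fun x => l x + l (wprod s) * tree_len x).
  by apply: lenfunD => //; apply: lenfun_scale; exact: tree_lenfun.
exists (l (wprod s)) => a b u _; left; set v := _ * u * _.
have Hb : absz b <= tree_len u + tree_len v + 1.
  apply: leq_trans (tree_len_cyclicZ b cs) _.
  have -> : zpow (wprod s) b = u^-1 * (zpow h a)^-1 * v.
    by rewrite /v !gmulA mulgVK mulVg mul1g.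
  have := len3 sT tree_lenfun (x := u^-1) (y := (zpow h a)^-1) (t := v) Logic.I Logic.I Logic.I.
  have := tree_len_vertex (subgrpV (sP i) (subgrpZ (sP i) a Ph)).
  by rewrite (lenV tree_lenfun (x := u)) //; glia.
apply: leq_trans (Hl a) _.
have -> : zpow h a = v * (zpow (wprod s) b)^-1 * u^-1 by rewrite /v !mulgK.
have := len3 sT ll (x := v) (y := (zpow (wprod s) b)^-1) (t := u^-1) Logic.I Logic.I Logic.I.
rewrite (lenV ll (x := u)) // (lenV ll (x := zpow (wprod s) b)) //.
have := lenZ sT ll b (x := wprod s) Logic.I.
have : absz b * l (wprod s) <= (tree_len u + tree_len v + 1) * l (wprod s).
  by rewrite leq_mul2r Hb orbT.
by rewrite !mulnDl [(tree_len u * _)%N]mulnC [(tree_len v * _)%N]mulnC; glia.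
Qed.

End EllipticCommens.

Lemma pigeonhole (f : nat -> nat) m : (forall j, j <= m -> f j < m) ->
  exists i j, i < j <= m /\ f i = f j.
Proof.
move=> H; pose g (j : 'I_m.+1) : 'I_m := Ordinal (H j (ltn_ord j)).
have /injectivePn[i [j ne E]] : ~~ injectiveb g.
  by apply/negP => /injectiveP/leq_card; rewrite !card_ord ltnn.
have Ef : f i = f j by case: E.
have [lt|lt|/val_inj e] := ltngtP i j; last by rewrite e eqxx in ne.
  by exists i, j; split=> //; rewrite lt -ltnS ltn_ord.
by exists j, i; split=> //; rewrite lt -ltnS ltn_ord.
Qed.

(** * Overlap of the axes of two hyperbolic elements *)

Section Alignment.
Variables (G : groupType) (I : finType) (i0 : I) (P : I -> G -> Prop) (c : G).
Hypothesis spl : splitting i0 P c.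
Let sP i := spl_sub spl i.
Let sE := edge_subgrp c.
Local Notation edge := (edge c).
Local Notation idx := (idx i0 P).
Local Notation syllable := (syllable P c).
Local Notation reduced := (reduced i0 P c).
Local Notation aligned := (aligned i0 P c).
Local Notation cyclic := (cyclic i0 P c).
Local Notation tree_len := (tree_len P c).
Local Notation full := (fun _ : G => True).
Implicit Types (x y g h u v z : G) (s A B R : seq G).
Let sT : subgrp full. Proof. by []. Qed.
Let lT := tree_lenfun spl.

Lemma reduced_rcons_idx A x y : syllable y -> idx y = idx x ->
  reduced (rcons A x) -> reduced (rcons A y).
Proof.
move=> sy iy; rewrite !reduced_rcons sy => /and3P[-> _] /=.
by case: A => //= a A; rewrite iy.
Qed.

Lemma reduced_prefix A R : reduced (A ++ R) -> reduced A.
Proof. by rewrite reduced_cat => /and3P[]. Qed.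

(** [A] is the intact part of the original word and [R] the part already modified. One syllable
    destroys at most one letter of [A], so multiplying a long power by [u] leaves all but
    [tree_len u] of its letters in place. *)
Lemma absorb_syllable A R z x : reduced (A ++ R) -> edge z -> syllable x ->
  exists A' B R' z', [/\ A = A' ++ B, size B <= 1, reduced (A' ++ R'), edge z' &
    wprod B * wprod R * z * x = wprod R' * z'].
Proof.
move=> RA Ez sx; have [sy iy] := syllableMl spl Ez sx.
have E1 := subgrp1 sE; set y := z * x in sy iy.
case/lastP: R RA => [|R l] RA.
  rewrite cats0 in RA; case/lastP: A RA => [|A l] RA.
    exists [::], [::], [:: y], 1; split=> //; first by rewrite /= reduced_cons sy.
    by rewrite /= !mul1g !mulg1.
  have [il|il] := eqVneq (idx l) (idx y); last first.
    exists (rcons A l), [::], [:: y], 1; rewrite cats0; split=> //.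
      by rewrite cats1 reduced_rcons RA sy /=; case: (A) => [|a A'] /=; rewrite ?last_rcons.
    by rewrite /= !mul1g !mulg1.
  have sl : syllable l by move: RA; rewrite reduced_rcons => /and3P[].
  have Ply : P (idx l) (l * y).
    by apply: (subgrpM (sP _)); [|rewrite il]; apply: (syllable_idx spl).
  case: (EM (edge (l * y))) => [Ely|nE].
    exists A, [:: l], [::], (l * y); rewrite cats0 cats1; split=> //.
      by move: RA; rewrite reduced_rcons => /and3P[].
    by rewrite /= !mulg1 mul1g -gmulA.
  have [sly ily] := syllableI spl Ply nE.
  exists A, [:: l], [:: l * y], 1; rewrite !cats1; split=> //.
    exact: reduced_rcons_idx RA.
  by rewrite /= !mulg1 -gmulA.
rewrite -rcons_cat in RA.
have [il|il] := eqVneq (idx l) (idx y); last first.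
  exists A, [::], (rcons (rcons R l) y), 1; rewrite cats0; split=> //.
    rewrite -rcons_cat reduced_rcons -rcons_cat RA sy /=.
    by case: (A ++ R) => [|a A'] /=; rewrite ?last_rcons.
  by rewrite mul1g mulg1 [in RHS]wprod_rcons -gmulA.
have sl : syllable l by move: RA; rewrite reduced_rcons => /and3P[].
have Ply : P (idx l) (l * y).
  by apply: (subgrpM (sP _)); [|rewrite il]; apply: (syllable_idx spl).
case: (EM (edge (l * y))) => [Ely|nE].
  exists A, [::], R, (l * y); rewrite cats0; split=> //.
    by move: RA; rewrite reduced_rcons => /and3P[].
  by rewrite mul1g wprod_rcons -!gmulA.
have [sly ily] := syllableI spl Ply nE.
exists A, [::], (rcons R (l * y)), 1; rewrite cats0; split=> //.
  by rewrite -rcons_cat; apply: reduced_rcons_idx RA.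
by rewrite mul1g mulg1 !wprod_rcons -!gmulA.
Qed.

Lemma absorb_word A R z s : reduced (A ++ R) -> edge z -> all syllable s ->
  exists A' B R' z', [/\ A = A' ++ B, size B <= size s, reduced (A' ++ R'), edge z' &
    wprod B * wprod R * z * wprod s = wprod R' * z'].
Proof.
elim: s A R z => [|x s IH] A R z RA Ez.
  by move=> _; exists A, [::], R, z; rewrite cats0; split=> //=; rewrite mul1g mulg1.
move=> /= /andP[sx ss].
have [A1 [B1 [R1 [z1 [EA szB RA1 Ez1 E1]]]]] := absorb_syllable RA Ez sx.
have [A2 [B2 [R2 [z2 [EA2 szB2 RA2 Ez2 E2]]]]] := IH _ _ _ RA1 Ez1 ss.
exists A2, (B2 ++ B1), R2, z2; split=> //.
- by rewrite EA EA2 catA.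
- by rewrite size_cat; lia.
- by rewrite -E2 wprod_cat -!gmulA; congr (_ * _); rewrite !gmulA E1.
Qed.

Lemma reduced_of g : exists s z, [/\ reduced s, edge z, g = wprod s * z & size s = tree_len g].
Proof.
have [s [Ns <- _]] := glen_normal spl (edge_count P c) g.
case: Ns => [[x Ex ->]|[R _]].
  exists [::], x; rewrite /= mul1g mulg1; split=> //.
  rewrite /tree_len (glen_vertex spl (edge_count P c) (i := i0)); last exact: (edgeP spl).
  by have /asboolP -> := Ex.
exists s, 1; rewrite mulg1 (tree_len_reduced spl R); split=> //; exact: subgrp1 sE.
Qed.

Lemma absorb_right s u : reduced s -> exists A B R z,
  [/\ s = A ++ B, size B <= tree_len u, reduced (A ++ R), edge z &
      wprod B * u = wprod R * z].
Proof.
move=> Rs; have [r [z0 [Rr Ez0 -> <-]]] := reduced_of u.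
have E1 := subgrp1 sE; have Rs' : reduced (s ++ [::]) by rewrite cats0.
have [A [B [R [z [EA szB RA Ez E]]]]] := absorb_word Rs' E1 (reduced_syll Rr).
exists A, B, R, (z * z0); split=> //; first exact: (subgrpM sE).
by move: E; rewrite /= !mulg1 !gmulA => ->.
Qed.

Lemma winvK : involutive (@winv G).
Proof.
move=> s; rewrite /winv map_rev revK -map_comp -[RHS]map_id.
by apply: eq_map => x /=; rewrite invgK.
Qed.

Lemma winv_cat s t' : winv (s ++ t') = winv t' ++ winv s.
Proof. by rewrite /winv map_cat rev_cat. Qed.

Lemma absorb_left s v : reduced s -> exists A B R z,
  [/\ s = B ++ A, size B <= tree_len v, reduced (R ++ A), edge z &
      v * wprod B = z * wprod R].
Proof.
move=> Rs; have [A [B [R [z [EA szB RA Ez E]]]]] := absorb_right v^-1 (reduced_winv spl Rs).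
exists (winv A), (winv B), (winv R), z^-1; split.
- by rewrite -winv_cat -EA winvK.
- by rewrite size_winv; move: szB; rewrite (lenV lT).
- by rewrite -winv_cat; apply: (reduced_winv spl).
- exact: (subgrpV sE).
by rewrite !wprod_winv -ginvM -E ginvM invgK.
Qed.

Lemma spow_shift s (r n : nat) : spow s n.+1 = take r s ++ spow (rot r s) n ++ drop r s.
Proof.
elim: n => [|n IH]; first by rewrite /spow /= cats0 cat_take_drop.
rewrite spowS IH spowS -{1}(cat_take_drop r s) /rot -!catA.
by [].
Qed.

Lemma aligned_spow n s t' x y : size s = size t' -> edge x ->
  aligned x (spow s n) (spow t' n) y ->
  exists X : nat -> G, X 0 = x /\ forall j, j < n -> edge (X j) /\ aligned (X j) s t' (X j.+1).
Proof.
move=> sz; elim: n x => [|n IH] x Ex; first by move=> _; exists (fun=> x).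
rewrite !spowS => /(aligned_cat sz)[z A1 A2].
have [X [X0 HX]] := IH z (aligned_edge Ex A1) A2.
exists (fun j => if j is j'.+1 then X j' else x); split=> // -[|j] lt /=; first by rewrite X0.
exact: HX.
Qed.

(* If [h ^ a u = v h' ^ b] with [a] large, the axes of [h] and of [v h' v^-1]
   share [N] periods; the edge elements [X j] compare the two there. *)
Lemma axes_align s s' (a b N : nat) u v : cyclic s -> cyclic s' -> size s = size s' ->
  wprod s ^+ a * u = v * wprod s' ^+ b ->
  tree_len u + 2 * tree_len v + N + 3 <= a ->
  exists (a0 b0 r : nat) (X : nat -> G),
    [/\ a0 <= 2 * tree_len v + 1, b0 <= tree_len v + 1, r <= size s',
      wprod s ^+ a0 = v * wprod s' ^+ b0 * wprod (take r s') * X 0 &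
      forall j, j < N -> edge (X j) /\ aligned (X j) s (rot r s') (X j.+1)].
Proof.
move=> cs cs' sz E big; have k1 := cyclic_size cs.
have [A [B [R [z [EA szB RA Ez ER]]]]] := absorb_right u (spow_reduced a cs).
have [A' [B' [R' [z' [EA' szB' RA' Ez' ER']]]]] := absorb_left v (spow_reduced b cs').
have {E} E : z'^-1 * wprod (A ++ R) = wprod (R' ++ A') * z^-1.
  apply: (mulgI z'); apply: (mulIg z).
  rewrite mulVKg gmulA mulgVK.
  have -> : wprod (A ++ R) * z = wprod s ^+ a * u.
    by rewrite wprod_cat -gmulA -ER gmulA -wprod_cat -EA wprod_spow.
  by rewrite E wprod_cat gmulA -ER' -gmulA -wprod_cat -EA' wprod_spow.
have Al := alignedP spl RA RA' (subgrpV sE Ez') (subgrpV sE Ez) E.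
have szR' : size R' <= 2 * tree_len v.
  rewrite -(tree_len_reduced spl (reduced_prefix RA')).
  have -> : wprod R' = z'^-1 * v * wprod B' by rewrite -gmulA ER' mulKg.
  have := len3 sT lT (x := z'^-1) (y := v) (t := wprod B') Logic.I Logic.I Logic.I.
  have Rb : reduced B' by apply: reduced_prefix (A' : seq G) _; rewrite -EA'; apply: spow_reduced.
  have -> : tree_len (wprod B') = size B' := tree_len_reduced spl Rb.
  have -> : tree_len z'^-1 = 0.
    have EV := subgrpV sE Ez'.
    rewrite /tree_len (glen_vertex spl (edge_count P c) (edgeP spl i0 EV)).
    by have /asboolP -> := EV.
  by glia.
(* [R'] precedes the intact letters [A'] of the power of [s']. The first [a0] periods of [s] cover
   it together with [q] letters of [A'], so that the comparison starts at the beginning of a period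
   of [s]. *)
pose k := size s; pose a0 := (size R' %/ k).+1; pose q := (k * a0 - size R')%N.
have kq : (k * a0 = size R' + q)%N /\ q <= k.
  rewrite /q /a0; have := divn_eq (size R') k; have := ltn_pmod (size R') (ltnW k1 : 0 < k).
  by move: (size R' %/ k) (size R' %% k) => d m; rewrite mulnS; lia.
have a0le : a0 <= 2 * tree_len v + 1.
  by rewrite /a0 addn1 ltnS; apply: leq_trans (leq_div _ _) szR'.
have szA : (k * (a0 + N + 1)) + size B <= k * a.
  rewrite !mulnDr; case: kq => -> qk; move: szB szR' big k1; rewrite -/k.
  move: (tree_len u) (tree_len v) (size B) (size R') => tu tv nb nr.
  by clear; nia.
have sumA : size A + size B = (k * a)%N by rewrite -size_cat -EA size_spow mulnC.
have sumA' : size A' + size B' = (k * b)%N.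
  by rewrite addnC -size_cat -EA' size_spow mulnC /k sz.
have szAA : size A + size R = size R' + size A'.
  by have := aligned_size Al; rewrite !size_cat.
have {kq} [Ea0 qk] := kq.
have szA2 : (k * a0 + k * (N + 1)) <= size A by move: szA sumA; rewrite !mulnDr; lia.
pose A1' := take q A'; pose A2' := drop q A'.
have szA1' : size A1' = q by rewrite size_take_min; apply/minn_idPl; lia.
have szA2' : size A2' = (size A' - q)%N by rewrite size_drop.
(* This starting point lies [b0] periods and [r] letters into the power of [s'], which is why the
   rotation of [s'] by [r] appears. *)
pose p0 := (size B' + q)%N; pose b0 := (p0 %/ k)%N; pose r := (p0 %% k)%N.
have Ep0 : p0 = (b0 * k + r)%N by rewrite /b0 /r -divn_eq.
have rk : r < k by rewrite /r ltn_mod ltnW.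
have b0N : b0 + N < b.
  have : k * (b0 + N) + k <= k * b.
    rewrite -sumA'; move: Ep0 szA2 Ea0 szAA rk; rewrite /p0 !mulnDr muln1 [(b0 * k)%N]mulnC.
    by clear; lia.
  by rewrite -mulnSr leq_pmul2l ?(ltnW k1).
have EA1 : A = spow s a0 ++ (spow s N ++ drop (k * (a0 + N)) A).
  rewrite catA -spowD -[LHS](cat_take_drop (k * (a0 + N)) A); congr (_ ++ _).
  have aN : a0 + N <= a.
    rewrite -(leq_pmul2l (ltnW k1 : 0 < k)) -sumA mulnDr; move: szA2; rewrite mulnDr; lia.
  have -> : take (k * (a0 + N)) A = take (k * (a0 + N)) (spow s a).
    rewrite EA take_cat; case: ltnP => // le.
    have -> : (k * (a0 + N) = size A)%N by move: szA2; rewrite mulnDr in le *; rewrite mulnDr; lia.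
    by rewrite subnn take0 cats0 take_size.
  by rewrite -{1}(subnKC aN) spowD take_size_cat // size_spow mulnC.
have EB1 : B' ++ A1' = spow s' b0 ++ take r s'.
  have := EA'; rewrite -(cat_take_drop q A') catA -/A1' -/A2' => {}EA'.
  have {EA'} : take p0 (spow s' b) = B' ++ A1'.
    by rewrite EA' take_size_cat // size_cat szA1'.
  move=> <-; have -> : b = (b0 + (b - b0.+1).+1)%N by move: b0N; move: (b0); clear; lia.
  rewrite spowD take_cat size_spow -sz -/k Ep0 ltnNge leq_addr /= addKn.
  by rewrite spowS takel_cat // -sz ltnW.
have [W EA2] : exists W, A2' = spow (rot r s') N ++ W.
  have [M Eb] : exists M, b = (b0 + (N + M).+1)%N by exists (b - b0 - N.+1)%N; move: b0N; move: (b0); clear; lia.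
  exists (spow (rot r s') M ++ drop r s').
  have : (B' ++ A1') ++ A2' = spow s' b by rewrite -catA cat_take_drop -EA'.
  rewrite {}Eb spowD (spow_shift s' r) spowD EB1 -!catA => /eqP.
  by rewrite !eqseq_cat // => /andP[_ /andP[_ /eqP]].
move: Al; rewrite EA1 -(cat_take_drop q A') -/A1' -/A2' EA2.
rewrite -[(_ ++ _) ++ R]catA [R' ++ _]catA => /aligned_cat.
case=> [|x Al0]; first by rewrite size_cat szA1' size_spow mulnC.
rewrite -catA => /aligned_cat; case=> [|y Al1 _]; first by rewrite !size_spow size_rot sz.
have Ex := aligned_edge (subgrpV sE Ez') Al0.
have szr : size s = size (rot r s') by rewrite size_rot.
have [X [X0 HX]] := aligned_spow szr Ex Al1.
exists a0, b0, r, X; split=> //.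
- have : b0 * k <= tree_len v + k by move: Ep0 szB' qk; rewrite /p0; lia.
  by move: (tree_len v) k1; rewrite -/k; clear; nia.
- by rewrite -sz ltnW.
have := aligned_prod Al0; rewrite wprod_spow -X0 => Eh.
have {1}-> : wprod s ^+ a0 = z' * (wprod (R' ++ A1') * X 0) by rewrite -Eh mulVKg.
rewrite -(wprod_spow s') -(gmulA v) -wprod_cat -EB1 wprod_cat.
by rewrite (wprod_cat B') !gmulA ER'.
Qed.

End Alignment.

(** The arithmetic of the drifting case of [hyp_hyp_nat]: [dd], [H], [H'], [gu], [gv] are the values
    of [gl] at [d], [h], [h'], [u], [v], and [tu], [tv] are syllable lengths. *)
Lemma drift_arith dd H H' gu gv tu tv b0 a0 n p Q :
  dd <= Q -> H <= Q -> H' <= Q -> 0 < Q ->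
  a0 <= 2 * tv + 1 -> b0 <= tv + 1 -> n <= 2 * p ->
  dd + b0 * H' + gv + a0 * H + (dd + (tu + tv + n + b0) * H' + gu + (a0 + n) * H)
    <= Q * (7 * (gu + tu + (gv + tv)) + (4 * p + 6)).
Proof.
move=> hd hH hH' Q0 ha hb hn.
have h1 : b0 * H' <= (tv + 1) * Q by apply: leq_mul.
have h2 : a0 * H <= (2 * tv + 1) * Q by apply: leq_mul.
have h3 : (tu + tv + n + b0) * H' <= (tu + tv + 2 * p + (tv + 1)) * Q.
  by apply: leq_mul => //; lia.
have h4 : (a0 + n) * H <= (2 * tv + 1 + 2 * p) * Q by apply: leq_mul => //; lia.
have h5 : gu <= gu * Q by rewrite leq_pmulr.
have h6 : gv <= gv * Q by rewrite leq_pmulr.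
apply: leq_trans (_ : Q + (tv + 1) * Q + gv * Q + (2 * tv + 1) * Q +
  (Q + (tu + tv + 2 * p + (tv + 1)) * Q + gu * Q + (2 * tv + 1 + 2 * p) * Q) <= _).
  by do ?apply: leq_add.
by clear; lia.
Qed.

(** * Commensuration of two hyperbolic elements *)

Section Hyperbolic.
Variables (G : groupType) (I : finType) (i0 : I) (P : I -> G -> Prop) (c : G).
Hypothesis spl : splitting i0 P c.
Hypothesis gP : forall i, good (P i).
Let sP i := spl_sub spl i.
Let Pc i := spl_edge spl i.
Local Notation cyclic := (cyclic i0 P c).
Local Notation tree_len := (tree_len P c).
Local Notation full := (fun _ : G => True).
Implicit Types (x y g h u v : G) (s : seq G) (z : int).
Let sT : subgrp full. Proof. by []. Qed.
Let lT := tree_lenfun spl.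
Let uP i : undistorted (P i). Proof. by case: (gP i). Qed.

Lemma wprod_rot (r : nat) s : wprod (take r s) * wprod (rot r s) = wprod s * wprod (take r s).
Proof.
have -> : wprod s = wprod (take r s) * wprod (drop r s).
  by rewrite -wprod_cat cat_take_drop.
by rewrite /rot wprod_cat !gmulA.
Qed.

Lemma cost_rot w (r : nat) s : cost w (rot r s) = cost w s.
Proof. by rewrite /rot cost_cat addnC -cost_cat cat_take_drop. Qed.

Lemma drift_bound (w : G -> nat) (k : nat) (f m : int) (l : nat) x g :
  lenfun full w -> 0 < k -> (forall z, w (zpow c z) = (k * absz z)%N) -> m <> 0 ->
  zpow c f = x -> zpow c (f + m * l%:Z)%R = g -> l <= w x + w g.
Proof.
move=> lw k0 wE m0 <- <-; rewrite !wE.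
have : l <= absz f + absz (f + m * l%:Z)%R.
  have : absz (m * l%:Z)%R <= absz f + absz (f + m * l%:Z)%R.
    by move: (m * l%:Z)%R => q; lia.
  by apply: leq_trans; rewrite abszM absz_nat leq_pmull //; lia.
by rewrite -mulnDr => le; apply: leq_trans le _; rewrite leq_pmull.
Qed.

(** With equal numbers of syllables the two translations keep step: periods correspond one to one,
    and [b] differs from [a] by at most the syllable lengths of [u] and [v]. *)
Lemma hyp_hyp_nat s s' : cyclic s -> cyclic s' -> size s = size s' ->
  exists2 l, lenfun full l & exists B, forall (a b : nat) u v,
    wprod s ^+ a * u = v * wprod s' ^+ b ->
    a <= l u + l v + B \/ bcomm B (wprod s) (wprod s') u.
Proof.
move=> cs cs' sz; set h := wprod s; set h' := wprod s'.
have [w [k [p [[lw k0 p0 wE wC] _]]]] :=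
  edge_norm_exists spl gP (fun i => lenfun0 (P i)).
pose gl := glen P w; have lg : lenfun full gl := glen_lenfun spl lw.
have glE z : gl (zpow c z) = (k * absz z)%N.
  by rewrite /gl (glen_vertex spl lw (edgeP spl i0 (edgeZ c z))) wE.
(* Beyond [La] an edge exponent triggers [chain] over one period. [N] exceeds every index used in
   the two pigeonhole arguments below. *)
pose La := (2 * (cost w s + cost w s'))%N.
pose N := (2 * La + 2 + 2 * p + 2)%N.
have [Q [HQ1 HQ2 HQ3 Q0]] : exists Q, [/\ gl h <= Q, gl h' <= Q, cost w s' <= Q & 0 < Q].
  by exists (gl h + gl h' + cost w s' + 1)%N; split; lia.
pose D := (2 * p * Q * 7)%N.
exists (fun x => (D + 2) * (gl x + tree_len x))%N.
  by apply: lenfun_scale; apply: lenfunD lg lT.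
exists (N + 3 + 2 * p * (Q * (4 * p + 6) + 1))%N => a b u v E.
set lhs := (_ <= _).
have [lt|le] := ltnP a (tree_len u + 2 * tree_len v + N + 3).
  by left; rewrite /lhs; move: (2 * p * _)%N => q; nia.
have [a0 [b0 [r [X [a0le b0le rle E0 HX]]]]] := axes_align spl cs cs' sz E le.
set d := wprod (take r s') in E0; set h2 := wprod (rot r s').
have dh : d * h2 = h' * d := wprod_rot r s'.
have step j : j < N -> X j * h = h2 * X j.+1.
  by move=> /HX[_ A]; apply: aligned_prod A.
have steps i n : i + n <= N -> X i * h ^+ n = h2 ^+ n * X (i + n).
  elim: n => [|n IH] lei; first by rewrite mulg1 mul1g addn0.
  rewrite expgSr gmulA IH; last lia.
  by rewrite -gmulA (step (i + n)) ?addnS ?gmulA -?expgSr //; lia.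
have Ev : v = h ^+ a0 * (X 0)^-1 * d^-1 * (h' ^+ b0)^-1.
  by rewrite E0 !mulgK.
have Eu : u = (h ^+ a)^-1 * h ^+ a0 * (X 0)^-1 * d^-1 * (h' ^+ b0)^-1 * h' ^+ b.
  by rewrite -(mulKg (h ^+ a) u) E Ev !gmulA.
(* In [Eu] every factor of [u] is a power of [h] or [h'], except that the inverse of [d] leads from
   [h' ^+ n] to [h2 ^+ n] and the inverse of [X 0] from there to [h ^+ n]. *)
have finish n : 0 < n <= 2 * p + 2 * La + 2 -> X 0 * h ^+ n = h2 ^+ n * X 0 ->
    a <= (D + 2) * (gl u + tree_len u) + (D + 2) * (gl v + tree_len v) +
      (N + 3 + 2 * p * (Q * (4 * p + 6) + 1)) \/
    bcomm (N + 3 + 2 * p * (Q * (4 * p + 6) + 1)) h h' u.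
  move=> n0 En; right; exists n, n; rewrite absz_nat.
  have nB : 0 < n <= N + 3 + 2 * p * (Q * (4 * p + 6) + 1) by rewrite /N; lia.
  split=> //; rewrite zpow_nat Eu.
  have dn : d * h2 ^+ n = h' ^+ n * d := expg_intertwine n dh.
  do 5?apply: intertwineM; try exact: expgC; try (apply: intertwineV; exact: expgC).
    by apply: intertwineV En.
  by apply: intertwineV dn.
case: (EM (c = 1)) => [c1|nc1].
  have X1 j : j < N -> X j = 1.
    by move=> /HX[[z ->] _]; rewrite c1 zpow1g.
  apply: (finish 1%N); first by lia.
  by rewrite !expg1 step ?X1 ?mulg1 ?mul1g //; rewrite /N; lia.
have {}k0 := k0 nc1.
have zinj := undistorted_zpow_inj (sP i0) (@uP i0) (Pc i0) nc1.
have /choice[f Hf] : forall j, exists z : int, j < N -> X j = zpow c z.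
  move=> j; case: (ltnP j N) => [/HX[[z Ez] _]|]; first by exists z.
  by exists 0%R.
have X0h i : i < N -> X 0 = h2 ^+ i * X i * (h ^+ i)^-1.
  by move=> iN; have := steps 0 i; rewrite add0n => <-; [rewrite mulgK|lia].
have [small|] := EM (forall j, j <= 2 * La + 1 -> absz (f j) <= La).
  (* There are [2 * La + 2] indices but only [2 * La + 1] integers of absolute value at most [La];
     adding [La] makes them natural numbers. *)
  have [i [j [ijB Eg]]] : exists i j, i < j <= 2 * La + 1 /\
      absz (f i + La%:Z)%R = absz (f j + La%:Z)%R.
    by apply: (pigeonhole (f := fun j => absz (f j + La%:Z)%R)) => j /small; lia.
  have Ef : f i = f j.
    by have := small i ltac:(lia); have := small j ltac:(lia); lia.
  have iN : i < N by rewrite /N; lia.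
  have jN : j < N by rewrite /N; lia.
  apply: (finish (j - i)%N); first lia.
  have := steps i (j - i)%N; rewrite subnKC; last lia.
  rewrite (Hf j) // -Ef -Hf // => /(_ (ltnW jN)) Eij.
  rewrite (X0h i) //; apply: intertwineM; last by apply: intertwineV; apply: expgC.
  by apply: intertwineM; [apply: expgC|].
move/existsNP => [j1 /not_implyP[j1le /negP]]; rewrite -ltnNge => big.
have j1N : j1 < N by rewrite /N; lia.
have [Ej1 Al] := HX j1 j1N; rewrite (Hf _ j1N) in Al.
have Rr := cyclic_reduced (cyclic_rot r cs').
have lt : 2 * (cost w s + cost w (rot r s')) < absz (f j1) by rewrite cost_rot.
have [Hs _] := chain spl lw k0 wE wC (cyclic_reduced cs) Rr Al lt.
have [e e1 Eh] := commens_wprod Hs; rewrite -/h in Eh.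
have ee : (e * e = 1)%R by lia.
(* [h] may invert [zpow c p], but its square commutes with it. Therefore only even positions are
   compared from here on. *)
have hh z : h ^+ 2 * zpow c (p%:Z * z)%R = zpow c (p%:Z * z)%R * h ^+ 2.
  rewrite expg2; apply: (@intertwineM _ _ _ _ (zpow c (e * (p%:Z * z))%R)).
    rewrite -{2}[(p%:Z * z)%R]GRing.mul1r -ee -GRing.mulrA.
    have -> : (e * (p%:Z * z) = p%:Z * (e * z))%R by lia.
    by rewrite (commensZ _ Eh).
  by rewrite (commensZ _ Eh).
have hz n z : h ^+ (n * 2) * zpow c (p%:Z * z)%R = zpow c (p%:Z * z)%R * h ^+ (n * 2).
  by rewrite mulnC expgnA; apply/esym/(@zpow_intertwine _ _ _ _ n)/esym/hh.
have [i [j [ijB Em]]] : exists i j, i < j <= p /\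
   absz (modz (f (i * 2)%N) p) = absz (modz (f (j * 2)%N) p).
  apply: (pigeonhole (f := fun j => absz (modz (f (j * 2)%N) p))) => j _.
  have := modz_ge0 (f (j * 2)%N) (d := p); have := ltz_pmod (f (j * 2)%N) (d := p); lia.
have [m Efm] : exists m : int, f (j * 2)%N = (f (i * 2)%N + p%:Z * m)%R.
  exists (divz (f (j * 2)%N) p - divz (f (i * 2)%N) p)%R.
  have := divz_eq (f (i * 2)%N) p; have := divz_eq (f (j * 2)%N) p.
  have := modz_ge0 (f (j * 2)%N) (d := p); have := modz_ge0 (f (i * 2)%N) (d := p).
  move: Em; move: (modz _ _) (modz _ _) (divz _ _) (divz _ _) => m1 m2 q1 q2.
  move=> Em g1 g2 E1 E2; have {Em} Em : m1 = m2 by lia.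
  by rewrite E1 E2 Em; lia.
pose n := ((j - i) * 2)%N.
have iN : (i * 2 < N)%N by rewrite /N; lia.
have jN : (j * 2 < N)%N by rewrite /N; lia.
have En : X 0 * h ^+ n = h2 ^+ n * X 0 * zpow c (p%:Z * m)%R.
  have := steps (i * 2)%N n; have -> : (i * 2 + n = j * 2)%N by rewrite /n; lia.
  move=> /(_ (ltnW jN)); rewrite (Hf _ jN) Efm zpowD -(Hf _ iN) => Ei.
  rewrite (X0h _ iN) -[LHS]gmulA.
  have -> : (h ^+ (i * 2))^-1 * h ^+ n = h ^+ n * (h ^+ (i * 2))^-1.
    by apply: intertwineV; apply: expgC.
  have -> : h2 ^+ n * (h2 ^+ (i * 2) * X (i * 2)%N / h ^+ (i * 2)) * zpow c (p%:Z * m)%R =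
     h2 ^+ (i * 2) * (h2 ^+ n * (X (i * 2)%N * zpow c (p%:Z * m)%R)) / h ^+ (i * 2).
    have -> : h2 ^+ (i * 2) * (h2 ^+ n * (X (i * 2)%N * zpow c (p%:Z * m)%R)) =
       h2 ^+ n * h2 ^+ (i * 2) * X (i * 2)%N * zpow c (p%:Z * m)%R.
      by rewrite !gmulA (expgC h2 n).
    rewrite !gmulA -!gmulA; do 3 congr (_ * _).
    by apply: intertwineV; apply: hz.
  by rewrite -Ei !gmulA.
have [m0|m0] := eqVneq m 0%R.
  apply: (finish n); first by rewrite /n; lia.
  by rewrite En m0 GRing.mulr0 zpow0 mulg1.
left; rewrite /lhs {lhs finish}.
have n0 : 0 < n by rewrite /n; lia.
have np : n <= 2 * p by rewrite /n; lia.
have hn q : h ^+ n * zpow c (p%:Z * q)%R = zpow c (p%:Z * q)%R * h ^+ n.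
  by rewrite /n hz.
(* [h ^+ n] commutes with the discrepancy, which therefore accumulates by the same amount in every
   round of [n] periods. *)
have Enl l : X 0 * h ^+ (n * l) = h2 ^+ (n * l) * X 0 * zpow c (p%:Z * m * l%:Z)%R.
  elim: l => [|l IH]; first by rewrite muln0 GRing.mulr0 zpow0 !mulg1 mul1g.
  have -> : (n * l.+1 = n * l + n)%N by rewrite mulnS addnC.
  have -> : (p%:Z * m * l.+1%:Z = p%:Z * m + p%:Z * (m * l%:Z))%R by lia.
  rewrite expgnDr gmulA IH -[LHS]gmulA -GRing.mulrA -hn !gmulA.
  by rewrite -(gmulA (h2 ^+ (n * l))) En expgnDr zpowD !gmulA.
pose l := (a %/ n)%N; have la : n * l <= a by rewrite mulnC leq_divM.
have la' : a < n * l + n by rewrite addnC -mulnS mulnC ltn_ceil.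
have N0 : 0 < N by rewrite /N; clear; lia.
set e1' := zpow h' (b%:Z - (n * l)%:Z - b0%:Z)%R.
set e2' := zpow h (a0%:Z + (n * l)%:Z - a%:Z)%R.
have EX : X 0 = d^-1 * zpow h' (b%:Z - b0%:Z)%R * u^-1 * zpow h (a0%:Z - a%:Z)%R.
  have {1}-> : X 0 = d^-1 * (h' ^+ b0)^-1 * v^-1 * h ^+ a0.
    by rewrite Ev !ginvM !invgK !gmulA !mulgVK mulVg mul1g.
  have -> : v^-1 = h' ^+ b * u^-1 * (h ^+ a)^-1.
    have -> : v = h ^+ a * u * (h' ^+ b)^-1 by rewrite E mulgK.
    by rewrite !ginvM invgK !gmulA.
  have -> : (b%:Z - b0%:Z = - b0%:Z + b%:Z)%R by lia.
  have -> : (a0%:Z - a%:Z = - a%:Z + a0%:Z)%R by lia.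
  by rewrite !zpowD !zpowN !zpow_nat !gmulA.
(* After [l = a %/ n] rounds the exponents left in [e1'] and [e2'] are linear in the syllable
   lengths of [u] and [v]. The drift is thus short, which bounds [l] and hence [a]. *)
have Eg : zpow c (f 0 + p%:Z * m * l%:Z)%R = d^-1 * e1' * u^-1 * e2'.
  have dn : d * h2 ^+ (n * l) = h' ^+ (n * l) * d := expg_intertwine _ dh.
  rewrite zpowD -(Hf 0 N0); apply: (mulgI (h2 ^+ (n * l))); rewrite gmulA -Enl.
  rewrite EX !gmulA -(intertwineV dn) -!gmulA; congr (_ * _); rewrite !gmulA.
  have -> : h' ^+ (n * l) * e1' = zpow h' (b%:Z - b0%:Z)%R.
    by rewrite -(zpow_nat h') -zpowD; congr zpow; lia.
  by rewrite -!gmulA -(zpow_nat h) -zpowD; do 2 congr (_ * _); congr zpow; lia.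
have pm0 : (p%:Z * m)%R <> 0%R by apply/eqP; rewrite GRing.mulf_neq0 // eqz_nat -lt0n.
have lle := drift_bound lg k0 glE pm0 (esym (Hf 0 N0)) Eg.
have dle : gl d <= cost w s'.
  have Rs' := cyclic_reduced cs'; rewrite -(cat_take_drop r s') in Rs'.
  apply: leq_trans (glen_le w (reduced_vertex spl (reduced_prefix Rs'))) _.
  by rewrite -{2}(cat_take_drop r s') cost_cat leq_addr.
have ab : absz (b%:Z - a%:Z)%R <= tree_len u + tree_len v.
  have Ea : h ^+ a = v * h' ^+ b * u^-1 by rewrite -E mulgK.
  have Eb : h' ^+ b = v^-1 * h ^+ a * u by rewrite -gmulA E mulKg.
  have := len3 sT lT (x := v) (y := h' ^+ b) (t := u^-1) Logic.I Logic.I Logic.I.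
  have := len3 sT lT (x := v^-1) (y := h ^+ a) (t := u) Logic.I Logic.I Logic.I.
  rewrite -Ea -Eb !(tree_len_cyclic spl) // !(lenV lT) // -sz.
  have := cyclic_size cs; move: (tree_len u) (tree_len v) => tu tv; clear; nia.
have gX : gl (X 0) <= gl d + b0 * gl h' + gl v + a0 * gl h.
  have {1}-> : X 0 = (d^-1 * (h' ^+ b0)^-1) * v^-1 * h ^+ a0.
    by rewrite Ev !ginvM !invgK !gmulA !mulgVK mulVg mul1g.
  have := len3 sT lg (x := d^-1 * (h' ^+ b0)^-1) (y := v^-1) (t := h ^+ a0)
    Logic.I Logic.I Logic.I.
  have := lenM lg (x := d^-1) (y := (h' ^+ b0)^-1) Logic.I Logic.I.
  have := lenX sT lg (x := h) a0 Logic.I; have := lenX sT lg (x := h') b0 Logic.I.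
  by rewrite !(lenV lg) //; clear; glia.
have gG : gl (d^-1 * e1' * u^-1 * e2') <= gl d + (tree_len u + tree_len v + n + b0) * gl h' +
    gl u + (a0 + n) * gl h.
  have := len3 sT lg (x := d^-1 * e1') (y := u^-1) (t := e2') Logic.I Logic.I Logic.I.
  have := lenM lg (x := d^-1) (y := e1') Logic.I Logic.I.
  have := lenZ sT lg (x := h') (b%:Z - (n * l)%:Z - b0%:Z)%R Logic.I.
  have := lenZ sT lg (x := h) (a0%:Z + (n * l)%:Z - a%:Z)%R Logic.I.
  rewrite -/e1' -/e2' !(lenV lg) //.
  have bB : absz (b%:Z - (n * l)%:Z - b0%:Z)%R <= tree_len u + tree_len v + n + b0.
    by move: ab la la'; move: (n * l)%N; clear; lia.
  have aB : absz (a0%:Z + (n * l)%:Z - a%:Z)%R <= a0 + n.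
    by move: la la'; move: (n * l)%N; clear; lia.
  move: (leq_mul bB (leqnn (gl h'))) (leq_mul aB (leqnn (gl h))).
  by clear; glia.
have {}lle : l <= Q * (7 * (gl u + tree_len u + (gl v + tree_len v)) + (4 * p + 6)).
  apply: leq_trans lle (leq_trans (leq_add gX gG) _).
  apply: drift_arith => //; exact: leq_trans dle HQ3.
have : a <= 2 * p * (l + 1).
  apply: leq_trans (ltnW la') _; rewrite mulnDr muln1; apply: leq_add => //.
  by rewrite leq_mul2r np orbT.
have : 2 * p * (l + 1) <= 2 * p * (Q * (7 * (gl u + tree_len u + (gl v + tree_len v)) + (4 * p + 6)) + 1).
  by rewrite leq_mul2l leq_add2r lle orbT.
rewrite /D; move: (gl u + tree_len u) (gl v + tree_len v) => U V.
clear; move: (4 * p + 6) => q; nia.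
Qed.
End Hyperbolic.

Section LinearCommens.
Variables (G : groupType) (I : finType) (i0 : I) (P : I -> G -> Prop) (c : G).
Hypothesis spl : splitting i0 P c.
Hypothesis gP : forall i, good (P i).
Local Notation cyclic := (cyclic i0 P c).
Local Notation full := (fun _ : G => True).
Let sT : subgrp full. Proof. by []. Qed.

Lemma bcommVl B (h h' u : G) : bcomm B h^-1 h' u -> bcomm B h h' u.
Proof.
move=> [p [q [H1 H2 E]]]; exists p, (- q)%R; rewrite abszN; split=> //.
by rewrite E zpowV.
Qed.

Lemma bcommVr B (h h' u : G) : bcomm B h h'^-1 u -> bcomm B h h' u.
Proof.
move=> [p [q [H1 H2 E]]]; exists p, (- q)%R; rewrite abszN; split=> //.
have E' : u * zpow h'^-1 p = zpow h q * u by [].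
have := zpow_intertwine (-1)%R E'; rewrite -!zpowM zpowV => E2.
have -> : (- q = q * -1)%R by lia.
by rewrite -E2 -zpow_nat; congr (_ * zpow _ _); lia.
Qed.

(** Inverting the words reduces the four combinations of signs to natural exponents. *)
Lemma hyp_hyp_commens (s s' : seq G) : cyclic s -> cyclic s' -> size s = size s' ->
  commens_bound full (wprod s) (wprod s').
Proof.
move=> cs cs' sz.
have ci := cyclic_winv spl cs; have ci' := cyclic_winv spl cs'.
have [l1 ll1 [B1 H1]] := hyp_hyp_nat spl gP cs cs' sz.
have [l2 ll2 [B2 H2]] := hyp_hyp_nat spl gP cs ci' (etrans sz (esym (size_winv _))).
have [l3 ll3 [B3 H3]] := hyp_hyp_nat spl gP ci cs' (etrans (size_winv _) sz).
have [l4 ll4 [B4 H4]] := hyp_hyp_nat spl gP ci ci'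
  (etrans (size_winv _) (etrans sz (esym (size_winv _)))).
exists (fun x => l1 x + l2 x + (l3 x + l4 x)).
  by do 2?apply: lenfunD.
exists (B1 + B2 + (B3 + B4))%N => a b u _; set v := _ * u * _.
have E : zpow (wprod s) a * u = v * zpow (wprod s') (- b)%R.
  by rewrite /v zpowN mulgK.
have sgn (x : G) (z : int) : zpow x z = x ^+ absz z \/ zpow x z = x^-1 ^+ absz z.
  case: z => n; first by left.
  by right; rewrite NegzE abszN -zpow_nat zpowV.
have mono B : B <= B1 + B2 + (B3 + B4) -> forall h h', bcomm B h h' u ->
   bcomm (B1 + B2 + (B3 + B4)) h h' u by move=> le h h'; apply: bcomm_mono.
case: (sgn (wprod s) a) => Ea; case: (sgn (wprod s') (- b)%R) => Eb; rewrite Ea Eb in E.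
- case: (H1 _ _ _ _ E) => [le|bc]; [left; lia | right].
  by apply: mono bc; lia.
- rewrite -wprod_winv in E; case: (H2 _ _ _ _ E) => [le|bc]; [left; lia | right].
  by rewrite wprod_winv in bc; apply: mono (bcommVr bc); lia.
- rewrite -wprod_winv in E; case: (H3 _ _ _ _ E) => [le|bc]; [left; lia | right].
  by rewrite wprod_winv in bc; apply: mono (bcommVl bc); lia.
rewrite -!wprod_winv in E; case: (H4 _ _ _ _ E) => [le|bc]; [left; lia | right].
by rewrite !wprod_winv in bc; apply: mono (bcommVl (bcommVr bc)); lia.
Qed.

Lemma cyclic_spow (s : seq G) n : 0 < n -> cyclic s -> cyclic (spow s n).
Proof.
case: n => // n _ cs; have R := spow_reduced (n.+1 + n.+1) cs.
move: R; rewrite spowD reduced_cat => /and3P[R _ J]; rewrite /cyclic R J !andbT.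
by rewrite -size_eq0 size_spow; have := cyclic_size cs; case: (size s).
Qed.

Lemma splitting_linear_commens : linear_commens full.
Proof.
move=> h h' _ _.
have [r [u [_ -> _ Hu]]] := cyclic_reduction spl (fun i => lenfun0 (P i)) h.
have [r' [u' [_ -> _ Hu']]] := cyclic_reduction spl (fun i => lenfun0 (P i)) h'.
move=> h1 h1'; apply: commens_bound_conj => //.
have {h1} u1 : u <> 1 by move=> u1; apply: h1; rewrite u1 mulg1 mulgV.
have {h1'} u1' : u' <> 1 by move=> u1'; apply: h1'; rewrite u1' mulg1 mulgV.
case: Hu => [[[i Pi] _]|[s [cs Ws _]]]; case: Hu' => [[[j Pj] _]|[s' [cs' Ws' _]]].
- exact: (elliptic_commens spl gP Pi Pj).
- by rewrite -Ws'; apply: (ell_hyp_commens spl gP cs' Pi).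
- by rewrite -Ws; apply: (hyp_ell_commens spl cs Pj).
have k0 := ltnW (cyclic_size cs); have k0' := ltnW (cyclic_size cs').
(* These exponents equalize the numbers of syllables. *)
rewrite -Ws -Ws'; apply: (@commens_bound_pow _ _ sT _ _ (size s') (size s)) => //.
rewrite -!wprod_spow; apply: hyp_hyp_commens; try exact: cyclic_spow.
by rewrite !size_spow mulnC.
Qed.

End LinearCommens.

(** * Conjugacy in an amalgam *)

Section LinearConj.
Variables (G : groupType) (I : finType) (i0 : I) (P : I -> G -> Prop) (c : G).
Hypothesis spl : splitting i0 P c.
Hypothesis gP : forall i, good (P i).
Let sP i := spl_sub spl i.
Let Pc i := spl_edge spl i.
Local Notation reduced := (reduced i0 P c).
Local Notation aligned := (aligned i0 P c).
Local Notation cyclic := (cyclic i0 P c).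
Local Notation tree_len := (tree_len P c).
Local Notation full := (fun _ : G => True).
Implicit Types (x y g h u v t : G) (s : seq G) (i j : I) (z : int).
Let sT : subgrp full. Proof. by []. Qed.
Let lT := tree_lenfun spl.
Let uP i : undistorted (P i). Proof. by case: (gP i). Qed.

Lemma tree_len_conj_pow t u v n : t * u * t^-1 = v ->
  tree_len (v ^+ n) <= tree_len (u ^+ n) + 2 * tree_len t.
Proof.
move=> <-; rewrite expg_conj.
have := len3 sT lT (x := t) (y := u ^+ n) (t := t^-1) Logic.I Logic.I Logic.I.
by rewrite (lenV lT (x := t)) //; glia.
Qed.

(** The conjugator contributes at most [2 * tree_len t] to the syllable length of any power, which
    is less than the exponent chosen here. *)
Lemma conj_size_le t s s' : cyclic s -> cyclic s' ->
  t * wprod s * t^-1 = wprod s' -> size s' <= size s.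
Proof.
move=> cs cs' /(tree_len_conj_pow (2 * tree_len t).+1).
rewrite !(tree_len_cyclic spl) //; move: (tree_len t) => T; nia.
Qed.

Lemma conjV t u v : t * u * t^-1 = v -> t^-1 * v * t^-1^-1 = u.
Proof. by move=> <-; rewrite invgK !gmulA mulVg mul1g mulgVK. Qed.

Lemma cyclic_not_elliptic t s i v : cyclic s -> P i v -> t * wprod s * t^-1 <> v.
Proof.
move=> cs Pv /conjV /(tree_len_conj_pow (2 * tree_len t^-1).+2).
rewrite (tree_len_cyclic spl) //.
have := tree_len_vertex spl (subgrpX (sP i) (2 * tree_len t^-1).+2 Pv).
have := cyclic_size cs; move: (tree_len t^-1) => T; nia.
Qed.

Section Norm.
Variables (w : G -> nat) (k p : nat).
Hypothesis wnorm : edge_norm P c w k p.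
Let lw : forall i, lenfun (P i) w. Proof. by case: wnorm. Qed.
Let wE z : w (zpow c z) = (k * absz z)%N. Proof. by case: wnorm. Qed.
Local Notation gl := (glen P w).
Let lg : lenfun full gl := glen_lenfun spl lw.
Let glE z : gl (zpow c z) = (k * absz z)%N.
Proof. by rewrite (glen_vertex spl lw (edgeP spl i0 (edgeZ c z))) wE. Qed.

(** [k * absz z] is the translation length of [zpow c z], hence that of its conjugate [g], and
    translation lengths are at most lengths. The proof compares sufficiently high powers. *)
Lemma edge_conj_bound i y g z : P i y -> P i g -> y * g * y^-1 = zpow c z ->
  k * absz z <= w g.
Proof.
move=> Py Pg E; rewrite leqNgt; apply/negP => lt.
pose n := (2 * w y).+1.
have En : zpow c (z * n%:Z)%R = y * g ^+ n * y^-1 by rewrite zpowM -E zpow_conj.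
have := len3 (sP i) (lw i) Py (subgrpX (sP i) n Pg) (subgrpV (sP i) Py).
have := lenX (sP i) (lw i) n Pg.
have : w (y * g ^+ n * y^-1) = (k * (absz z * n))%N by rewrite -En wE abszM absz_nat.
rewrite (lenV (lw i) Py); move: lt; rewrite /n.
move: (w (_ * _ * _)) (w (_ ^+ _)) => A B; move: (w y) (w g) (absz z) => yy gg zz.
clear; nia.
Qed.

(** [edge_conj_bound] in both directions shows that each letter keeps or inverts the power of [c].
    If the whole word inverts it, some letter or its inverse already does, so one vertex element can
    replace [s] in a conjugator. *)
Lemma aligned_flip (f f' : int) s : c <> 1 -> reduced s ->
  aligned (zpow c f) s s (zpow c f') -> f' = f \/ f' = (- f)%R /\
   exists i a, P i a /\ a * zpow c f * a^-1 = zpow c (- f)%R.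
Proof.
move=> nc1; have k0 : 0 < k by case: wnorm => _ /(_ nc1).
have zinj := undistorted_zpow_inj (sP i0) (@uP i0) (Pc i0) nc1.
elim: s f => [|a s IH] f /=; first by move=> _ /zinj ->; left.
rewrite reduced_cons => /and3P[sa rs _] [_ [[g ->] _ E A]].
have Pa := syllable_idx spl sa; set i := idx i0 P a in Pa.
have E1 : a * zpow c g * a^-1 = zpow c f by rewrite -E mulgK.
have le1 := edge_conj_bound Pa (subgrpZ (sP i) g (Pc i)) E1.
have le2 := edge_conj_bound (subgrpV (sP i) Pa) (subgrpZ (sP i) f (Pc i)) (conjV E1).
rewrite !wE !leq_pmul2l // in le1 le2.
case: (IH g rs A) => [fg|[fg [j [b [Pb Eb]]]]]; have [gf|gf] : g = f \/ g = (- f)%R by lia.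
- by left; rewrite fg gf.
- right; rewrite fg; split=> //; exists i, a^-1; split; first exact: (subgrpV (sP i)).
  by rewrite (conjV E1) gf.
- by right; rewrite fg gf; split=> //; exists j, b; rewrite -gf.
by left; rewrite fg gf; lia.
Qed.

(** Let [f = r + p * m]. If [h] commutes with the power [p * m] of [c], this power cancels and [r]
    can replace [f]. If [h] inverts it, the two occurrences add up to a power equal to a product of
    [h], [h2] and short elements, so [f] itself was linear. *)
Lemma edge_residue (f : int) h h2 : c <> 1 ->
  commens c p h -> zpow c f * h = h2 * zpow c f ->
  exists2 f' : int, k * absz f' <= gl h + gl h2 + 3 * k * p &
    zpow c f' * h = h2 * zpow c f'.
Proof.
move=> nc1 [e e1 Eh] E; have k0 : 0 < k by case: wnorm => _ /(_ nc1).
have p0 : 0 < p by case: wnorm.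
pose m := (f %/ p)%Z; pose r := (f %% p)%Z.
have Ef : f = (r + p%:Z * m)%R by rewrite {1}(divz_eq f p) GRing.addrC GRing.mulrC.
have rp : absz r <= p.
  by rewrite /r; have := modz_ge0 f (d := p); have := ltz_pmod f (d := p); lia.
have Em : h * zpow c (p%:Z * (e * m))%R = zpow c (p%:Z * m)%R * h.
  rewrite (commensZ _ Eh); congr (zpow c _ * _).
  have : (e * e = 1)%R by lia.
  by move=> ee; rewrite GRing.mulrCA [(e * (e * m))%R]GRing.mulrA ee GRing.mul1r.
clearbody m r; have {Ef} Ef : zpow c f = zpow c r * zpow c (p%:Z * m)%R by rewrite Ef zpowD.
have E' : zpow c r * h * zpow c (p%:Z * (e * m))%R = h2 * zpow c r * zpow c (p%:Z * m)%R.
  by rewrite -(gmulA _ h) Em gmulA -Ef E Ef gmulA.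
have [ee|ee] : e = 1%R \/ e = (-1)%R by lia.
  exists r; first by have := leq_mul (leqnn k) rp; lia.
  by move: E'; rewrite ee GRing.mul1r => /mulIg.
exists f => //.
have E2 : zpow c (p%:Z * m + p%:Z * m)%R = zpow c (- r)%R * h2^-1 * (zpow c r * h).
  have -> : zpow c r * h = h2 * zpow c r * zpow c (p%:Z * m + p%:Z * m)%R.
    rewrite zpowD gmulA -E' -[RHS]gmulA -zpowD ee.
    have -> : (p%:Z * (-1 * m) + p%:Z * m = 0)%R by lia.
    by rewrite zpow0 mulg1.
  by rewrite zpowN !gmulA mulgVK mulVg mul1g.
have := glE (p%:Z * m + p%:Z * m)%R; rewrite E2.
have := len3 sT lg (x := zpow c (- r)%R) (y := h2^-1) (t := zpow c r * h) Logic.I Logic.I Logic.I.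
have := lenM lg (x := zpow c r) (y := h) Logic.I Logic.I.
rewrite !glE abszN (lenV lg) //.
have : k * absz r <= k * p by rewrite leq_mul2l rp orbT.
have : k * absz f <= k * absz r + k * absz (p%:Z * m + p%:Z * m)%R.
  have /(undistorted_zpow_inj (sP i0) (@uP i0) (Pc i0) nc1) -> :
    zpow c f = zpow c (r + p%:Z * m)%R by rewrite zpowD.
  rewrite -mulnDr leq_mul2l; apply/orP; right; lia.
move: (absz (p%:Z * m + _)%R) => q.
by glia.
Qed.

Lemma hyp_conj t s s' : cyclic s -> cyclic s' -> t * wprod s * t^-1 = wprod s' ->
  exists2 t', t' * wprod s * t'^-1 = wprod s' &
    gl t' <= (2 * k + 2) * (cost w s + cost w s') + 3 * k * p.
Proof.
move=> cs cs' E.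
have sz : size s' = size s.
  apply/eqP; rewrite eqn_leq (conj_size_le cs cs' E) /=.
  exact: (conj_size_le cs' cs (conjV E)).
have Ea a : wprod s' ^+ a * t = t * wprod s ^+ a.
  by apply/esym/expg_intertwine; apply: conj_intertwine.
(* One shared period is enough. Powers commute with their base, so by [Et] the edge element [X 0]
   inherits from [t] the property of conjugating [wprod s'] to a rotation of [s]. *)
pose a := (tree_len t + 2 * tree_len t + 1 + 3)%N.
have [a0 [b0 [r [X [_ _ _ E0 /(_ 0 isT) [[f Ef] A]]]]]] :=
  axes_align spl cs' cs sz (Ea a) (leqnn a).
set d := wprod (take r s) in E0; set h2 := wprod (rot r s).
have dh : d * h2 = wprod s * d := wprod_rot r s.
have Et : (wprod s' ^+ a0)^-1 * t * wprod s ^+ b0 = (X 0)^-1 * d^-1.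
  by rewrite E0 !ginvM !gmulA !mulgVK.
have EX : X 0 * wprod s' = h2 * X 0.
  have : ((X 0)^-1 * d^-1) * wprod s = wprod s' * ((X 0)^-1 * d^-1).
    rewrite -Et; apply: intertwineM; last exact: (expgC _ b0 1).
    apply: intertwineM; first by apply: intertwineV; exact: (expgC _ a0 1).
    exact: conj_intertwine.
  rewrite -ginvM => /intertwineV; rewrite invgK -gmulA => Ed.
  by apply: (mulgI d); rewrite gmulA -gmulA Ed !gmulA dh.
have gd : gl d <= cost w s.
  have Rs := cyclic_reduced cs; rewrite -(cat_take_drop r s) in Rs.
  apply: leq_trans (glen_le w (reduced_vertex spl (reduced_prefix Rs))) _.
  by rewrite -{2}(cat_take_drop r s) cost_cat leq_addr.
have gs q : cyclic q -> gl (wprod q) <= cost w q.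
  by move=> cq; apply/glen_le/(reduced_vertex spl)/cyclic_reduced.
suff [f' fB Ef'] : exists2 f' : int,
    k * absz f' <= (2 * k + 1) * (cost w s + cost w s') + 3 * k * p &
    zpow c f' * wprod s' = h2 * zpow c f'.
  exists ((zpow c f')^-1 * d^-1).
    apply: intertwine_conj; apply: intertwineM; first exact: intertwineV Ef'.
    exact: intertwineV dh.
  have := lenM lg (x := (zpow c f')^-1) (y := d^-1) Logic.I Logic.I.
  by rewrite !(lenV lg) // glE; move: gd fB; rewrite !mulnDl; glia.
case: (EM (c = 1)) => [c1|nc1].
  exists 0%R; first by rewrite muln0.
  by rewrite zpow0 mul1g mulg1 -[RHS]mulg1 -(zpow1g G f) -c1 -Ef -EX Ef c1 zpow1g mul1g.
have k0 : 0 < k by case: wnorm => _ /(_ nc1).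
have [le|lt] := leqP (absz f) (2 * (cost w s + cost w s')).
  exists f; last by rewrite -Ef.
  have := leq_mul (leqnn k) le; rewrite !mulnDl mul1n; lia.
have wC : forall (a b : int) x, syllable P c x ->
  absz a <= 2 * (w x + w (zpow c a * x * zpow c b)) \/ commens c p x by case: wnorm.
have Rr := cyclic_reduced (cyclic_rot r cs).
rewrite Ef in A.
have lt' : 2 * (cost w s' + cost w (rot r s)) < absz f by rewrite cost_rot addnC.
have [Hs _] := chain spl lw k0 wE wC (cyclic_reduced cs') Rr A lt'.
have Ef2 : zpow c f * wprod s' = h2 * zpow c f by rewrite -Ef.
have [f' fB Ef'] := edge_residue nc1 (commens_wprod Hs) Ef2.
exists f' => //; apply: leq_trans fB _.
have := gs s' cs'; have := gs _ (cyclic_rot r cs); rewrite cost_rot -/h2.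
by rewrite mulnDl mul1n; glia.
Qed.

End Norm.

Lemma splitting_linear_conj : linear_conj full.
Proof.
move=> l' ll'.
have lc i : linear_conj (P i) by case: (gP i).
have ll'i i : lenfun (P i) l'.
  by case: ll' => a1 a2 a3; split=> // [x y _ _|x _]; [apply: a2 | apply: a3].
have /choice[li Hli] : forall i, exists l, lenfun (P i) l /\
   exists K, forall u v t, P i u -> P i v -> P i t -> t * u * t^-1 = v ->
    exists t', [/\ P i t', t' * u * t'^-1 = v & l' t' <= l u + l v + K].
  by move=> i; have [l ll [K H]] := lc i _ (ll'i i); exists l; split=> //; exists K.
have /choice[Ki HK] := fun i => proj2 (Hli i).
pose K := \sum_i Ki i.
have KK i : Ki i <= K by rewrite /K (bigD1 i) //= leq_addr.
(* Including [l'] makes [glen] dominate it, so conjugators may be estimated by [glen]. Including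
   [li] expresses the bounds in the factors through [w]. *)
have LP i : lenfun (P i) (fun x => l' x + li i x).
  by apply: lenfunD; [apply: ll'i | case: (Hli i)].
have [w [k [p [wn wL]]]] := edge_norm_exists spl gP LP.
have [lw k0 p0 wE _] := wn.
have lg : lenfun full (glen P w) := glen_lenfun spl lw.
have l'w i x : P i x -> l' x <= w x by move=> /wL; lia.
have liw i x : P i x -> li i x <= w x by move=> /wL; lia.
have l'cost s : vertex_word P s -> l' (wprod s) <= cost w s.
  elim: s => [|a s IH]; first by rewrite (len1 ll').
  move=> /vertex_word_cons[[i Pa] /IH le]; rewrite cost_cons.
  by apply: leq_trans (lenM ll' Logic.I Logic.I) (leq_add (l'w _ _ Pa) le).
have l'g g : l' g <= glen P w g.
  have [s [Ns <- <-]] := glen_normal spl lw g; exact/l'cost/(normal_vertex spl).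
have ellcase i u v t : P i u -> P i v -> P i t -> t * u * t^-1 = v ->
    exists2 t', t' * u * t'^-1 = v & l' t' <= w u + w v + K.
  move=> Pu Pv Pt E; have [t' [_ E' le]] := HK i u v t Pu Pv Pt E; exists t' => //.
  by have := liw _ _ Pu; have := liw _ _ Pv; have := KK i; lia.
(* [3 * K] pays for the three vertex conjugators of the elliptic case and [3 * k * p] is the
   constant of [hyp_conj]; [C] covers the coefficients 3 and [2 * k + 2] of the two cases. *)
pose C := (2 * k + 3)%N; pose B := (3 * k * p + 3 * K)%N.
exists (fun x => (C + 1) * glen P w x)%N; first exact: lenfun_scale.
exists B => u v t _ _ _ E.
suff main u0 v0 t0 gu gv : t0 * u0 * t0^-1 = v0 ->
   elliptic P u0 /\ w u0 <= gu \/ (exists q, [/\ cyclic q, wprod q = u0 & cost w q <= gu]) ->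
   elliptic P v0 /\ w v0 <= gv \/ (exists q, [/\ cyclic q, wprod q = v0 & cost w q <= gv]) ->
   exists2 t1, t1 * u0 * t1^-1 = v0 & l' t1 <= C * (gu + gv) + B.
  have [r [u0 [Vr Eu Cr Hu]]] := cyclic_reduction spl lw u.
  have [q [v0 [Vq Ev Cq Hv]]] := cyclic_reduction spl lw v.
  set rr := wprod r in Eu *; set qq := wprod q in Ev *.
  have E0 : (qq^-1 * t * rr) * u0 * (qq^-1 * t * rr)^-1 = v0.
    rewrite !ginvM invgK.
    have <- : qq^-1 * v * qq = v0 by rewrite Ev !gmulA mulVg mul1g mulgVK.
    by rewrite -E Eu !gmulA.
  have [t1 E1 le1] := main _ _ _ _ _ E0 Hu Hv.
  exists (qq * t1 * rr^-1); split=> //.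
    by rewrite Ev -E1 Eu !ginvM invgK !gmulA mulgVK mulgVK.
  have := len3 sT ll' (x := qq) (y := t1) (t := rr^-1) Logic.I Logic.I Logic.I.
  rewrite (lenV ll') //; have := l'cost _ Vr; have := l'cost _ Vq.
  by rewrite -/rr -/qq; move: le1 Cr Cq; rewrite !mulnDr !mulnDl !mul1n; glia.
move=> {t E} E Hu Hv.
case: Hu => [[[i Pu] wu]|[s [cs Ws Cs]]]; case: Hv => [[[j Pv] wv]|[s' [cs' Ws' Cs']]].
- have [x [s [y [Et [Px Py] Ts _]]]] := triple spl lw j i t0.
  (* These are two double coset decompositions of [t0]. By rigidity either [t0] lies in a vertex
     group, or [u0] and [v0] are conjugate to powers of [c] within their own vertex groups. *)
  have Et0 : (v0^-1 * x) * wprod s * (y * u0) = x * wprod s * y.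
    rewrite -Et; have -> : v0^-1 * x * wprod s * (y * u0) = v0^-1 * (t0 * u0).
      by rewrite Et !gmulA.
    by rewrite -E !ginvM invgK !gmulA mulgVK mulgVK.
  have := triple_rigid spl (subgrpM (sP j) (subgrpV (sP j) Pv) Px) (subgrpM (sP i) Py Pu)
    Px Py Ts Ts Et0.
  case=> [[ji s0 _]|[f0 [f1 [E0 A E1]]]].
    have Pt : P i t0.
      by rewrite Et s0 /= mulg1; apply: (subgrpM (sP i)) => //; rewrite -ji.
    have Pv' : P i v0 by rewrite -ji.
    have [t1 E' le] := ellcase i u0 v0 t0 Pu Pv' Pt E; exists t1 => //.
    by rewrite /C /B mulnDl; lia.
  have Eu : y * u0 * y^-1 = zpow c (- f1)%R.
    by rewrite zpowN; apply: (mulgI (zpow c f1)); rewrite gmulA E1 !mulgV.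
  have Ev : x * zpow c (- f0)%R * x^-1 = v0.
    by rewrite zpowN; apply: (mulIg x); rewrite mulgVK; apply: (mulIg (zpow c f0));
       rewrite mulgVK -gmulA -E0 mulVKg.
  have PZ m z : P m (zpow c z) := subgrpZ (sP m) z (Pc m).
  have b1 := edge_conj_bound wn Py Pu Eu.
  have b0 := edge_conj_bound wn (subgrpV (sP j) Px) Pv (conjV Ev).
  have [y1 Ey1 le1] := ellcase i _ _ _ Pu (PZ i _) Py Eu.
  have [x1 Ex1 le0] := ellcase j _ _ _ (PZ j _) Pv Px Ev.
  (* The middle word may be arbitrarily long, but by [aligned_flip] its effect on this power of [c]
     is that of 1 or of a single vertex element, for which the factor supplies a short
     substitute. *)
  have [m Em lem] : exists2 m, m * zpow c (- f1)%R * m^-1 = zpow c (- f0)%R &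
      l' m <= gu + gv + K.
    case: (EM (c = 1)) => [c1|nc1].
      by exists 1; [rewrite c1 !zpow1g !mul1g invg1 | rewrite (len1 ll')].
    have [R _ _] := Ts; case: (aligned_flip wn nc1 R A) => [->|[Ef1 [q [a [Pa Ea]]]]].
      by exists 1; [rewrite mul1g invg1 mulg1 | rewrite (len1 ll')].
    have -> : (- f1 = f0)%R by lia.
    have [m Em le] := ellcase q _ _ _ (PZ q _) (PZ q _) Pa Ea.
    exists m => //; move: b0 b1 le wv wu; rewrite Ef1 !wE !abszN; clear; lia.
  exists (x1 * m * y1); first by rewrite -Ex1 -Em -Ey1 !ginvM !gmulA.
  have := len3 sT ll' (x := x1) (y := m) (t := y1) Logic.I Logic.I Logic.I.
  have hC : 3 * (gu + gv) <= C * (gu + gv) by rewrite leq_mul2r /C; lia.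
  by move: le0 le1 b0 b1 lem wu wv hC; rewrite /B !wE !abszN; move: (C * _)%N => CC; clear; glia.
- by case: (cyclic_not_elliptic cs' Pu (t := t0^-1)); rewrite Ws'; apply: conjV.
- by case: (cyclic_not_elliptic cs Pv (t := t0)); rewrite Ws.
rewrite -Ws -Ws' in E *; have [t1 E1 le1] := hyp_conj wn cs cs' E.
exists t1 => //; apply: leq_trans (l'g _) (leq_trans le1 _).
rewrite /C /B.
have : (2 * k + 2) * (cost w s + cost w s') <= (2 * k + 3) * (gu + gv) by apply: leq_mul; lia.
lia.
Qed.

Theorem splitting_good : good full.
Proof.
split; [by []| exact: (splitting_undistorted spl uP) | | exact: splitting_linear_conj].
exact: (splitting_linear_commens spl gP).
Qed.

End LinearConj.

(** * Transport along injective homomorphisms *)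

Section GoodImage.
Variables (G1 G : groupType) (f : {multiplicative G1 -> G}).
Hypothesis finj : injective f.
Local Notation full := (fun _ : G1 => True).
Let Q (g : G) : Prop := exists y, g = f y.
Let pre (g : G) : G1 := xget 1 [set y | g = f y]%classic.

Let preK y : pre (f y) = y.
Proof.
by apply: finj; have /(xgetI 1) <- : [set z | f y = f z]%classic y by [].
Qed.

Let pullback (l : G1 -> nat) (g : G) : nat := l (pre g).

Lemma subgrp_image : subgrp Q.
Proof.
split=> [|_ _ [x ->] [y ->]|_ [x ->]]; first by exists 1; rewrite hom1.
- by exists (x * y); rewrite gmulfM.
- by exists x^-1; rewrite homV.
Qed.

Let lenfun_pullback l : lenfun full l -> lenfun Q (pullback l).
Proof.
move=> ll; split=> [|_ _ [x ->] [y ->]|_ [x ->]].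
- by rewrite /pullback -(hom1 f) preK (len1 ll).
- by rewrite /pullback -gmulfM !preK; apply: (lenM ll).
- by rewrite /pullback -homV !preK (lenV ll).
Qed.

Let lenfun_comp l : lenfun Q l -> lenfun full (fun y => l (f y)).
Proof.
move=> ll; split=> [|x y _ _|x _]; first by rewrite hom1 (len1 ll).
- by rewrite gmulfM; apply: (lenM ll); [exists x | exists y].
- by rewrite homV (lenV ll) //; exists x.
Qed.

Let fX y n : f (y ^+ n) = f y ^+ n.
Proof. exact: (gmulfz y n (hom1 f)). Qed.

Lemma good_image : good full -> good Q.
Proof.
move=> [_ uF cF lF]; split; first exact: subgrp_image.
- move=> F FQ; case: (uF [seq pre h | h <- F]) => // l ll tl.
  exists (pullback l) => [|h hF]; first exact: lenfun_pullback.
  have [y hy] := FQ h hF.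
  have [k [K [k0 H]]] : tame l y by rewrite -(preK y) -hy; apply: tl; apply: map_f.
  exists k, K; split=> [h1|m]; last by rewrite hy -fX /pullback preK.
  by apply: k0 => y1; apply: h1; rewrite hy y1 hom1.
- move=> _ _ [h ->] [h' ->] h1 h1'.
  have n1 : h <> 1 by move=> e; apply: h1; rewrite e hom1.
  have n1' : h' <> 1 by move=> e; apply: h1'; rewrite e hom1.
  have [l ll [B H]] := cF h h' Logic.I Logic.I n1 n1'.
  exists (pullback l); first exact: lenfun_pullback.
  exists B => a b _ [u ->].
  rewrite -!(gmulfz _ _ (hom1 f)) -!gmulfM /pullback !preK.
  case: (H a b u Logic.I) => [le|[p [q [H1 H2 E]]]]; [by left|right].
  by exists p, q; split=> //; rewrite -fX -(gmulfz _ _ (hom1 f)) -!gmulfM E.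
move=> l' ll'; have [l ll [K H]] := lF _ (lenfun_comp ll').
exists (pullback l); first exact: lenfun_pullback.
exists K => _ _ _ [u ->] [v ->] [t ->] E.
have {}E : t * u * t^-1 = v by apply: finj; rewrite !gmulfM homV.
have [t' [_ E' le]] := H u v t Logic.I Logic.I Logic.I E.
exists (f t'); split; first by exists t'.
- by rewrite -homV -!gmulfM E'.
- by rewrite /pullback !preK.
Qed.

End GoodImage.

(** * Subgroups as groups *)

Section SubgroupType.
Variables (G : groupType) (K : G -> Prop).

Definition sub_pred : {pred G} := fun x => `[< K x >].
Definition subgroup_of of subgrp K : Type := {x : G | x \in sub_pred}.

Variable sK : subgrp K.
HB.instance Definition _ := SubChoice.on (subgroup_of sK).

Lemma sub_pred_closed : group_closed sub_pred.
Proof.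
split; first exact/asboolP/(subgrp1 sK).
move=> x y /asboolP Kx /asboolP Ky; apply/asboolP.
by apply: (subgrpM sK) => //; apply: (subgrpV sK).
Qed.

HB.instance Definition _ :=
  SubChoice_isSubGroup.Build G sub_pred (subgroup_of sK) sub_pred_closed.

Definition subgroup_elt (x : G) (Kx : K x) : subgroup_of sK :=
  exist _ x (introT (asboolP (K x)) Kx).

Lemma subgroup_val (x : subgroup_of sK) : K (val x).
Proof. exact/asboolP/(valP x). Qed.

End SubgroupType.

(** * The normal form theorem for pushouts *)

Section Bijections.
Variable T : Type.

(** The symmetric group of [T], in which the pushout will act on normal forms. *)
Record bij : Type := Bij {
  bfun : T -> T; binv : T -> T; bfunK : cancel bfun binv; binvK : cancel binv bfun }.

Lemma bij_ext (p q : bij) : bfun p = bfun q -> p = q.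
Proof.
case: p q => [f f' K1 K2] [g g' K3 K4] /= E.
have E' : f' = g' by apply/funext => x; rewrite -{1}(K4 x) -E K1.
by subst g g'; congr Bij; apply: Prop_irrelevance.
Qed.

HB.instance Definition _ := gen_eqMixin bij.
HB.instance Definition _ := gen_choiceMixin bij.

Definition bij1 : bij := @Bij id id (fun _ => erefl) (fun _ => erefl).
Definition bijM (p q : bij) : bij :=
  Bij (can_comp (bfunK p) (bfunK q)) (can_comp (binvK q) (binvK p)).
Definition bijV (p : bij) : bij := Bij (binvK p) (bfunK p).

Lemma bijA : associative bijM. Proof. by move=> p q r; apply: bij_ext. Qed.
Lemma bij1M : left_id bij1 bijM. Proof. by move=> p; apply: bij_ext. Qed.
Lemma bijM1 : right_id bij1 bijM. Proof. by move=> p; apply: bij_ext. Qed.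
Lemma bijVM : left_inverse bij1 bijV bijM.
Proof. by move=> p; apply: bij_ext; apply/funext => x /=; rewrite bfunK. Qed.
Lemma bijMV : right_inverse bij1 bijV bijM.
Proof. by move=> p; apply: bij_ext; apply/funext => x /=; rewrite binvK. Qed.

HB.instance Definition _ := isGroup.Build bij bijA bij1M bijM1 bijVM bijMV.
End Bijections.

Section NormalForm.
Variables (I : finType) (i0 : I) (C : groupType) (Gi : I -> groupType).
Variable e : forall i, {multiplicative C -> Gi i}.
Hypothesis einj : forall i, injective (e i).

Let coset i (g : Gi i) : set (Gi i) := [set h | exists a, h = e i a * g]%classic.

(** A transversal of the right cosets of [C], with 1 representing [C] itself, so that the elements
    with trivial representative are exactly those coming from [C]. *)
Definition crep i (g : Gi i) : Gi i :=
  if `[< exists a, g = e i a >] then 1 else xget 1 (coset g).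

Definition cpart i (g : Gi i) : C := xget 1 [set a | g = e i a * crep g]%classic.

Lemma cpartP i (g : Gi i) : g = e i (cpart g) * crep g.
Proof.
suff [a Ha] : exists a, g = e i a * crep g.
  exact: (xgetI 1 (Ha : [set a | g = e i a * crep g]%classic a)).
rewrite /crep; case: asboolP => [[a ->]|_]; first by exists a; rewrite mulg1.
have [a E] : coset g (xget 1 (coset g)).
  by apply: (xgetI 1 (_ : coset g g)); exists 1; rewrite hom1 mul1g.
by exists a^-1; rewrite homV E mulKg.
Qed.

Lemma crepMl i (g : Gi i) (a : C) : crep (e i a * g) = crep g.
Proof.
rewrite /crep; have -> : coset (e i a * g) = coset g.
  apply/predeqP => h; split=> -[b ->].
    by exists (b * a); rewrite gmulfM gmulA.
  by exists (b * a^-1); rewrite gmulfM homV gmulA mulgVK.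
congr (if _ then _ else _); apply: asbool_equiv_eq; split=> -[b E].
  by exists (a^-1 * b); rewrite gmulfM homV -E mulKg.
by exists (a * b); rewrite gmulfM E.
Qed.

Lemma crep_edge i (a : C) : crep (e i a) = 1.
Proof. by rewrite /crep ifT //; apply/asboolP; exists a. Qed.

Lemma crep1_edge i (g : Gi i) : crep g = 1 -> g = e i (cpart g).
Proof. by move=> E; rewrite [LHS]cpartP E mulg1. Qed.

Lemma crep_idem i (g : Gi i) : crep (crep g) = crep g.
Proof. by rewrite -(crepMl (crep g) (cpart g)) -cpartP. Qed.

Lemma cpartMl i (g : Gi i) (a : C) : cpart (e i a * g) = a * cpart g.
Proof.
apply: (einj (i := i)); apply: (mulIg (crep g)).
by rewrite gmulfM -gmulA -cpartP -{1}(crepMl g a) -cpartP.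
Qed.

Lemma cpart1 i (t : Gi i) : t <> 1 -> crep t = t -> cpart t = 1.
Proof.
move=> _ E; apply: (einj (i := i)); apply: (mulIg t).
by rewrite hom1 mul1g -{2}E -cpartP.
Qed.

Definition letter : Type := {i : I & Gi i}.

Fixpoint valid (l : seq letter) : Prop :=
  if l is u :: l' then
    [/\ tagged u <> 1, crep (tagged u) = tagged u,
        if l' is u' :: _ then tag u <> tag u' else True & valid l']
  else True.

Definition avoids i (l : seq letter) : Prop :=
  if l is u :: _ then tag u <> i else True.

(** The pair of [a] and [t1, ..., tn] stands for the product [a t1 ... tn]. *)
Definition pair_form : Type := (C * seq letter)%type.
Implicit Types (x : pair_form) (l w : seq letter).

(* [unfold_at] and [fold_at] identify the normal pairs with [Gi i] times the
   letter sequences not starting with [i]; [Gi i] acts by multiplication on the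
   first factor of the latter. *)
Definition unfold_at i x : Gi i * seq letter :=
  match x.2 with
  | u :: w => match tag u =P i with
              | ReflectT E => (e i x.1 * eq_rect _ Gi (tagged u) i E, w)
              | ReflectF _ => (e i x.1, x.2)
              end
  | [::] => (e i x.1, [::])
  end.

Definition fold_at i (y : Gi i * seq letter) : pair_form :=
  (cpart y.1, if crep y.1 == 1 then y.2 else Tagged Gi (crep y.1) :: y.2).

Lemma unfold_at_avoids i x : avoids i x.2 -> unfold_at i x = (e i x.1, x.2).
Proof.
by case: x => a [|u w] //= ne; rewrite /unfold_at /=; case: eqP.
Qed.

Lemma unfold_at_cons i a (t : Gi i) w :
  unfold_at i (a, Tagged Gi t :: w) = (e i a * t, w).
Proof.
rewrite /unfold_at /=; case: eqP => // E.
by rewrite (Prop_irrelevance E erefl).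
Qed.

Variant unfold_spec i x : Gi i * seq letter -> Prop :=
  | UnfoldAvoids of avoids i x.2 : unfold_spec x (e i x.1, x.2)
  | UnfoldCons t w of x = (x.1, Tagged Gi t :: w) & t <> 1 & crep t = t
      & avoids i w & valid w : unfold_spec x (e i x.1 * t, w).

Lemma unfold_atP i x : valid x.2 -> unfold_spec x (unfold_at i x).
Proof.
case: x => a [|[j t] w] V; first exact: (@UnfoldAvoids i (a, [::]) Logic.I).
have [E|ne] := eqVneq j i; last first.
  rewrite unfold_at_avoids; last exact/eqP.
  by apply: UnfoldAvoids; apply/eqP.
subst j; rewrite (unfold_at_cons a t w); case: V => /= t1 tr ne V.
apply: (@UnfoldCons i (a, Tagged Gi t :: w)) => //.
by case: w ne {V} => //= u w ne E; apply: ne.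
Qed.

Lemma unfold_avoids i x : valid x.2 -> avoids i (unfold_at i x).2.
Proof. by case/unfold_atP. Qed.

Lemma unfold_valid i x : valid x.2 -> valid (unfold_at i x).2.
Proof. by move=> V; case: (unfold_atP i V). Qed.

Lemma fold_valid i g w : valid w -> avoids i w -> valid (@fold_at i (g, w)).2.
Proof.
move=> V A; rewrite /fold_at /=; case: eqP => //= ne; split=> //.
  exact: crep_idem.
by case: w A {V} => //= u w A E; apply: A.
Qed.

Lemma foldK i g w : avoids i w -> unfold_at i (@fold_at i (g, w)) = (g, w).
Proof.
move=> A; rewrite /fold_at /=; case: eqP => [E|_].
  by rewrite unfold_at_avoids //= -crep1_edge.
by rewrite unfold_at_cons -cpartP.
Qed.

Lemma unfoldK i x : valid x.2 -> fold_at (unfold_at i x) = x.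
Proof.
move=> V; case: (unfold_atP i V) => [A|t w -> t1 tr A _]; rewrite /fold_at /=.
  rewrite crep_edge eqxx; case: x {V A} => a l /=; congr pair.
  by apply: (einj (i := i)); rewrite -crep1_edge // crep_edge.
rewrite crepMl tr cpartMl (cpart1 t1 tr) mulg1.
by case: eqP.
Qed.

Definition act i (s : Gi i) x : pair_form :=
  fold_at (s * (unfold_at i x).1, (unfold_at i x).2).

Lemma act_valid i (s : Gi i) x : valid x.2 -> valid (act s x).2.
Proof.
by move=> V; apply: fold_valid; [apply: unfold_valid | apply: unfold_avoids].
Qed.

Lemma actM i (s s' : Gi i) x : valid x.2 -> act s (act s' x) = act (s * s') x.
Proof.
by move=> V; rewrite /act foldK ?gmulA //; apply: unfold_avoids.
Qed.

Lemma act1 i x : valid x.2 -> act (1 : Gi i) x = x.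
Proof. by move=> V; rewrite /act mul1g -surjective_pairing unfoldK. Qed.

Lemma act_edge i (a : C) x : valid x.2 -> act (e i a) x = (a * x.1, x.2).
Proof.
move=> V; rewrite /act -{3 4}(unfoldK i V) /fold_at /=.
by rewrite crepMl cpartMl.
Qed.

Lemma act_cons i (s : Gi i) x : avoids i x.2 -> ~ (exists a, s = e i a) ->
  exists b t, act s x = (b, Tagged Gi (t : Gi i) :: x.2).
Proof.
move=> A nE; rewrite /act unfold_at_avoids // /fold_at /=; case: eqP => [E|_].
  case: nE; exists (cpart (s * e i x.1) * x.1^-1).
  by rewrite gmulfM homV -crep1_edge // mulgK.
by eexists; eexists.
Qed.

Definition normal_pair : Type := {x : pair_form | valid x.2}.

Lemma normal_pair_ext (x y : normal_pair) : sval x = sval y -> x = y.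
Proof. by case: x y => [x px] [y py] /= E; subst y; congr exist; apply: Prop_irrelevance. Qed.

Definition actn i (s : Gi i) (x : normal_pair) : normal_pair :=
  exist _ (act s (sval x)) (act_valid s (svalP x)).

Lemma actnK i (s : Gi i) : cancel (actn s) (actn s^-1).
Proof.
by move=> x; apply: normal_pair_ext; rewrite /= actM ?mulVg ?act1 //; exact: (svalP x).
Qed.

Lemma actnVK i (s : Gi i) : cancel (actn s^-1) (actn s).
Proof.
by move=> x; apply: normal_pair_ext; rewrite /= actM ?mulgV ?act1 //; exact: (svalP x).
Qed.

Definition act_bij i (s : Gi i) : bij normal_pair := Bij (actnK s) (actnVK s).

Lemma act_bijM i : {morph @act_bij i : s s' / s * s'}.
Proof.
move=> s s'; apply: bij_ext; apply/funext => x /=; apply: normal_pair_ext => /=.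
by rewrite actM //; exact: (svalP x).
Qed.

HB.instance Definition _ i :=
  isMultiplicative.Build (Gi i) (bij normal_pair) (@act_bij i) (@act_bijM i).

Definition base_pair : normal_pair := exist (fun x : pair_form => valid x.2) (1, [::]) Logic.I.

Section Pushout.
Variables (G : groupType) (io : forall i, {multiplicative Gi i -> G}).
Hypothesis io_e : forall i j a, io i (e i a) = io j (e j a).
Hypothesis univ : forall (H : groupType) (f : forall i, {multiplicative Gi i -> H}),
  (forall i j a, f i (e i a) = f j (e j a)) ->
  exists phi : {multiplicative G -> H}, forall i y, phi (io i y) = f i y.
Hypothesis uniq_hom : forall (H : groupType) (phi psi : {multiplicative G -> H}),
  (forall i y, phi (io i y) = psi (io i y)) -> phi =1 psi.
Variable c0 : C.
Hypothesis C_cyclic : forall a, exists z : int, a = zpow c0 z.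

Let P i (g : G) : Prop := exists y, g = io i y.
Let c : G := io i0 (e i0 c0).

Lemma edge_io g : edge c g <-> exists a, g = io i0 (e i0 a).
Proof.
have E z : zpow c z = io i0 (e i0 (zpow c0 z)) by rewrite !gmulfz ?hom1.
split=> [[z ->]|[a ->]]; first by exists (zpow c0 z).
by have [z ->] := C_cyclic a; exists z.
Qed.

(* The corestriction to the generated subgroup, followed by the inclusion, is the
   identity by uniqueness. *)
Lemma pushout_generated (g : G) :
  exists s : seq G, (forall u, u \in s -> exists i, P i u) /\ wprod s = g.
Proof.
pose K h := exists s : seq G, (forall u, u \in s -> exists i, P i u) /\ wprod s = h.
have sK : subgrp K.
  split=> [|_ _ [s [Hs <-]] [t [Ht <-]]|_ [s [Hs <-]]].
  - by exists [::].
  - exists (s ++ t); rewrite wprod_cat; split=> // z.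
    by rewrite mem_cat => /orP[/Hs|/Ht].
  - exists (winv s); rewrite wprod_winv; split=> // z.
    rewrite mem_rev => /mapP[y /Hs[i [u ->]] ->]; exists i, u^-1.
    by rewrite homV.
have Kio i (y : Gi i) : K (io i y).
  exists [:: io i y]; rewrite wprod1; split=> // z.
  by rewrite inE => /eqP ->; exists i, y.
pose f i (y : Gi i) : subgroup_of sK := subgroup_elt sK (Kio i y).
have fM i : {morph f i : y y' / y * y'}.
  by move=> y y'; apply: val_inj; rewrite /= gmulfM.
pose F i : {multiplicative Gi i -> subgroup_of sK} :=
  HB.pack (f i) (isMultiplicative.Build _ _ (f i) (fM i)).
have [|phi Hphi] := univ (f := F); first by move=> i j a; apply: val_inj; rewrite /= (io_e i j).
pose v : {multiplicative subgroup_of sK -> G} := val.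
have E : val (phi g) = g.
  by apply: (uniq_hom (phi := v \o phi) (psi := idfun)) => i y; rewrite /= Hphi.
by have := subgroup_val (phi g); rewrite E.
Qed.

Lemma pushout_action : exists phi : {multiplicative G -> bij normal_pair},
  forall i y, phi (io i y) = act_bij y.
Proof.
apply: (univ (f := fun i => (@act_bij i : {multiplicative _ -> _}))) => i j a.
apply: bij_ext; apply/funext => x; apply: normal_pair_ext => /=.
by rewrite !act_edge //; exact: (svalP x).
Qed.

Lemma act_base i (y : Gi i) : act y (1, [::]) = fold_at (y, [::]).
Proof. by rewrite /act /unfold_at /= hom1 mulg1. Qed.

(** An element of a factor can be recovered from the image of the base pair under its action. *)
Lemma pushout_inj i : injective (io i).
Proof.
have [phi Hphi] := pushout_action => y y' E.
have : fold_at (y, [::]) = fold_at (y', [::]).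
  rewrite -!act_base.
  by have /(congr1 (fun b => sval (bfun b base_pair))) := congr1 phi E; rewrite !Hphi.
move/(congr1 (unfold_at i)); rewrite !foldK //.
by case.
Qed.

(** Van der Waerden's method: acting on the base pair, each syllable of a reduced word prepends one
    letter, whereas an element of a vertex group produces at most one. Hence longer reduced words
    lie in no vertex group. *)
Lemma pushout_splitting : splitting i0 P c.
Proof.
have [phi Hphi] := pushout_action.
pose ev (g : G) : pair_form := sval (bfun (phi g) base_pair).
have evV g : valid (ev g).2 by exact: (svalP (bfun (phi g) base_pair)).
have evM i (y : Gi i) g : ev (io i y * g) = act y (ev g).
  by rewrite /ev gmulfM /= Hphi.
have ev1 : ev 1 = (1, [::]) by rewrite /ev hom1.
have evio i (y : Gi i) : ev (io i y) = fold_at (y, [::]).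
  by rewrite -[io i y]mulg1 evM ev1 act_base.
have nE i (y : Gi i) : ~ edge c (io i y) -> ~ exists a, y = e i a.
  by move=> n [a ya]; apply: n; apply/edge_io; exists a; rewrite ya; apply: io_e.
have evE g : edge c g -> (ev g).2 = [::].
  by case/edge_io => a ->; rewrite evio /fold_at /= crep_edge eqxx.
split.
- by move=> i; apply: subgrp_image.
- by move=> i; exists (e i c0); apply: io_e.
- move=> i j _ [y ->] [y' E] ij; apply/edge_io; exists (cpart y).
  have := congr1 ev E; rewrite !evio /fold_at /= => -[_].
  case: eqP => [y1 _|_]; first by rewrite {1}(crep1_edge y1); apply: io_e.
  case: eqP => // _ /(congr1 (fun l => if l is u :: _ then tag u else i)) /= ji.
  by case: ij.
- exact: pushout_generated.
move=> i s R sz [y E].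
have key s' : reduced i0 P c s' -> size (ev (wprod s')).2 = size s' /\
    (if s' is x :: _ then if (ev (wprod s')).2 is u :: _ then tag u = idx i0 P x else False
     else True).
  elim: s' => [|x s' IH]; first by rewrite /= ev1.
  rewrite reduced_cons => /and3P[sx /IH[szs' tg] ja].
  have [ex nx] : (exists i, P i x) /\ ~ edge c x by apply/asboolP.
  have [u Eu] : P (idx i0 P x) x.
    rewrite /idx; case: pickP => [j /asboolP //|none].
    by case: ex => j Pj; have /asboolP := none j.
  have av : avoids (idx i0 P x) (ev (wprod s')).2.
    case: s' szs' tg ja {IH} => [|x' s'] /=; first by move/size0nil => ->.
    by case: (ev _).2 => //= u' l _ -> /eqP ne ji; apply: ne; rewrite ji.
  have nu : ~ exists a, u = e _ a by apply: nE; rewrite -Eu.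
  have [b [t Eact]] := act_cons av nu.
  have Ex : ev (x * wprod s') = (b, Tagged Gi t :: (ev (wprod s')).2).
    by rewrite -Eact -evM -Eu.
  by rewrite /= Ex /= szs'.
have := proj1 (key s R); rewrite E evio /fold_at /=.
by case: eqP => _ /=; lia.
Qed.

End Pushout.
End NormalForm.

Lemma good_trivial (G : groupType) : (forall g : G, g = 1) -> good (fun _ : G => True).
Proof.
move=> triv; split=> [//|F _|h h' _ _ h1|l' ll'].
- exists (fun=> 0) => // h _; exists 0, 0; split=> //; by rewrite (triv h).
- by case: h1.
exists (fun=> 0) => //; exists 0 => u v t _ _ _ _; exists 1.
by rewrite (triv u) (triv v) (len1 ll') mul1g mulgV.
Qed.

(** * The base case: infinite cyclic and free groups *)

Section Integers.
Notation Zg := (GRing.to_multiplicative int).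

Lemma zpow_int (h : Zg) (z : int) : (zpow h z : int) = ((h : int) * z)%R.
Proof.
have X n : ((h ^+ n)%g : int) = ((h : int) * n%:Z)%R.
  elim: n => [|n IH]; first by rewrite GRing.mulr0.
  rewrite expgS -[LHS]/((h : int) + ((h ^+ n)%g : int))%R IH; lia.
case: z => n; first exact: X.
rewrite /= -[LHS]/(- ((h ^+ n.+1)%g : int))%R X; lia.
Qed.

Lemma good_int : good (fun _ : Zg => True).
Proof.
have mulZ (x y : Zg) : x * y = y * x by exact: GRing.addrC.
have l0 : lenfun (fun _ : Zg => True) (fun=> 0) by [].
split=> [//|F _|h h' _ _ h1 h1'|l' ll'].
- exists (fun z : Zg => absz z).
    split=> // [x y _ _|x _]; last exact: abszN.
    by rewrite -[x * y]/((x : int) + y)%R; lia.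
  move=> h _; exists (absz h), 0; split=> [h1|m].
    by rewrite absz_gt0; apply/eqP => h0; apply: h1.
  by rewrite -zpow_nat zpow_int abszM absz_nat; lia.
- have n0 : (h : int) != 0%R by apply/eqP.
  have n0' : (h' : int) != 0%R by apply/eqP.
  (* Nonzero integers are always commensurable, here by [h' * absz h = h * (s * h')]; the sign is
     needed because the first exponent must be positive. *)
  have [s s1 hs] : exists2 s : int, absz s = 1%N & Posz (absz h) = (s * (h : int))%R.
    have [h0|h0] : Posz (absz h) = h \/ Posz (absz h) = (- (h : int))%R by lia.
      by exists 1%R => //; rewrite GRing.mul1r.
    by exists (-1)%R => //; rewrite GRing.mulN1r.
  exists (fun=> 0) => //; exists (absz h + absz h')%N => a b u _; right.
  exists (absz h), (s * (h' : int))%R; split.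
  + by rewrite absz_gt0 n0 leq_addr.
  + by rewrite abszM s1 mul1n absz_gt0 n0' leq_addl.
  rewrite mulZ; congr (_ * _); rewrite -zpow_nat !zpow_int hs.
  by rewrite GRing.mulrCA [((h' : int) * h)%R]GRing.mulrC GRing.mulrCA.
exists (fun=> 0) => //; exists 0 => u v t _ _ _; rewrite mulZ mulKg => ->.
by exists 1; rewrite (len1 ll') mul1g invg1 mulg1.
Qed.

End Integers.

Section FreeGroup.
Variables (X : finType) (G : groupType) (b : X -> G).
Hypothesis fb : free_basis b.
Notation Zg := (GRing.to_multiplicative int).
Notation C := (GRing.to_multiplicative 'I_1).

(** The one-element additive group ['I_1] serves as [C]. An empty basis is treated separately, since
    a splitting requires an index [i0]. *)
Lemma free_good : good (fun _ : G => True).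
Proof.
have [i0 _|noX] := pickP (fun _ : X => true); last first.
  apply: good_trivial => g; have [_ u] := @fb G b.
  by apply: (u idfun (one_fun (T := G) G)) => a; have := noX a.
pose e (i : X) : {multiplicative C -> Zg} := one_fun (T := C) Zg.
have ioM a : {morph (fun z : Zg => zpow (b a) (z : int)) : x y / x * y}.
  by move=> x y; apply: zpowD.
pose io a : {multiplicative Zg -> G} :=
  HB.pack (fun z : Zg => zpow (b a) (z : int)) (isMultiplicative.Build _ _ _ (ioM a)).
have C1 (x y : C) : x = y by rewrite (ord1 x) (ord1 y).
have einj i : injective (e i) by move=> x y _; apply: C1.
pose g1 : Zg := (1%R : int).
have g1E (y : Zg) : zpow g1 (y : int) = y by rewrite zpow_int GRing.mul1r.
have io1 a : io a g1 = b a by [].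
have univ (H : groupType) (f : forall i : X, {multiplicative Zg -> H}) :
  (forall i j a, f i (e i a) = f j (e j a)) ->
  exists phi : {multiplicative G -> H}, forall i y, phi (io i y) = f i y.
  move=> _; have [[phi Hphi] _] := fb (fun a => f a g1).
  exists phi => i y; rewrite /= (gmulfz (b i) y (hom1 phi)) Hphi.
  by rewrite -(gmulfz g1 y (hom1 (f i))) g1E.
have uniq (H : groupType) (phi psi : {multiplicative G -> H}) :
  (forall i y, phi (io i y) = psi (io i y)) -> phi =1 psi.
  move=> E; have [_ u] := fb (fun a => phi (b a)).
  by apply: u => // a; rewrite -io1 E.
have io_e i j (a : C) : io i (e i a) = io j (e j a) by [].
have cyc (a : C) : exists z : int, a = zpow (1 : C) z by exists 0%R; apply: C1.
have spl := pushout_splitting i0 einj io_e univ uniq cyc.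
apply: (splitting_good spl) => i; apply: good_image good_int.
exact: (pushout_inj einj univ (i := i)).
Qed.

End FreeGroup.

(** * The inductive step: amalgams over a cyclic group *)

Section CyclicAmalgam.
Variables (C G1 G2 G : groupType).
Variables (e1 : {multiplicative C -> G1}) (e2 : {multiplicative C -> G2}).
Variables (i1 : {multiplicative G1 -> G}) (i2 : {multiplicative G2 -> G}).
Hypothesis cycC : infinite_cyclic C.
Hypothesis amal : amalgam e1 e2 i1 i2.

Lemma infinite_cyclic_zpow : exists c0 : C, forall a, exists z : int, a = zpow c0 z.
Proof.
have [[c0 Hc] _] := cycC; exists c0 => a.
case: (Hc a) => n [->|->]; first by exists n%:Z%R.
by exists (- n%:Z)%R; rewrite zpowN.
Qed.

Lemma amalgam_good : good (fun _ : G1 => True) -> good (fun _ : G2 => True) ->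
  good (fun _ : G => True).
Proof.
move=> g1 g2; have [c0 cyc] := infinite_cyclic_zpow.
have [inj1 inj2 comm univ0] := amal.
pose Gi (b : bool) : groupType := if b then G1 else G2.
pose e (b : bool) : {multiplicative C -> Gi b} :=
  match b return {multiplicative C -> Gi b} with true => e1 | false => e2 end.
pose io (b : bool) : {multiplicative Gi b -> G} :=
  match b return {multiplicative Gi b -> G} with true => i1 | false => i2 end.
have einj b : injective (e b) by case: b.
have io_e b b' a : io b (e b a) = io b' (e b' a) by case: b; case: b' => /=.
have univ (H : groupType) (f : forall b, {multiplicative Gi b -> H}) :
  (forall i j a, f i (e i a) = f j (e j a)) ->
  exists phi : {multiplicative G -> H}, forall i y, phi (io i y) = f i y.
  move=> fe; have [[phi [H1 H2]] _] := univ0 H (f true) (f false) (fe true false).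
  by exists phi; case.
have uniq (H : groupType) (phi psi : {multiplicative G -> H}) :
  (forall i y, phi (io i y) = psi (io i y)) -> phi =1 psi.
  move=> E; have cE a : (phi \o i1) (e1 a) = (phi \o i2) (e2 a) by rewrite /= comm.
  have [_ u] := univ0 H (phi \o i1) (phi \o i2) cE.
  by apply: u => // y; [rewrite -(E true) | rewrite -(E false)].
have spl := pushout_splitting true einj io_e univ uniq cyc.
apply: (splitting_good spl) => b; apply: good_image; last by case: b.
exact: (pushout_inj einj univ (i := b)).
Qed.

End CyclicAmalgam.

(** * Presentations and word length *)

Section Words.
Implicit Types (X Y : Type).

Lemma weval_nil X (G : groupType) (x : X -> G) : weval x [::] = 1.
Proof. exact: big_nil. Qed.

Lemma weval_cat X (G : groupType) (x : X -> G) w1 w2 :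
  weval x (w1 ++ w2) = weval x w1 * weval x w2.
Proof. exact: big_cat. Qed.

Lemma weval_cons X (G : groupType) (x : X -> G) l w :
  weval x (l :: w) = (if l.2 then x l.1 else (x l.1)^-1) * weval x w.
Proof. exact: big_cons. Qed.

Lemma weval_hom X (G H : groupType) (f : {multiplicative G -> H}) (x : X -> G)
  (y : X -> H) w : (forall a, f (x a) = y a) -> f (weval x w) = weval y w.
Proof.
move=> xy; elim: w => [|[a []] w IH]; first by rewrite !weval_nil hom1.
- by rewrite !weval_cons gmulfM IH /= xy.
- by rewrite !weval_cons gmulfM IH /= homV xy.
Qed.

Definition word_inv X (w : word X) : word X := rev [seq (l.1, ~~ l.2) | l <- w].

Lemma weval_inv X (G : groupType) (x : X -> G) w : weval x (word_inv w) = (weval x w)^-1.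
Proof.
elim: w => [|[a s] w IH]; first by rewrite weval_nil invg1.
rewrite /word_inv /= rev_cons -cats1 weval_cat -/(word_inv w) IH !weval_cons weval_nil mulg1.
by rewrite ginvM /=; case: s; rewrite //= invgK.
Qed.

Lemma size_word_inv X (w : word X) : size (word_inv w) = size w.
Proof. by rewrite size_rev size_map. Qed.

Definition word_map X Y (f : X -> Y) (w : word X) : word Y := [seq (f l.1, l.2) | l <- w].

Lemma weval_map X Y (G : groupType) (f : X -> Y) (y : Y -> G) w :
  weval y (word_map f w) = weval (y \o f) w.
Proof. exact: big_map. Qed.

End Words.

(** By uniqueness the identity of [G] factors through the subgroup of values of words. *)
Lemma presentation_generates (X : finType) (R : seq (word X)) (G : groupType) (x : X -> G) :
  presentation R x -> forall g, exists w, weval x w = g.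
Proof.
move=> [Rx univ] g; pose K h := exists w, weval x w = h.
have sK : subgrp K.
  split=> [|_ _ [w <-] [w' <-]|_ [w <-]].
  - by exists [::]; rewrite weval_nil.
  - by exists (w ++ w'); rewrite weval_cat.
  - by exists (word_inv w); rewrite weval_inv.
have Kx a : K (x a) by exists [:: (a, true)]; rewrite weval_cons weval_nil mulg1.
pose v : {multiplicative subgroup_of sK -> G} := val.
pose y a : subgroup_of sK := subgroup_elt sK (Kx a).
have [|[phi Hphi] _] := univ _ y.
  move=> w /Rx E; apply: val_inj; apply: etrans (@weval_hom _ _ _ v y x w _) _ => //; by rewrite E.
have [_ u] := univ G x Rx.
have E : val (phi g) = g.
  by apply: (u (v \o phi) idfun) => // a; rewrite /= Hphi.
by have := subgroup_val (phi g); rewrite E.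
Qed.

Lemma free_finitely_presented (X : finType) (G : groupType) (b : X -> G) :
  free_basis b -> finitely_presented G.
Proof. by move=> fb; exists X, [::], b; split=> // H f _; apply: fb. Qed.

(** As [C] is cyclic, a single relation between words for the two images of its generator expresses
    the amalgamation. *)
Lemma amalgam_finitely_presented (C G1 G2 G : groupType)
    (e1 : {multiplicative C -> G1}) (e2 : {multiplicative C -> G2})
    (i1 : {multiplicative G1 -> G}) (i2 : {multiplicative G2 -> G}) :
  infinite_cyclic C -> amalgam e1 e2 i1 i2 ->
  finitely_presented G1 -> finitely_presented G2 -> finitely_presented G.
Proof.
move=> cycC [_ _ comm univ] [X1 [R1 [x1 p1]]] [X2 [R2 [x2 p2]]].
have [c0 cyc] := infinite_cyclic_zpow cycC.
have [w1 E1] := presentation_generates p1 (e1 c0).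
have [w2 E2] := presentation_generates p2 (e2 c0).
pose x (s : X1 + X2) : G := match s with inl a => i1 (x1 a) | inr a => i2 (x2 a) end.
have xl w : weval (x \o inl) w = i1 (weval x1 w) by apply/esym/weval_hom.
have xr w : weval (x \o inr) w = i2 (weval x2 w) by apply/esym/weval_hom.
exists (X1 + X2)%type, ([seq word_map inl w | w <- R1] ++ [seq word_map inr w | w <- R2] ++
  [:: word_map inl w1 ++ word_inv (word_map inr w2)]), x.
have [r1 u1] := p1; have [r2 u2] := p2.
split=> [w|H f fR].
  rewrite !mem_cat inE => /or3P[/mapP[v vR ->]|/mapP[v vR ->]|/eqP ->].
  - by rewrite weval_map xl r1 // hom1.
  - by rewrite weval_map xr r2 // hom1.
  - by rewrite weval_cat weval_inv !weval_map xl xr E1 E2 comm mulgV.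
have f1 w : w \in R1 -> weval (f \o inl) w = 1.
  by move=> wR; rewrite -weval_map; apply: fR; rewrite mem_cat map_f.
have f2 w : w \in R2 -> weval (f \o inr) w = 1.
  by move=> wR; rewrite -weval_map; apply: fR; rewrite !mem_cat map_f ?orbT.
have f3 : weval (f \o inl) w1 = weval (f \o inr) w2.
  apply: divg1_eq; rewrite -(weval_map inl f) -(weval_map inr f) -weval_inv -weval_cat.
  apply: fR.
  by rewrite !mem_cat inE eqxx !orbT.
have [[phi1 H1] v1] := u1 H _ f1; have [[phi2 H2] v2] := u2 H _ f2.
have cE a : phi1 (e1 a) = phi2 (e2 a).
  have [z ->] := cyc a; rewrite !gmulfz ?hom1 // -E1 -E2.
  by rewrite (weval_hom _ H1) (weval_hom _ H2) f3.
have [[phi [P1 P2]] up] := univ H phi1 phi2 cE.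
split; first by exists phi; case=> a /=; rewrite ?P1 ?P2 ?H1 ?H2.
move=> p q Hp Hq; apply: up => y.
- by apply: (v1 (p \o i1) phi1) => a //=; rewrite -(Hp (inl a)).
- by apply: (v2 (p \o i2) phi2) => a //=; rewrite -(Hp (inr a)).
- by apply: (v1 (q \o i1) phi1) => a //=; rewrite -(Hq (inl a)).
- by apply: (v2 (q \o i2) phi2) => a //=; rewrite -(Hq (inr a)).
Qed.

(** * Word length and the conjugator length function *)

Section WordLength.
Variables (X : finType) (G : groupType) (x : X -> G).
Hypothesis gen : forall g, exists w, weval x w = g.

Lemma wlen_le w : wlen x (weval x w) <= size w.
Proof.
by have [_] := @nat_minP [set m | exists w' : word X, weval x w' = weval x w /\ size w' = m]%classic
  (size w) (ex_intro _ w (conj erefl erefl)); apply; exists w.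
Qed.

Lemma wlen_word g : exists2 w, weval x w = g & size w = wlen x g.
Proof.
have [w wg] := gen g.
have [[w' [E S]] _] := @nat_minP [set m | exists w' : word X, weval x w' = g /\ size w' = m]%classic
  (size w) (ex_intro _ w (conj wg erefl)).
by exists w'.
Qed.

Lemma wlen_lenfun : lenfun (fun _ : G => True) (wlen x).
Proof.
have leV g : wlen x g^-1 <= wlen x g.
  have [w <- <-] := wlen_word g; rewrite -weval_inv -(size_word_inv w); exact: wlen_le.
split=> [|g h _ _|g _].
- by apply/eqP; rewrite -leqn0 -(weval_nil x); apply: wlen_le.
- have [w <- <-] := wlen_word g; have [w' <- <-] := wlen_word h.
  by rewrite -weval_cat -size_cat; apply: wlen_le.
by apply/eqP; rewrite eqn_leq leV -{1}[g]invgK leV.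
Qed.

(** Turns a bound by a length of one's choice into a bound by word length. *)
Lemma wlen_dominates l : lenfun (fun _ : G => True) l ->
  exists K, forall g, l g <= K * wlen x g.
Proof.
move=> ll; exists (\sum_a l (x a))%N => g.
have [w <- <-] := wlen_word g.
elim: w => [|[a s] w IH]; first by rewrite weval_nil (len1 ll).
rewrite weval_cons /= mulnS; apply: leq_trans (lenM ll Logic.I Logic.I) _.
apply: leq_add IH; apply: (@leq_trans (l (x a))).
  by case: s; rewrite ?(lenV ll).
by rewrite (bigD1 a) //= leq_addr.
Qed.

Lemma CL_linear : linear_conj (fun _ : G => True) -> exists A B, forall n, CL x n <= A * n + B.
Proof.
move=> lc; have [l ll [K H]] := lc _ wlen_lenfun.
have [A HA] := wlen_dominates ll; exists A, K => n.
(* The default value 0 satisfies the bound trivially; the remaining case is a maximum attained at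
   [u] and [v]. *)
rewrite /CL /nat_max; case: xgetP => // m -> [[u [v [[t E] uv <-]]] _].
have [t' [_ E' le]] := H u v t Logic.I Logic.I Logic.I E.
have [_ dmin] := @nat_minP [set m | exists t : G, t * u * t^-1 = v /\ wlen x t = m]%classic
  (wlen x t') (ex_intro _ t' (conj E' erefl)).
apply: leq_trans (dmin _ (ex_intro _ t' (conj E' erefl))) _.
apply: leq_trans le _; rewrite leq_add2r.
apply: leq_trans (leq_add (HA u) (HA v)) _.
by rewrite -mulnDr leq_mul2l uv orbT.
Qed.

End WordLength.

Lemma calA_good (Lambda : countType) (r : nat) (G : groupType) : calA Lambda r G ->
  good (fun _ : G => True) /\ finitely_presented G.
Proof.
elim: r G => [|r IH] G /=.
  by move=> [S [b fb]]; split; [apply: free_good fb | apply: free_finitely_presented fb].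
case=> [/IH //|[G1 [G2 [C [e1 [e2 [i1 [i2 [/IH[g1 p1] /IH[g2 p2] cC am]]]]]]]]].
by split; [apply: amalgam_good am g1 g2 | apply: amalgam_finitely_presented am p1 p2].
Qed.

Theorem corollary1p2 (Lambda : countType) (r : nat) (G : groupType)
    (hG : calA Lambda r G) :
  finitely_presented G /\
  forall (X : finType) (R : seq (word X)) (x : X -> G),
    presentation R x -> simeq (CL x) (fun n => n).
Proof.
have [[_ _ _ lc] fp] := calA_good hG; split=> // X R x pr.
have [A [B le]] := CL_linear (presentation_generates pr) lc.
(* The linear summand in [preceq] already gives the lower bound. *)
split; last by exists 1%N => // n; lia.
exists (A + B + 1)%N => [|n]; first by rewrite addn1.
by have := le n; nia.
Qed.
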